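(* Let $\Pi=(p_1,\dots,p_d)$ with real $p_i\ge1$, and $p_{\max}:=\max_i p_i$. Let $X:[0,T]\to G_\Pi$ be a weakly geometric $\Pi$-rough path, and let $f_i:\mathbb{R}^n\to\mathbb{R}^n$ be $Lip(\gamma_i)$ for some $\gamma_i>p_{\max}(1-p_i^{-1})+1$, $i=1,\dots,d$. Let $y:[0,T]\to\mathbb{R}^n$ denote the unique path-level solution of the rough differential equation $$dy_t=\sum_{i=1}^d f_i(y_t)\,dX_t^i,\qquad y_0=\xi\in\mathbb{R}^n .$$ Denote $\theta:=\min_{w\in W,\,|w|>1}|w|$. Then there exists a constant $C$ that only depends on $p_1,\dots,p_d,d$ such that $$\left|y_t-y_s-\sum_{w\in W,\;0<|w|\le1}F^w(y_s)\,(X_{s,t},w)\right|\le C\left(\omega_{\bar X}(s,t)^\theta\wedge\omega_{\bar X}(s,t)\right)$$ for every $0\le s\le t\le T$.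
   Context: Words: $W$ is the set of finite sequences (words) in $\{1,\dots,d\}$, including the empty word $\varepsilon$. For $w=i_1\cdots i_m\in W$, $|w|:=\frac1{p_{i_1}}+\cdots+\frac1{p_{i_m}}$, and $|\varepsilon|:=0$. Group $G_\Pi$: the set of maps $a:\{w\in W:|w|\le1\}\to\mathbb{R}$, $w\mapsto(a,w)$, with $(a,\varepsilon)=1$ and $(a,w_1)(a,w_2)=(a,sh(w_1\otimes w_2))$ whenever $|w_1|+|w_2|\le1$, where $sh(w_1\otimes w_2)$ is the sum (with multiplicity) of all shuffles of $w_1$ and $w_2$ and $(a,\cdot)$ is extended linearly. It is a group under $(ab,w)=\sum_{uv=w}(a,u)(b,v)$ ($uv$ = concatenation). Rough paths: for $X:[0,T]\to G_\Pi$ put $X_{s,t}:=X_s^{-1}X_t$ and $$\omega_X(s,t):=\sum_{w\in W,\,0<|w|\le1}\ \sup_{n\ge1,\ s=t_0<t_1<\cdots<t_n=t}\ \sum_{k=0}^{n-1}|(X_{t_k,t_{k+1}},w)|^{1/|w|}.$$ $X$ is a weakly geometric $\Pi$-rough path if it is continuous and $\omega_X(0,T)<\infty$. Lipschitz functions (in the sense of Stein/Lyons): for $\gamma>0$ and $k$ the largest integer strictly less than $\gamma$, $f:\mathbb{R}^n\to\mathbb{R}^n$ is $Lip(\gamma)$ if $f$ is $k$ times differentiable and there is $M$ such that, for $j=0,\dots,k$ and all $x,y$, $|D^jf(x)|\le M$ and $\left|D^jf(y)-\sum_{l=0}^{k-j}\frac{1}{l!}D^{j+l}f(x)(y-x)^{\otimes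 l}\right|\le M|y-x|^{\gamma-j}$. The smallest such $M$ is $\|f\|_{Lip(\gamma)}$. The rescaled path $\bar X:[0,T]\to G_\Pi$ is defined by $(\bar X_t,i_1\cdots i_k)=\|f_{i_1}\|_{Lip(\gamma_{i_1})}\cdots\|f_{i_k}\|_{Lip(\gamma_{i_k})}(X_t,i_1\cdots i_k)$, and $\omega_{\bar X}$ is $\omega$ computed from $\bar X$. Functions $F^w$: for $f,\varphi:\mathbb{R}^n\to\mathbb{R}^n$ put $f(\varphi):=(D\varphi)f$ and $(f\circ g)(\varphi):=f(g(\varphi))$. With $I$ the identity map of $\mathbb{R}^n$, $F^{i_1\cdots i_m}:=(f_{i_1}\circ\cdots\circ f_{i_m})(I)$ and $F^\varepsilon:=I$. Thus $F^i=f_i$ and $F^{iw}=(DF^w)f_i$. Path-level solution: for a continuous bounded variation path $x:[0,T]\to\mathbb{R}^d$, let $(S(x)_{s,t},i_1\cdots i_m)=\int_{s<u_1<\cdots<u_m<t}dx^{i_1}_{u_1}\cdots dx^{i_m}_{u_m}$. For $p_i'>p_i$ sufficiently close to $p_i$ (so that $\gamma_i>p'_{\max}(1-1/p'_i)+1$ and the set of words $\{|w|\le1\}$ is the same for $\Pi'=(p_1',\dots,p_d')$ as for $\Pi$), there are continuous bounded variation paths $x^{(m)}$ with $S(x^{(m)})\to X$ in $\Pi'$-variation, i.e. $\sup\sum_k|(S(x^{(m)})_{t_k,t_{k+1}},w)-(X_{t_k,t_{k+1}},w)|^{1/|w|'}\to0$ for every $w$ with $0<|w|\le1$, where the sup is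 over partitions of $[0,T]$ and $|w|'$ is $|w|$ computed with $\Pi'$. The unique path-level solution $y$ is the uniform limit (independent of choices; existence and uniqueness is a known result of Gyurkó) of the solutions of the ODEs $dy^{(m)}_t=\sum_i f_i(y^{(m)}_t)\,dx^{(m),i}_t$, $y_0^{(m)}=\xi$. *)

(* Defs.v *)
(* MathComp-Analysis; the reals are an arbitrary R : realType, R^n is 'rV[R]_n
   and the letters 1..d are the elements of 'I_d. *)
From mathcomp Require Import all_boot all_order all_algebra.
From mathcomp Require Import all_classical all_reals all_analysis.

Set Implicit Arguments.
Unset Strict Implicit.
Unset Printing Implicit Defensive.

Import Order.TTheory GRing.Theory Num.Theory.
Import numFieldNormedType.Exports.

Local Open Scope classical_set_scope.
Local Open Scope ring_scope.

Section Words.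
Context {R : realType} {d : nat}.
Implicit Types (p : 'I_d -> R) (w : seq 'I_d).

Definition wlen p w : R := \sum_(i <- w) (p i)^-1.

Definition words p : set (seq 'I_d) := [set w | 0 < wlen p w <= 1].

(* The base value 0 is harmless: the maximum is only used for 0 < d and
   p i >= 1. *)
Definition pmax p : R := \big[Num.max/0]_(i < d) p i.

(* The infimum is a minimum, see [theta_min]. *)
Definition theta p : R := inf [set wlen p w | w in [set w | 1 < wlen p w]].

(* All the shuffles of two words, listed with multiplicity. *)
Fixpoint shuffle (u : seq 'I_d) : seq 'I_d -> seq (seq 'I_d) :=
  if u is i :: u' then
    fix shuffle_u (v : seq 'I_d) : seq (seq 'I_d) :=
      if v is j :: v' then
        [seq i :: w | w <- shuffle u' v] ++ [seq j :: w | w <- shuffle_u v']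
      else [:: u]
  else fun v => [:: v].

Lemma wlen_ge0 p w : (forall i, 0 < p i) -> 0 <= wlen p w.
Proof. by move=> p0; apply: sumr_ge0 => i _; rewrite invr_ge0 ltW. Qed.

Lemma finite_wlen_le p c :
  (forall i, 0 < p i) -> finite_set [set w | wlen p w <= c].
Proof.
move=> p0.
have finN N : finite_set [set w : seq 'I_d | (size w <= N)%N].
  elim: N => [|N IH].
    by apply: (sub_finite_set _ (finite_set1 [::])) => w /=; case: w.
  have fX := finite_setX (@finite_finset 'I_d setT) IH.
  have fU : finite_set ([set [::]] `|`
      (fun iw : 'I_d * seq 'I_d => iw.1 :: iw.2) @`
      (setT `*` [set w : seq 'I_d | (size w <= N)%N])).
    by rewrite finite_setU; split; [exact: finite_set1|exact: finite_image].
  apply: sub_finite_set fU => -[|i w] /= sw; [by left|right].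
  by exists (i, w).
pose M : R := \big[Num.max/1]_(i < d) p i.
have M1 : 1 <= M by exact: bigmax_ge_id.
have M0 : 0 < M by exact: lt_le_trans M1.
have [m cm] : exists m : nat, c * M < m%:R.
  by exists (Num.truncn (c * M)).+1; exact: truncnS_gt.
apply: (sub_finite_set _ (finN m)) => w /= wc.
rewrite -(ler_nat R); apply: le_trans (ltW cm).
rewrite -ler_pdivrMr//; apply: le_trans wc; rewrite /wlen.
elim: w => [|i w IH]; first by rewrite big_nil mul0r.
rewrite big_cons /= -addn1 natrD mulrDl addrC lerD// div1r lef_pV2 ?posrE//.
exact: le_bigmax.
Qed.

Lemma finite_words p : (forall i, 0 < p i) -> finite_set (words p).
Proof.
move=> p0; apply: (sub_finite_set _ (finite_wlen_le 1 p0)) => w /=.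
by case/andP.
Qed.

Lemma theta_min p : (0 < d)%N -> (forall i, 0 < p i) ->
  (exists2 w, 1 < wlen p w & wlen p w = theta p) /\
  (forall w, 1 < wlen p w -> theta p <= wlen p w).
Proof.
move=> d0 p0; pose A := [set wlen p w | w in [set w | 1 < wlen p w]].
have Alb : lbound A 0 by move=> _ [w _ <-]; exact: wlen_ge0.
have lb w : 1 < wlen p w -> theta p <= wlen p w.
  by move=> w1; apply: ge_inf; [exists 0|exists w].
split=> //.
pose i0 := Ordinal d0; pose m := (Num.truncn (p i0)).+1.
have w01 : 1 < wlen p (nseq m i0).
  rewrite /wlen big_nseq.
  have -> : iter m (fun x => (p i0)^-1 + x) 0 = (p i0)^-1 *+ m.
    by elim: m => // k /= ->; rewrite mulrS.
  by rewrite -[_ *+ m]mulr_natl ltr_pdivlMr// mul1r; exact: truncnS_gt.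
pose B := [set w | 1 < wlen p w /\ wlen p w <= wlen p (nseq m i0)].
have Bfin : finite_set B.
  by apply: (sub_finite_set _ (finite_wlen_le (wlen p (nseq m i0)) p0)) => w [].
have [s Bs] : exists s : seq (seq 'I_d), B = [set` s].
  by move: Bfin; rewrite finite_seqP.
have w0s : nseq m i0 \in s.
  by have : B (nseq m i0) by []; rewrite Bs.
pose k0 := Ordinal (etrans (index_mem _ _) w0s : index (nseq m i0) s < size s)%N.
case: (@Order.TotalTheory.arg_minP _ _ _ k0 xpredT (fun k => wlen p (nth [::] s k))) => // k _ kmin.
have [k1 kw] : B (nth [::] s k) by rewrite Bs /=; exact: mem_nth.
exists (nth [::] s k) => //; apply/le_anti/andP; split; last exact: lb.
apply: lb_le_inf; first by exists (wlen p (nseq m i0)), (nseq m i0).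
move=> _ [v /= v1 <-]; case: (leP (wlen p v) (wlen p (nseq m i0))) => [vw|/ltW].
  have vs : v \in s by have : B v by []; rewrite Bs.
  have vk : (index v s < size s)%N by rewrite index_mem.
  by have := kmin (Ordinal vk) isT; rewrite /= nth_index.
exact: le_trans.
Qed.

End Words.

(* A map {w | wlen p w <= 1} -> R is encoded by a total function on words whose
   values at the other words are arbitrary. Every notion below reads it only at
   words w with wlen p w <= 1: the product, the unit and the inverse at w only
   involve factors of w, whose length is at most wlen p w. *)
Section Group.
Context {R : realType} {d : nat}.
Implicit Types (p : 'I_d -> R) (a b : seq 'I_d -> R) (w : seq 'I_d).

Definition in_G p a : Prop :=
  a [::] = 1 /\
  forall u v, wlen p u + wlen p v <= 1 ->
    a u * a v = \sum_(w <- shuffle u v) a w.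

Definition gone w : R := (w == [::])%:R.

Definition gmul a b w : R :=
  \sum_(k < (size w).+1) a (take k w) * b (drop k w).

(* The Neumann series of (1 - (1 - a))^-1; only the powers of 1 - a of order at
   most size w contribute at w. It is the two-sided inverse of a, see [gmulV]
   and [gmulVl]. *)
Definition ginv a w : R :=
  \sum_(k < (size w).+1) iter k (gmul (fun v => gone v - a v)) gone w.

Lemma gmul_cons a b i w :
  gmul a b (i :: w) = a [::] * b (i :: w) + gmul (fun v => a (i :: v)) b w.
Proof. by rewrite /gmul big_ord_recl. Qed.

Lemma gmul_nil a b : gmul a b [::] = a [::] * b [::].
Proof. by rewrite /gmul big_ord_recl big_ord0 addr0. Qed.

Lemma gmulDl a b c w :
  gmul (fun v => a v + b v) c w = gmul a c w + gmul b c w.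
Proof.
by rewrite /gmul -big_split; apply: eq_bigr => k _; rewrite /= mulrDl.
Qed.

Lemma gmulNl a c w : gmul (fun v => - a v) c w = - gmul a c w.
Proof. by rewrite /gmul -sumrN; apply: eq_bigr => k _; rewrite mulNr. Qed.

Lemma gmulZl x a c w : gmul (fun v => x * a v) c w = x * gmul a c w.
Proof. by rewrite /gmul mulr_sumr; apply: eq_bigr => k _; rewrite mulrA. Qed.

Lemma eq_gmul a a' b b' : a =1 a' -> b =1 b' -> gmul a b =1 gmul a' b'.
Proof. by move=> aE bE w; apply: eq_bigr => k _; rewrite aE bE. Qed.

Lemma gmulA a b c w : gmul a (gmul b c) w = gmul (gmul a b) c w.
Proof.
elim: w a => [|i w IH] a; first by rewrite !gmul_nil mulrA.
rewrite 2!gmul_cons IH gmul_cons gmul_nil mulrDr mulrA -addrA; congr (_ + _).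
rewrite -gmulZl -gmulDl; apply: eq_gmul => // v.
by rewrite gmul_cons.
Qed.

Lemma gmul1l a w : gmul gone a w = a w.
Proof.
rewrite /gmul big_ord_recl /= take0 drop0 /gone eqxx mul1r big1 ?addr0// => k _.
by case: w k => [[]//|i w k]; rewrite mul0r.
Qed.

Lemma gmul1r a w : gmul a gone w = a w.
Proof.
rewrite /gmul big_ord_recr /= take_size drop_size /gone eqxx mulr1 big1 ?add0r//.
move=> k _; case: eqP => [/(congr1 size)/eqP|]; last by rewrite mulr0.
by rewrite size_drop subn_eq0 leqNgt ltn_ord.
Qed.

Lemma gmulV a w : a [::] = 1 -> gmul a (ginv a) w = gone w.
Proof.
move=> a1; pose z v := gone v - a v; pose P k := iter k (gmul z) gone.
have z0 : z [::] = 0 by rewrite /z a1 /gone eqxx subrr.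
have P0 k v : (size v < k)%N -> P k v = 0.
  elim: k v => // k IH v vk; rewrite /P iterS -/(P k) {1}/gmul big_ord_recl.
  rewrite [take _ v]take0 z0 mul0r add0r big1// => j _.
  by rewrite IH ?mulr0// size_drop lift0 subnSK// (leq_trans (leq_subr _ _)).
have PE N v : (size v < N)%N -> ginv a v = \sum_(k < N) P k v.
  move=> vN; rewrite /ginv (big_ord_widen _ (fun k => P k v) vN) big_mkcond /=.
  apply: eq_bigr => k _; case: ifPn => //; rewrite ltnS -ltnNge => /P0 ->//.
have -> : gmul a (ginv a) w = gmul gone (ginv a) w - gmul z (ginv a) w.
  rewrite -gmulNl -gmulDl; apply: eq_gmul => // v.
  by rewrite /z opprB addrCA subrr addr0.
rewrite gmul1l; set N := (size w).+1.
have -> : gmul z (ginv a) w = \sum_(k < N) P k.+1 w.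
  rewrite /P; under [RHS]eq_bigr do rewrite iterS /gmul.
  rewrite exchange_big /=; apply: eq_bigr => j _.
  by rewrite -mulr_sumr (PE N)// size_drop ltnS leq_subr.
rewrite (PE N)// -sumrB; under eq_bigr do rewrite -opprB.
rewrite sumrN -(big_mkord xpredT (fun k => P k.+1 w - P k w)).
by rewrite telescope_sumr// (P0 N)// sub0r opprK.
Qed.

Lemma gmulVl a w : a [::] = 1 -> gmul (ginv a) a w = gone w.
Proof.
move=> a1; pose b := ginv a.
have b1 : b [::] = 1.
  by rewrite /b /ginv big_ord_recl big_ord0 addr0.
rewrite -[RHS](gmulV w b1); apply: eq_gmul => // v.
rewrite -[LHS]gmul1r -[RHS]gmul1l.
transitivity (gmul a (gmul b (ginv b)) v).
  by apply: eq_gmul => // u; rewrite gmulV.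
by rewrite gmulA; apply: eq_gmul => // u; rewrite gmulV.
Qed.

End Group.

Section RoughPath.
Context {R : realType} {d : nat}.
Implicit Types (p : 'I_d -> R) (X : R -> seq 'I_d -> R) (w : seq 'I_d).

Definition incr X (s t : R) : seq 'I_d -> R := gmul (ginv (X s)) (X t).

(* The partition s = t_0 < ... < t_n = t is the sequence P = [:: t_1; ...; t_n].
   For s = t the only partition is the empty one, so that pvar q A s s = 0. *)
Definition pvar (q : R) (A : R -> R -> R) (s t : R) : \bar R :=
  ereal_sup
    [set (\sum_(0 <= k < size P)
            `|A (nth t (s :: P) k) (nth t (s :: P) k.+1)| `^ q)%:E
      | P in [set P | itv_partition s t P]].

Definition omega p X (s t : R) : \bar R :=
  (\sum_(w \in words p) pvar (wlen p w)^-1 (fun u v => incr X u v w) s t)%E.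

Definition weakly_geometric p (T : R) X : Prop :=
  [/\ forall t, 0 <= t <= T -> in_G p (X t),
      forall w, wlen p w <= 1 ->
        {within `[0, T], continuous (fun t => X t w)} &
      (omega p X 0 T < +oo)%E].

End RoughPath.

Section Lipschitz.
Context {R : realType} {n : nat}.
Implicit Types f phi : 'rV[R]_n -> 'rV[R]_n.

(* The norm of 'rV[R]_n provided by the library is the maximum norm. *)
Definition enorm (v : 'rV[R]_n) : R := Num.sqrt (\sum_(i < n) v 0 i ^+ 2).

(* Diter f [:: v_1; ...; v_j] x is D^j f(x)(v_1, ..., v_j), with v_1 the
   direction of the last differentiation. *)
Fixpoint Diter f (vs : seq 'rV[R]_n) : 'rV[R]_n -> 'rV[R]_n :=
  if vs is v :: vs' then fun x => 'd (Diter f vs') x v else f.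

(* In finite dimension D^j f is Frechet differentiable as a map into the
   j-linear maps iff all the maps x |-> D^j f(x)(v_1, ..., v_j) are. *)
Definition times_differentiable (k : nat) f : Prop :=
  forall (vs : seq 'rV[R]_n), (size vs < k)%N ->
    forall x, differentiable (Diter f vs) x.

(* The operator norm of the j-linear map A is at most M. *)
Definition opnorm_le (j : nat) (A : seq 'rV[R]_n -> 'rV[R]_n) (M : R) : Prop :=
  forall vs, size vs = j -> enorm (A vs) <= M * \prod_(v <- vs) enorm v.

(* The largest integer strictly less than gamma, for gamma > 0. *)
Definition lip_order (gamma : R) : nat := (`|Num.ceil gamma|%N).-1.

Definition Lip_bound (gamma : R) f (M : R) : Prop :=
  forall j, (j <= lip_order gamma)%N -> forall x y : 'rV[R]_n,
    opnorm_le j (fun vs => Diter f vs x) M /\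
    opnorm_le j
      (fun vs => Diter f vs y -
        \sum_(0 <= l < (lip_order gamma - j).+1)
          (l`!%:R)^-1 *: Diter f (vs ++ nseq l (y - x)) x)
      (M * enorm (y - x) `^ (gamma - j%:R)).

Definition is_Lip (gamma : R) f : Prop :=
  times_differentiable (lip_order gamma) f /\ exists M, Lip_bound gamma f M.

Definition Lip_norm (gamma : R) f : R := inf [set M | Lip_bound gamma f M].

Definition lie f phi : 'rV[R]_n -> 'rV[R]_n := fun x => 'd phi x (f x).

Definition Fw {d : nat} (f : 'I_d -> 'rV[R]_n -> 'rV[R]_n) (w : seq 'I_d) :
    'rV[R]_n -> 'rV[R]_n :=
  foldr (fun i phi => lie (f i) phi) id w.

Definition rescale {d : nat} (gamma : 'I_d -> R)
    (f : 'I_d -> 'rV[R]_n -> 'rV[R]_n) (X : R -> seq 'I_d -> R) :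
    R -> seq 'I_d -> R :=
  fun t w => (\prod_(i <- w) Lip_norm (gamma i) (f i)) * X t w.

End Lipschitz.

Section Stieltjes.
Context {R : realType}.

(* I is the Riemann-Stieltjes integral of f against g over [a, b]: the limit of
   the tagged Riemann sums as the mesh of the partition tends to 0. *)
Definition is_RS (f g : R -> R) (a b I : R) : Prop :=
  forall e, 0 < e -> exists2 delta, 0 < delta &
    forall (P : seq R) (c : nat -> R),
      itv_partition a b P ->
      (forall k, (k < size P)%N ->
        nth b (a :: P) k.+1 - nth b (a :: P) k < delta /\
        nth b (a :: P) k <= c k <= nth b (a :: P) k.+1) ->
      `|\sum_(0 <= k < size P)
          f (c k) * (g (nth b (a :: P) k.+1) - g (nth b (a :: P) k)) - I| < e.

Definition RS (f g : R -> R) (a b : R) : R := xget 0 [set I | is_RS f g a b I].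

End Stieltjes.

Section Solution.
Context {R : realType} {d n : nat}.
Implicit Types (p : 'I_d -> R) (x : R -> 'rV[R]_d) (w : seq 'I_d).

(* For w = i :: w', the integral over s < u_1 < ... < u_m < t is computed as
   the integral over u_1, against x^i, of the one over u_1 < ... < u_m < t. *)
Fixpoint signature x w (s t : R) : R :=
  if w is i :: w' then RS (fun u => signature x w' u t) (fun u => x u 0 i) s t
  else 1.

Definition continuous_BV (T : R) x : Prop :=
  forall i, {within `[0, T], continuous (fun t => x t 0 i)} /\
            bounded_variation 0 T (fun t => x t 0 i).

Definition ode_solution (T : R) (f : 'I_d -> 'rV[R]_n -> 'rV[R]_n) x
    (xi : 'rV[R]_n) (y : R -> 'rV[R]_n) : Prop :=
  {within `[0, T], continuous y} /\
  forall t, 0 <= t <= T -> forall j,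
    y t 0 j = xi 0 j +
      \sum_(i < d) RS (fun u => f i (y u) 0 j) (fun u => x u 0 i) 0 t.

(* p' is an exponent "sufficiently close" to p. *)
Definition close_above p (gamma p' : 'I_d -> R) : Prop :=
  [/\ forall i, p i < p' i,
      forall i, pmax p' * (1 - (p' i)^-1) + 1 < gamma i &
      forall w, (wlen p' w <= 1) = (wlen p w <= 1)].

(* The limit does not depend on p' nor on the approximations, so y is the
   path-level solution as soon as it is obtained from one choice of them. *)
Definition path_level_solution p (T : R) (X : R -> seq 'I_d -> R)
    (gamma : 'I_d -> R) (f : 'I_d -> 'rV[R]_n -> 'rV[R]_n) (xi : 'rV[R]_n)
    (y : R -> 'rV[R]_n) : Prop :=
  exists (p' : 'I_d -> R) (x : nat -> R -> 'rV[R]_d) (ym : nat -> R -> 'rV[R]_n),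
    [/\ close_above p gamma p',
        forall m, continuous_BV T (x m),
        forall w, words p w ->
          pvar (wlen p' w)^-1
            (fun s t => signature (x m) w s t - incr X s t w) 0 T
            @[m --> \oo] --> 0%E,
        forall m, ode_solution T f (x m) xi (ym m) &
        {uniform `[0, T], ym @ \oo --> y}].

End Solution.

(* Main.v *)
(* This is an argument of Davie's type. Let J(s,t) be the quantity to be
   estimated. By Chen's relation, J(s,u) - J(s,t) - J(t,u) is the sum over the
   words w of (X_{t,u}, w) times the error in the Taylor expansion of F^w(y_t)
   around y_s; as X_{s,t} is group-like, the iterated Taylor formula bounds it by
   a multiple of omega(s,u)^theta. A discrete sewing lemma then gives
   |J(s,t)| <= A omega(s,t)^theta when omega(s,t) is small, provided that the sum
   of |J| over some partition of [s,t] is arbitrarily small.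
   The proviso holds for equations driven by paths of bounded variation. Hence the
   estimate, for the exponents p', applies to the approximations x^(m) and passes
   to the limit: |J(s,t)| <= A' omega'(s,t)^theta', where omega' is a control that
   is small on short intervals. Since theta' > 1, the proviso holds for y itself,
   and the estimate applies a second time, now with the exponents p.
   When omega(s,t) is not small, [s,t] is cut into blocks of small control whose
   number is at most proportional to omega(s,t). *)

Require Import Defs.
From HB Require Import structures.
From mathcomp Require Import all_boot all_order all_algebra.
From mathcomp Require Import all_classical all_reals all_analysis.
From mathcomp Require Import ring lra zify.

Set Implicit Arguments.
Unset Strict Implicit.
Unset Printing Implicit Defensive.

Import Order.TTheory GRing.Theory Num.Theory.
Import numFieldNormedType.Exports.

Local Open Scope classical_set_scope.
Local Open Scope ring_scope.

(** The fields have different regularities, so no single Taylor order fits them all. Everything is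
    measured by weight: a letter i counts 1/p_i, and a derivative counts 1/p_max, the least weight
    of the letter that fills it. The order N_i = floor(p_max (1 - 1/p_i)) + 1 < gamma_i of the jet
    of f_i is the least one with 1/p_i + N_i/p_max > 1; this sum is the length of a word, hence at
    least theta, and no length lies strictly between 1 and theta. The expansion of F^w is proved for
    a larger family, the iterated Lie derivatives of D^j f_i(v_1, ..., v_j), because that family is
    stable under the product rule. The bound on the defect of J presupposes |J| <= omega. The
    induction of the sewing lemma supplies it, once twice the sum of |J| over the partition is added
    to the control. The fields enter only through the products of Lip norms that the rescaled path
    absorbs, so the constants depend on the exponents and d alone. Those of the first pass depend on
    p', whose choice depends on gamma; the second pass removes this dependence. *)

Lemma ler_sum_seq (R : numDomainType) (I : eqType) (r : seq I) (F G : I -> R) :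
  {in r, forall i, F i <= G i} -> \sum_(i <- r) F i <= \sum_(i <- r) G i.
Proof. by move=> FG; rewrite big_seq [leRHS]big_seq; exact: ler_sum. Qed.

Lemma ler_pdivD1 (R : realFieldType) (e c : R) :
  0 <= e -> 0 <= c -> c * (e / (c + 1)) <= e.
Proof.
move=> e0 c0; rewrite mulrCA -[leRHS]mulr1 ler_wpM2l// ler_pdivrMr ?ltr_wpDl//.
by rewrite mul1r lerDl.
Qed.

(** * The Euclidean norm *)

Section Enorm.
Context {R : realType} {n : nat}.
Implicit Types u v : 'rV[R]_n.

Lemma enorm_ge0 v : 0 <= enorm v.
Proof. exact: sqrtr_ge0. Qed.

Lemma enorm_sqr v : enorm v ^+ 2 = \sum_(i < n) v 0 i ^+ 2.
Proof. by rewrite sqr_sqrtr// sumr_ge0// => i _; rewrite sqr_ge0. Qed.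

Lemma enorm0 : enorm (0 : 'rV[R]_n) = 0.
Proof.
by apply/eqP; rewrite -sqrf_eq0 enorm_sqr big1// => i _; rewrite mxE expr0n.
Qed.

Lemma enorm_eq0 v : enorm v = 0 -> v = 0.
Proof.
move=> v0; have := enorm_sqr v; rewrite v0 expr0n => /esym/eqP.
rewrite psumr_eq0 => [/allP vi|i _]; last exact: sqr_ge0.
apply/rowP => i; rewrite mxE; apply/eqP; rewrite -sqrf_eq0.
by apply: vi; rewrite mem_index_enum.
Qed.

Lemma enormZ a v : enorm (a *: v) = `|a| * enorm v.
Proof.
rewrite /enorm -sqrtr_sqr -sqrtrM ?sqr_ge0// mulr_sumr.
by congr Num.sqrt; apply: eq_bigr => i _; rewrite mxE exprMn.
Qed.

Lemma enormN v : enorm (- v) = enorm v.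
Proof. by rewrite -scaleN1r enormZ normrN1 mul1r. Qed.

(** Expanding the nonnegative sum of the squares of |v| u_i - |u| v_i leaves the Cauchy-Schwarz
    inequality multiplied by 2 |u| |v|. *)
Lemma enorm_dot u v : \sum_(i < n) u 0 i * v 0 i <= enorm u * enorm v.
Proof.
have [u0|u0] := eqVneq (enorm u) 0.
  by rewrite (enorm_eq0 u0) enorm0 mul0r big1// => i _; rewrite mxE mul0r.
have [v0|v0] := eqVneq (enorm v) 0.
  by rewrite (enorm_eq0 v0) enorm0 mulr0 big1// => i _; rewrite mxE mulr0.
have up : 0 < enorm u by rewrite lt_neqAle eq_sym u0 enorm_ge0.
have vp : 0 < enorm v by rewrite lt_neqAle eq_sym v0 enorm_ge0.
have : 0 <= \sum_(i < n) (enorm v * u 0 i - enorm u * v 0 i) ^+ 2.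
  by apply: sumr_ge0 => i _; exact: sqr_ge0.
have -> : \sum_(i < n) (enorm v * u 0 i - enorm u * v 0 i) ^+ 2 =
    enorm v ^+ 2 * \sum_(i < n) u 0 i ^+ 2 +
    enorm u ^+ 2 * \sum_(i < n) v 0 i ^+ 2
    - 2 * (enorm u * enorm v) * \sum_(i < n) u 0 i * v 0 i.
  rewrite !mulr_sumr -big_split/= -sumrB.
  by apply: eq_bigr => i _ /=; ring.
rewrite -!enorm_sqr.
rewrite subr_ge0.
have -> : enorm v ^+ 2 * enorm u ^+ 2 + enorm u ^+ 2 * enorm v ^+ 2 =
    2 * (enorm u * enorm v) * (enorm u * enorm v) by ring.
by rewrite ler_pM2l// !mulr_gt0.
Qed.

Lemma ler_enormD u v : enorm (u + v) <= enorm u + enorm v.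
Proof.
rewrite -(ler_pXn2r (n := 2))// ?nnegrE ?addr_ge0 ?enorm_ge0// sqrrD.
rewrite !enorm_sqr.
have -> : \sum_(i < n) (u + v) 0 i ^+ 2 = \sum_(i < n) u 0 i ^+ 2 +
   (\sum_(i < n) u 0 i * v 0 i) *+ 2 + \sum_(i < n) v 0 i ^+ 2.
  by rewrite -sumrMnl -!big_split; apply: eq_bigr => i _ /=; rewrite mxE sqrrD.
by rewrite lerD2r lerD2l lerMn2r enorm_dot orbT.
Qed.

Lemma ler_enormB u v : enorm (u - v) <= enorm u + enorm v.
Proof. by rewrite -(enormN v) ler_enormD. Qed.

Lemma ler_enorm_sum (I : Type) (r : seq I) (P : pred I) (F : I -> 'rV[R]_n) :
  enorm (\sum_(i <- r | P i) F i) <= \sum_(i <- r | P i) enorm (F i).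
Proof.
elim/big_ind2 : _ => [|x a y b xa yb|//]; first by rewrite enorm0.
by rewrite (le_trans (ler_enormD _ _))// lerD.
Qed.

(** Limits and differentials are taken in the maximum norm. The factor n is harmless: the bound is
    only applied to quantities that can be made arbitrarily small, so n does not reach the final
    constant. *)
Lemma enorm_le_norm v : enorm v <= n%:R * `|v|.
Proof.
rewrite {1}[v]row_sum_delta (le_trans (ler_enorm_sum _ _ _))//.
apply: (@le_trans _ _ (\sum_(i < n) `|v|)); last first.
  by rewrite sumr_const card_ord mulr_natl.
apply: ler_sum => i _; rewrite enormZ.
have -> : enorm (delta_mx 0 i : 'rV[R]_n) = 1.
  rewrite /enorm (bigD1 i)//= big1 => [|j ji]; last first.
    by rewrite mxE (negbTE ji) andbF expr0n.
  by rewrite mxE !eqxx addr0 expr1n sqrtr1.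
rewrite mulr1 [leRHS]/Num.Def.normr/= mx_normrE.
by apply/bigmax_geP; right; exists (0, i).
Qed.

End Enorm.

(** * Shuffles *)

Section Words.
Context {R : realType} {d : nat}.
Implicit Types (u v w : seq 'I_d) (p : 'I_d -> R).

(* The 2^m pairs of complementary subwords of a word of length m. *)
Fixpoint unshuffle w : seq (seq 'I_d * seq 'I_d) :=
  if w is a :: w' then
    [seq (a :: q.1, q.2) | q <- unshuffle w'] ++
    [seq (q.1, a :: q.2) | q <- unshuffle w']
  else [:: ([::], [::])].

Lemma size_unshuffle w : size (unshuffle w) = (2 ^ size w)%N.
Proof.
elim: w => //= a w IH; rewrite size_cat !size_map IH expnS; lia.
Qed.

Lemma perm_unshuffle w q : q \in unshuffle w -> perm_eq (q.1 ++ q.2) w.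
Proof.
elim: w q => [|a w IH] q /=; first by rewrite inE => /eqP ->.
rewrite mem_cat => /orP[] /mapP[r /IH rw ->] /=; first by rewrite perm_cons.
by rewrite (perm_catCA _ [:: a] _) perm_cons.
Qed.

Lemma unshuffle_size w q :
  q \in unshuffle w -> (size q.1 + size q.2 = size w)%N.
Proof. by move=> /perm_unshuffle/perm_size; rewrite size_cat. Qed.

Lemma unshuffle_size_le w q :
  q \in unshuffle w -> (size q.1 <= size w)%N /\ (size q.2 <= size w)%N.
Proof. by move=> /unshuffle_size <-; rewrite leq_addr leq_addl. Qed.

Lemma unshuffle_wlen p w q :
  q \in unshuffle w -> wlen p q.1 + wlen p q.2 = wlen p w.
Proof. by move=> /perm_unshuffle qw; rewrite /wlen -big_cat (perm_big _ qw). Qed.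

Lemma unshuffle_prod (M : 'I_d -> R) w q : q \in unshuffle w ->
  (\prod_(i <- q.1) M i) * (\prod_(i <- q.2) M i) = \prod_(i <- w) M i.
Proof. by move=> /perm_unshuffle qw; rewrite -big_cat (perm_big _ qw). Qed.

Section Sums.
Context {E : nmodType}.
Implicit Types F : seq 'I_d * seq 'I_d -> E.

Lemma big_unshuffle_cons a w F :
  \sum_(q <- unshuffle (a :: w)) F q =
  \sum_(q <- unshuffle w) (F (a :: q.1, q.2) + F (q.1, a :: q.2)).
Proof. by rewrite [RHS]big_split/= big_cat !big_map. Qed.

Lemma big_unshuffle_nil F : \sum_(q <- unshuffle [::]) F q = F ([::], [::]).
Proof. by rewrite big_seq1. Qed.

Lemma big_unshuffle_cat v w F :
  \sum_(q <- unshuffle (v ++ w)) F q =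
  \sum_(r <- unshuffle v) \sum_(q <- unshuffle w) F (r.1 ++ q.1, r.2 ++ q.2).
Proof.
elim: v F => [|a v IH] F.
  by rewrite big_unshuffle_nil; apply: eq_bigr => -[].
rewrite cat_cons !big_unshuffle_cons (IH (fun q => F (a :: q.1, q.2) + F (q.1, a :: q.2))).
by apply: eq_bigr => q _; rewrite -big_split.
Qed.

Lemma big_unshuffle_rcons a w F :
  \sum_(q <- unshuffle (rcons w a)) F q =
  \sum_(q <- unshuffle w) (F (rcons q.1 a, q.2) + F (q.1, rcons q.2 a)).
Proof.
rewrite -cats1 big_unshuffle_cat; apply: eq_bigr => q _.
by rewrite big_unshuffle_cons big_unshuffle_nil !cats1 !cats0.
Qed.

(** Both sides run over the ways to distribute the letters of w over three ordered slots; the last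
    two slots are exchanged. *)
Lemma unshuffleAC w (G : seq 'I_d -> seq 'I_d -> seq 'I_d -> E) :
  \sum_(q <- unshuffle w) \sum_(r <- unshuffle q.1) G r.1 q.2 r.2 =
  \sum_(q <- unshuffle w) \sum_(r <- unshuffle q.1) G r.1 r.2 q.2.
Proof.
elim: w G => [|a w IH] G; first by rewrite !(big_unshuffle_nil,big_seq1).
rewrite !big_unshuffle_cons.
under eq_bigr do rewrite big_unshuffle_cons big_split/=.
under [RHS]eq_bigr do rewrite big_unshuffle_cons big_split/=.
rewrite !big_split/= (IH (fun x y z => G (a :: x) y z)).
rewrite (IH (fun x y z => G x y (a :: z))) (IH (fun x y z => G x (a :: y) z)).
by rewrite -!addrA; congr (_ + _); rewrite addrC.
Qed.

(** Equal terms are collected: a sum over a list with repetitions becomes a sum over a fixed index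
    set, where multiplicities can be compared and summations exchanged. *)
Lemma big_count (I : eqType) (r s : seq I) (P : pred I) (F : I -> E) :
  uniq r -> (forall x, x \in s -> (x \in r) && P x) ->
  \sum_(x <- s) F x = \sum_(x <- r | P x) F x *+ count_mem x s.
Proof.
move=> ur; elim: s => [|y s IH] sr.
  by rewrite big_nil big1// => x _; rewrite mulr0n.
rewrite big_cons IH => [|x xs]; last by rewrite sr// inE xs orbT.
under [RHS]eq_bigr do rewrite /= mulrnDr.
rewrite big_split/=; congr (_ + _).
have /andP[yr Py] := sr y (mem_head _ _).
rewrite big_mkcond (bigD1_seq y)//= Py eqxx mulr1n big1 ?addr0// => x xy.
by case: ifPn => // _; rewrite eq_sym (negbTE xy) mulr0n.
Qed.

End Sums.

Lemma shuffle_nil u : shuffle u [::] = [:: u].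
Proof. by case: u. Qed.

Lemma count_map_cons a i w (s : seq (seq 'I_d)) :
  count_mem (a :: w) [seq i :: x | x <- s] = ((i == a) * count_mem w s)%N.
Proof.
rewrite count_map; case: (eqVneq i a) => [->|ia].
  by rewrite mul1n; apply: eq_count => x /=; rewrite eqseq_cons eqxx.
rewrite mul0n (eq_count (a2 := pred0)) ?count_pred0// => x /=.
by rewrite eqseq_cons (negbTE ia).
Qed.

Lemma count_map_consl a u v (s : seq (seq 'I_d * seq 'I_d)) :
  count_mem (u, v) [seq (a :: q.1, q.2) | q <- s] =
  if u is i :: u' then ((i == a) * count_mem (u', v) s)%N else 0%N.
Proof.
rewrite count_map; case: u => [|i u].
  by rewrite (eq_count (a2 := pred0)) ?count_pred0// => x /=; rewrite xpair_eqE.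
case: (eqVneq i a) => [->|ia].
  rewrite mul1n; apply: eq_count => -[x y] /=.
  by rewrite !xpair_eqE eqseq_cons eqxx.
rewrite mul0n (eq_count (a2 := pred0)) ?count_pred0// => x /=.
by rewrite xpair_eqE eqseq_cons eq_sym (negbTE ia).
Qed.

Lemma count_map_consr a u v (s : seq (seq 'I_d * seq 'I_d)) :
  count_mem (u, v) [seq (q.1, a :: q.2) | q <- s] =
  if v is i :: v' then ((i == a) * count_mem (u, v') s)%N else 0%N.
Proof.
rewrite count_map; case: v => [|i v].
  by rewrite (eq_count (a2 := pred0)) ?count_pred0// => x /=; rewrite xpair_eqE andbF.
case: (eqVneq i a) => [->|ia].
  rewrite mul1n; apply: eq_count => -[x y] /=.
  by rewrite !xpair_eqE eqseq_cons eqxx.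
rewrite mul0n (eq_count (a2 := pred0)) ?count_pred0// => x /=.
by rewrite xpair_eqE eqseq_cons [a == i]eq_sym (negbTE ia) andbF.
Qed.

(** Adjointness of the shuffle product and the unshuffle coproduct, by induction on w: its first
    letter comes from the head of u or from the head of v. *)
Lemma count_shuffle u v w :
  count_mem w (shuffle u v) = count_mem (u, v) (unshuffle w).
Proof.
elim: w u v => [|a w IH] u v.
  case: u => [|i u]; first by case: v.
  case: v => [|j v] //=; rewrite count_cat !count_map.
  by rewrite !(eq_count (a2 := pred0)) ?count_pred0.
rewrite [in RHS]/= count_cat count_map_consl count_map_consr.
case: u v => [|i u] [|j v]; rewrite ?add0n ?addn0 //=.
- by rewrite addn0 -IH /= addn0 eqseq_cons mulnb.
- by rewrite addn0 -IH shuffle_nil /= addn0 eqseq_cons mulnb.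
by rewrite count_cat !count_map_cons -!IH.
Qed.

(** The form in which group-likeness is used. By adjointness, a sum over words v and their
    splittings (v1, v2), weighted by g v, is a double sum weighted by g v1 g v2; a splitting
    preserves the total length, so the truncation is respected. *)
Lemma big_shuffle (E : lmodType R) p (g : seq 'I_d -> R) (Ws : seq (seq 'I_d))
    (c : R) (G : seq 'I_d -> seq 'I_d -> E) :
  uniq Ws -> (forall i, 0 < p i) -> (forall v, wlen p v < c -> v \in Ws) ->
  (forall u v, wlen p u + wlen p v < c ->
     g u * g v = \sum_(w <- shuffle u v) g w) ->
  \sum_(v <- Ws | wlen p v < c) g v *: \sum_(q <- unshuffle v) G q.1 q.2 =
  \sum_(v1 <- Ws | wlen p v1 < c)
    \sum_(v2 <- Ws | wlen p v2 < c - wlen p v1) (g v1 * g v2) *: G v1 v2.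
Proof.
move=> uW p0 cW gsh.
pose P q := wlen p q.1 + wlen p q.2 < c.
pose W2 := [seq (v1, v2) | v1 <- Ws, v2 <- Ws].
have uW2 : uniq W2 by apply: allpairs_uniq => // -[? ?] [? ?] _ _ /=.
have W2P q : P q -> q \in W2.
  case: q => u v; rewrite /P /= => uvc; apply/allpairs_f.
    by apply: cW; apply: le_lt_trans uvc; rewrite lerDl wlen_ge0.
  by apply: cW; apply: le_lt_trans uvc; rewrite lerDr wlen_ge0.
have -> : \sum_(v1 <- Ws | wlen p v1 < c)
    \sum_(v2 <- Ws | wlen p v2 < c - wlen p v1) (g v1 * g v2) *: G v1 v2 =
    \sum_(q <- W2 | P q) (g q.1 * g q.2) *: G q.1 q.2.
  rewrite [RHS]big_mkcond big_allpairs [LHS]big_mkcond/=.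
  apply: eq_bigr => v1 _; rewrite -big_mkcond/= /P/=.
  case: ifPn => [_|]; first by apply: eq_bigl => v2; rewrite ltrBrDl.
  rewrite -leNgt => cv1; rewrite big1// => v2.
  rewrite ltNge (le_trans cv1)//= ?lerDl ?wlen_ge0//.
transitivity (\sum_(v <- Ws | wlen p v < c) \sum_(q <- W2 | P q)
    (g v *: G q.1 q.2) *+ count_mem q (unshuffle v)).
  apply: eq_bigr => v vc; rewrite (big_count (P := P) _ uW2) => [|q qv].
    by rewrite scaler_sumr; apply: eq_bigr => q _; rewrite scalerMnr.
  have Pq : P q by rewrite /P (unshuffle_wlen p qv).
  by rewrite Pq W2P.
rewrite exchange_big/=; apply: eq_bigr => -[u v] Pq.
rewrite gsh// (big_count (P := fun w => wlen p w < c) _ uW) => [|w ws].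
  rewrite scaler_suml; apply: eq_bigr => w _.
  by rewrite -count_shuffle scalerMnl.
have : (u, v) \in unshuffle w by rewrite -has_pred1 has_count -count_shuffle -has_count has_pred1.
move=> /(unshuffle_wlen p)/= ww; have wc : wlen p w < c by rewrite -ww.
by rewrite cW.
Qed.

End Words.

(** * Jets of Lipschitz functions *)

Section DiffRow.
Context {R : realType} {n : nat}.
Local Notation V := 'rV[R]_n.

Lemma is_diff_sum (I : eqType) (r : seq I) (f df : I -> V -> V) (x : V) :
  (forall i, i \in r -> is_diff x (f i) (df i)) ->
  is_diff x (fun y => \sum_(i <- r) f i y) (fun h => \sum_(i <- r) df i h).
Proof.
elim: r => [|i r IH] fdf.
  have -> : (fun y => \sum_(i <- [::]) f i y) = cst 0.
    by apply/funext => y; rewrite big_nil.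
  have -> : (fun h => \sum_(i <- [::]) df i h) = 0.
    by apply/funext => y; rewrite big_nil.
  exact: is_diff_cst.
have -> : (fun y => \sum_(i <- i :: r) f i y) = f i + (fun y => \sum_(i <- r) f i y).
  by apply/funext => y; rewrite big_cons.
have -> : (fun y => \sum_(i <- i :: r) df i y) = df i + (fun y => \sum_(i <- r) df i y).
  by apply/funext => y; rewrite big_cons.
apply: is_diffD; first by apply: fdf; exact: mem_head.
by apply: IH => j jr; apply: fdf; rewrite inE jr orbT.
Qed.

Lemma is_diff_coord (g dg : V -> V) (x : V) e :
  is_diff x g dg -> is_diff x (fun y => g y 0 e) (fun h => dg h 0 e).
Proof.
move=> gd; pose c (N : V) : R := N 0 e.
have lc : linear c by move=> k u v; rewrite /c !mxE.
pose cM := GRing.isLinear.Build _ _ _ _ _ lc.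
pose cL : {linear _ -> _} := HB.pack c cM.
have cc : continuous cL by exact: coord_continuous.
have cd : is_diff (g x) c c.
  apply: DiffDef; first exact: (@linear_differentiable _ _ _ cL).
  exact: (@diff_lin _ _ _ cL).
exact: (@is_diff_comp _ _ _ _ g dg c c).
Qed.

Lemma is_diff_coords (g dg : V -> V) (x : V) :
  (forall e, is_diff x (fun y => g y 0 e) (fun h => dg h 0 e)) -> is_diff x g dg.
Proof.
move=> gd.
have gE (k : V -> V) : k = fun y => \sum_e (k y 0 e) *: (delta_mx 0 e : V).
  by apply/funext => y; rewrite {1}(row_sum_delta (k y)).
rewrite (gE g) (gE dg); apply: is_diff_sum => e _.
have [gde dgE] := gd e; apply: DiffDef; first exact: differentiableZl.
by rewrite diffZl// dgE.
Qed.

(** Expanding the linear argument of B in the canonical basis reduces the claim to products of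
    scalar functions. Hence differentiability of each [B u] separately is enough. *)
Lemma is_diff_app (B : V -> V -> V) (dB : V -> V -> V) (phi dphi : V -> V) (x : V) :
  (forall y, linear (B^~ y)) -> (forall u, is_diff x (B u) (dB u)) ->
  is_diff x phi dphi ->
  is_diff x (fun y => B (phi y) y) (fun h => dB (phi x) h + B (dphi h) x).
Proof.
move=> Blin Bd phid.
have Bsum y (a : 'I_n -> R) (u : 'I_n -> V) :
    B (\sum_e a e *: u e) y = \sum_e a e *: B (u e) y.
  have B0 : B 0 y = 0.
    by have := Blin y (-1) 0 0; rewrite /= scaler0 addr0 scaleN1r addNr.
  elim/big_rec2 : _ => // e v1 v2 _ <-.
  by rewrite (Blin y).
have BE u y : B u y = \sum_e u 0 e *: B (delta_mx 0 e) y.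
  by rewrite {1}(row_sum_delta u) Bsum.
have dBE h : dB (phi x) h = \sum_e (phi x) 0 e *: dB (delta_mx 0 e) h.
  have [_ <-] := Bd (phi x).
  suff [_ ->//] : is_diff x (B (phi x)) (fun h => \sum_e (phi x) 0 e *: dB (delta_mx 0 e) h).
  have -> : B (phi x) = fun y => \sum_e (phi x) 0 e *: B (delta_mx 0 e) y.
    by apply/funext => y; exact: BE.
  apply: is_diff_sum => e _; exact: (@is_diffZ _ _ _ (B (delta_mx 0 e))).
have -> : (fun y => B (phi y) y) = fun y => \sum_e phi y 0 e *: B (delta_mx 0 e) y.
  by apply/funext => y; exact: BE.
have -> : (fun h => dB (phi x) h + B (dphi h) x) = fun h => \sum_e
    (phi x 0 e *: dB (delta_mx 0 e) h + dphi h 0 e *: B (delta_mx 0 e) x).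
  by apply/funext => h; rewrite dBE (BE (dphi h)) big_split.
apply: is_diff_sum => e _; apply: is_diff_coords => e'.
have pe := is_diff_coord e phid.
have be := is_diff_coord e' (Bd (delta_mx 0 e)).
have := @is_diffM _ _ _ _ _ _ _ pe be.
have -> : (fun y => phi y 0 e) * (fun y => B (delta_mx 0 e) y 0 e') =
  (fun y => (phi y 0 e *: B (delta_mx 0 e) y) 0 e').
  by apply/funext => y; rewrite mxE.
set D1 := (X in is_diff _ _ X); set D2 := (X in _ -> is_diff _ _ X).
have -> // : D1 = D2.
apply/funext => h; rewrite /D1 /D2 !mxE; congr (_ + _).
by rewrite mulrC.
Qed.

End DiffRow.

Section Jets.
Context {R : realType} {n : nat}.
Local Notation V := 'rV[R]_n.
Implicit Types (f : V -> V) (vs us : seq V).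

Lemma Diter_cons f v vs x : Diter f (v :: vs) x = 'd (Diter f vs) x v.
Proof. by []. Qed.

Lemma diff_eq (g h : V -> V) x v : g =1 h -> 'd g x v = 'd h x v.
Proof. by move=> /funext ->. Qed.

Lemma diff_addr (g : V -> V) x u v : 'd g x (u + v) = 'd g x u + 'd g x v.
Proof. exact: (linearD ('d g x)). Qed.

Lemma diff_scaler (g : V -> V) x a v : 'd g x (a *: v) = a *: 'd g x v.
Proof. exact: linearZ. Qed.

Lemma diff_scalel (g : V -> V) x a v : differentiable g x ->
  'd (fun y => a *: g y) x v = a *: 'd g x v.
Proof.
move=> gx; have -> : (fun y => a *: g y) = a *: g by exact/funext.
by have /(congr1 (fun h => h v)) := diffZ a gx.
Qed.

(* A Lip(gamma) function has these bounds for every integer N < gamma; the price for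
   replacing gamma by N in the Taylor estimate is the constant 5 = 1 + 4, with 4
   bounding the sum of the 1 / l!. *)
Record jet_bound (N : nat) (M : R) f : Prop := JetBound {
  jet_diff : forall vs, (size vs < N)%N -> forall x, differentiable (Diter f vs) x;
  jet_le : forall vs x, (size vs <= N)%N ->
    enorm (Diter f vs x) <= M * \prod_(v <- vs) enorm v;
  jet_taylor : forall vs x y, (size vs <= N)%N ->
    enorm (Diter f vs y - \sum_(l < N - size vs)
       (l`!%:R)^-1 *: Diter f (vs ++ nseq l (y - x)) x) <=
    5 * M * enorm (y - x) ^+ (N - size vs) * \prod_(v <- vs) enorm v;
  jet_sym : forall us vs, (size us <= N)%N -> perm_eq us vs ->
    Diter f us = Diter f vs }.

(** Since k! >= 2^(k-1), the terms are dominated by a geometric series; the stronger bound 4 - 4/2^k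
    is what the induction carries. *)
Lemma sum_invfact_le k : \sum_(l < k) (l`!%:R)^-1 <= 4 :> R.
Proof.
suff : \sum_(l < k) (l`!%:R)^-1 <= 4 - 4 * 2 ^- k :> R.
  by move=> /le_trans; apply; rewrite gerBl mulr_ge0// invr_ge0 exprn_ge0.
elim: k => [|k IH]; first by rewrite big_ord0 expr0 invr1 mulr1 subrr.
rewrite big_ord_recr/= (le_trans (lerD IH (lexx _)))//.
have : (k`!%:R)^-1 <= 2 * 2 ^- k :> R.
  rewrite -[X in X * _]invrK -invfM lef_pV2 ?posrE ?mulr_gt0 ?exprn_gt0 ?invr_gt0 ?ltr0n ?fact_gt0//.
  rewrite ler_pdivrMl// -natrX -natrM ler_nat.
  elim: k {IH} => // k IH; rewrite expnS factS.
  case: k IH => // k IH; nia.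
rewrite exprS invfM; set a := 2 ^- k; lra.
Qed.

Lemma Lip_bound_ge0 gamma f M : Lip_bound gamma f M -> 0 <= M.
Proof.
move=> /(_ 0%N (leq0n _) 0 0)[/(_ [::] erefl) + _].
by rewrite big_nil mulr1; apply: le_trans; exact: enorm_ge0.
Qed.

Lemma prod_enorm_ge0 vs : 0 <= \prod_(v <- vs) enorm v.
Proof. by apply: prodr_ge0 => v _; exact: enorm_ge0. Qed.

(** The infimum is attained: each requirement on M has the form a <= M c with c >= 0, and such a
    requirement passes to the infimum. *)
Lemma Lip_norm_bound gamma f : is_Lip gamma f ->
  Lip_bound gamma f (Lip_norm gamma f).
Proof.
move=> [_ [M0 M0P]]; set A := [set M | Lip_bound gamma f M].
have A0 : A !=set0 by exists M0.
have key (a c : R) : 0 <= c -> (forall M, A M -> a <= M * c) -> a <= inf A * c.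
  rewrite le_eqVlt => /orP[/eqP <- aM|c0 aM].
    by rewrite mulr0; have := aM _ M0P; rewrite mulr0.
  rewrite -ler_pdivrMr//; apply: lb_le_inf => // M AM.
  by rewrite ler_pdivrMr// aM.
move=> j jk x y; split=> vs svs.
  by apply: key => [|M /(_ j jk x y)[+ _]]; [exact: prod_enorm_ge0|exact].
rewrite -mulrA; apply: key => [|M /(_ j jk x y)[_ +]].
  by rewrite mulr_ge0 ?powR_ge0 ?prod_enorm_ge0.
by move=> /(_ vs svs); rewrite mulrA.
Qed.

Lemma lip_order_lt (gamma : R) : 0 < gamma -> (lip_order gamma)%:R < gamma.
Proof.
move=> g0; rewrite /lip_order.
have c1 : 0 < Num.ceil gamma by rewrite ceil_gt0.
case E : (Num.ceil gamma) c1 => [[|m]|m]// _.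
have := ceil_itv gamma; rewrite E /=.
by move=> /andP[+ _]; apply: le_lt_trans; rewrite -[m.+1]addn1 PoszD addrK.
Qed.

Section OfLip.
Variables (gamma M : R) (f : V -> V).
Hypothesis gamma0 : 0 < gamma.
Hypothesis fd : times_differentiable (lip_order gamma) f.
Hypothesis fM : Lip_bound gamma f M.
Local Notation K := (lip_order gamma).

Let M0 : 0 <= M. Proof. exact: Lip_bound_ge0 fM. Qed.

Lemma Diter_scale vs us (u : V) (t : R) : (size vs + size us < K)%N ->
  Diter f (vs ++ t *: u :: us) = t *: (Diter f (vs ++ u :: us) : V -> V).
Proof.
elim: vs => [|v vs IH] sK; apply/funext => x.
  by rewrite !cat0s !Diter_cons diff_scaler.
move: sK; rewrite /= => sK.
rewrite IH; last by lia.
apply: diff_scalel; apply: fd; rewrite size_cat /=; lia.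
Qed.

Lemma Diter_nseq_scale vs (u : V) (t : R) l x : (size vs + l <= K)%N ->
  Diter f (vs ++ nseq l (t *: u)) x = t ^+ l *: Diter f (vs ++ nseq l u) x.
Proof.
elim: l vs => [|l IH] vs sK; first by rewrite expr0 scale1r.
have -> : nseq l.+1 u = u :: nseq l u by [].
have -> : vs ++ nseq l.+1 (t *: u) = rcons vs (t *: u) ++ nseq l (t *: u).
  by rewrite cat_rcons.
rewrite IH ?size_rcons; last by lia.
rewrite cat_rcons Diter_scale ?size_nseq; last by lia.
by rewrite exprSr -scalerA.
Qed.

(** Both sides are first-order terms of D^j f(vs) at x along u: the left one by differentiability,
    the right one by the Taylor estimate that belongs to the Lip condition. Uniqueness of such an
    expansion identifies them, so symmetry of the derivatives comes from the Lip estimate and not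
    from continuity of second derivatives. *)
Lemma Diter_rot vs (u : V) : (size vs < K)%N ->
  Diter f (u :: vs) = Diter f (rcons vs u).
Proof.
move=> sK; apply/funext => x; rewrite Diter_cons.
set A := 'd _ x u; set B := Diter f (rcons vs u) x.
(* An exponent above 1 that serves both the Taylor error and the terms of order at least 2, for
   steps t <= 1. *)
pose e := Num.min 2 (gamma - (size vs)%:R).
have gK : (size vs).+1%:R < gamma.
  by apply: le_lt_trans (lip_order_lt gamma0); rewrite ler_nat.
have e1 : 1 < e.
  by rewrite /e lt_min ltr1n/= ltrBrDl natr1.
have [C C0 CP] : exists2 C, 0 <= C & forall t : R, 0 < t <= 1 ->
    enorm (Diter f vs (x + t *: u) - Diter f vs x - t *: B) <= C * t `^ e.
  pose c l := enorm (Diter f (vs ++ nseq l u) x).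
  pose C := \sum_(2 <= l < (K - size vs).+1) c l +
    M * enorm u `^ (gamma - (size vs)%:R) * \prod_(v <- vs) enorm v.
  have s0 : 0 <= \sum_(2 <= l < (K - size vs).+1) c l.
    by apply: sumr_ge0 => l _; exact: enorm_ge0.
  exists C.
    by rewrite addr_ge0// !mulr_ge0 ?powR_ge0 ?prod_enorm_ge0.
  move=> t /andP[t0 t1].
  have [_ /(_ vs erefl)] := fM (ltnW sK) x (x + t *: u).
  rewrite addrAC subrr add0r enormZ (ger0_norm (ltW t0)).
  rewrite big_ltn// big_ltn ?ltnS ?subn_gt0//.
  rewrite (@Diter_nseq_scale _ _ _ 1) ?addn1// expr1 cats0 cats1 fact0 invr1 !scale1r.
  rewrite -/B addrA opprD addrA opprD addrA.
  set S := \sum_(_ <= _ < _) _; set D := _ - _ => DS.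
  have te m : e <= m -> t `^ m <= t `^ e.
    by move=> em; apply: ger_powR => //; rewrite t0 t1.
  rewrite -[X in enorm X <= C * _](subrK S) -/D.
  apply: le_trans (ler_enormD _ _) _; rewrite /C mulrDl addrC lerD//.
    rewrite (le_trans (ler_enorm_sum _ _ _))// mulr_suml; apply: ler_sum_seq => l; rewrite mem_index_iota => /andP[l2 lK].
    rewrite Diter_nseq_scale; last by lia.
    rewrite !enormZ -/(c l) mulrA mulrC ler_wpM2l ?enorm_ge0//.
    rewrite ger0_norm ?invr_ge0// ger0_norm ?exprn_ge0 ?(ltW t0)//.
    rewrite -(mul1r (t `^ e)) ler_pM ?invr_ge0 ?exprn_ge0 ?(ltW t0)//.
      by rewrite invf_le1 ?ltr0n ?fact_gt0// ler1n fact_gt0.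
    rewrite -powR_mulrn ?(ltW t0)//; apply: te.
    by rewrite ge_min ler_nat l2.
  apply: le_trans DS _.
  rewrite powRM ?(ltW t0) ?enorm_ge0//.
  set a := t `^ (_ - _); set b := enorm u `^ _; set q := \prod_(_ <- _) _.
  have -> : M * (a * b) * q = M * b * q * a by ring.
  rewrite ler_wpM2l ?te ?mulr_ge0 ?powR_ge0 ?prod_enorm_ge0//.
  by rewrite ge_min lexx orbT.
apply/eqP/negPn/negP => AB.
have eta0 : 0 < enorm (A - B).
  rewrite lt_neqAle enorm_ge0 andbT eq_sym; apply: contra AB => /eqP/enorm_eq0/eqP.
  by rewrite subr_eq0.
set eta := enorm (A - B) in eta0.
have fdx : differentiable (Diter f vs) x by exact: fd.
have /cvg_ex[L Lc] : derivable (Diter f vs) x u by exact: diff_derivable.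
have LA : L = A.
  by rewrite /A -(deriveE _ fdx) /derive; apply/esym/cvg_lim.
rewrite {}LA in Lc.
pose ep := eta / (4 * n.+1%:R).
have ep0 : 0 < ep by rewrite divr_gt0 ?mulr_gt0.
have [de /= de0 deP] : \forall t \near 0^', `|A -
    t^-1 *: ((Diter f vs \o shift x) (t *: u) - Diter f vs x)| < ep.
  by move/cvgrPdist_lt : Lc => /(_ _ ep0).
have e10 : 0 < e - 1 by rewrite subr_gt0.
(* Chosen so that C t^(e-1) <= eta/2 for t <= s; with the other error below eta/4 this contradicts
   the definition of eta. *)
pose s := (eta / (2 * (C + 1))) `^ (e - 1)^-1.
have C10 : 0 < C + 1 by rewrite ltr_wpDl.
have s0 : 0 < s by rewrite powR_gt0// divr_gt0// mulr_gt0.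
pose t := Num.min (de / 2) (Num.min 1 s).
have t0 : 0 < t by rewrite !lt_min divr_gt0//= ltr01 s0.
have t1 : t <= 1 by rewrite !ge_min lexx ?orbT.
have ts : t <= s by rewrite !ge_min lexx ?orbT.
have tde : t < de by rewrite gt_min ltr_pdivrMr// ltr_pMr ?ltr1n.
have := deP t; rewrite /ball/= sub0r normrN gtr0_norm// => /(_ tde).
rewrite gt_eqF// => /(_ isT).
set q := _ *: _ => qA.
have qB : enorm (q - B) <= eta / 2.
  have := CP t; rewrite t0 t1 => /(_ isT) h.
  have -> : q - B = t^-1 *: (Diter f vs (x + t *: u) - Diter f vs x - t *: B).
    rewrite scalerBr scalerA mulVf ?gt_eqF// scale1r /q /=.
    by rewrite [t *: u + x]addrC.
  rewrite enormZ gtr0_norm ?invr_gt0// ler_pdivrMl//.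
  apply: le_trans h _.
  rewrite -(@mulr_powRB1 _ t e) ?(ltW t0)//; last exact: lt_trans e1.
  rewrite mulrCA ler_pM2l//.
  apply: (@le_trans _ _ (C * s `^ (e - 1))).
    by rewrite ler_wpM2l// ge0_ler_powR ?nnegrE ?(ltW t0) ?(ltW s0) ?(ltW e10).
  rewrite /s -powRrM mulVf ?gt_eqF// powRr1; last first.
    by rewrite divr_ge0 ?mulr_ge0 ?(ltW C10) ?(ltW eta0).
  rewrite mulrA ler_pdivrMr ?mulr_gt0//.
  have -> : eta / 2 * (2 * (C + 1)) = eta * (C + 1) by field.
  by rewrite mulrC ler_pM2l// lerDl.
have : eta <= enorm (A - q) + enorm (q - B).
  by rewrite /eta -[A - B](subrKA q) ler_enormD.
have Aq : enorm (A - q) <= eta / 4.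
  apply: le_trans (enorm_le_norm _) _.
  apply: (@le_trans _ _ (n.+1%:R * ep)).
    by rewrite ler_pM// ?ler_nat// ltW.
  rewrite /ep; have n0 : n.+1%:R != 0 :> R by rewrite pnatr_eq0.
  by rewrite le_eqVlt; apply/orP; left; apply/eqP; field.
clear -eta0 Aq qB; lra.
Qed.

(** Rotating u to the end, once past v and vs and once past vs alone, gives the same iterated
    derivative. *)
Lemma Diter_swap (u v : V) vs : ((size vs).+2 <= K)%N ->
  Diter f (u :: v :: vs) = Diter f (v :: u :: vs).
Proof.
move=> sK; have -> : Diter f (v :: u :: vs) = Diter f (v :: rcons vs u).
  by apply/funext => x; rewrite !Diter_cons Diter_rot//; lia.
by rewrite (@Diter_rot (v :: vs)).
Qed.

Lemma Diter_perm us vs : (size us <= K)%N -> perm_eq us vs -> Diter f us = Diter f vs.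
Proof.
elim: {us}(size us) {-2}us (erefl (size us)) vs => [|m IH] us.
  by move=> /size0nil -> vs _; rewrite perm_sym => /perm_nilP ->.
case: us => // u us [sus] [|a vs] sK; first by move=> /perm_nilP.
have cong w xs ys : Diter f xs = Diter f ys -> Diter f (w :: xs) = Diter f (w :: ys).
  by move=> e; apply/funext => x; rewrite !Diter_cons e.
have [<-|ua] := eqVneq u a; first by rewrite perm_cons => uv; apply/cong/IH => //; exact: ltnW.
move=> uv.
have uvs : u \in vs.
  by have := perm_mem uv u; rewrite !inE eqxx (negbTE ua)/= => <-.
have vsu := perm_to_rem uvs.
have usa : perm_eq us (a :: rem u vs).
  rewrite -(perm_cons u) (perm_trans uv)// perm_sym.
  apply: (perm_trans (y := [:: a, u & rem u vs])).
    by rewrite (perm_catCA [:: u] [:: a] (rem u vs)).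
  by rewrite perm_cons perm_sym.
rewrite (cong u us (a :: rem u vs)); last by apply: IH => //; exact: ltnW.
have sz := perm_size vsu; have szu := perm_size usa; rewrite /= in sz szu.
rewrite (Diter_swap u a); last by move: sK; rewrite /=; lia.
by apply/cong/IH; rewrite 1?perm_sym//=; move: sK; rewrite /=; lia.
Qed.

(** For |h| <= 1 the Taylor polynomial of order K is cut at order N - j, and each term cut off is at
    most M |h|^(N-j) / l!. For |h| > 1 the function and every remaining term are bounded separately,
    since all lower powers of |h| are below |h|^(N-j). *)
Lemma Lip_jet N : (N <= K)%N -> jet_bound N M f.
Proof.
move=> NK; split.
- by move=> vs sN; apply: fd; exact: leq_trans NK.
- move=> vs x sN; have [+ _] := fM (leq_trans sN NK) x x.
  exact.
- move=> vs x y sN; set j := size vs; set h := y - x; set P := \prod_(v <- vs) _.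
  have P0 : 0 <= P by exact: prod_enorm_ge0.
  have h0 : 0 <= enorm h by exact: enorm_ge0.
  have jK : (j <= K)%N by exact: leq_trans sN NK.
  have Dl l : (j + l <= K)%N -> enorm ((l`!%:R)^-1 *: Diter f (vs ++ nseq l h) x) <=
      (l`!%:R)^-1 * (M * enorm h ^+ l * P).
    move=> jl; rewrite enormZ ger0_norm ?invr_ge0// ler_wpM2l ?invr_ge0//.
    have sl : size (vs ++ nseq l h) = (j + l)%N by rewrite size_cat size_nseq.
    have [/(_ _ sl) + _] := fM jl x x; move=> /le_trans; apply.
    by rewrite big_cat big_nseq -Monoid.iteropE/= mulrAC mulrA lexx.
  have Dx z : enorm (Diter f vs z) <= M * P.
    by have [/(_ _ erefl)] := fM jK z z.
  have [hle|hge] := leP (enorm h) 1.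
    have [_ /(_ _ erefl)] := fM jK x y; rewrite -/h -/P => taylor.
    set S := \sum_(_ < _) _.
    have SE : \sum_(0 <= l < (K - j).+1) (l`!%:R)^-1 *: Diter f (vs ++ nseq l h) x =
       S + \sum_(N - j <= l < (K - j).+1) (l`!%:R)^-1 *: Diter f (vs ++ nseq l h) x.
      rewrite /S -(big_mkord xpredT (fun l => (l`!%:R)^-1 *: Diter f (vs ++ nseq l h) x)).
      by rewrite -big_cat_nat//; lia.
    rewrite SE in taylor.
    set U := \sum_(N - j <= _ < _) _ in SE taylor *.
    have -> : Diter f vs y - S = Diter f vs y - (S + U) + U by rewrite opprD addrA subrK.
    rewrite (le_trans (ler_enormD _ _))//.
    have -> : 5 * M * enorm h ^+ (N - j) * P =
      M * enorm h ^+ (N - j) * P + 4 * (M * enorm h ^+ (N - j) * P) by ring.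
    apply: lerD.
      rewrite (le_trans taylor)// ler_wpM2r// ler_wpM2l//.
      rewrite -powR_mulrn//.
      have [->|hn0] := eqVneq (enorm h) 0.
        rewrite powR0 ?powR_ge0// subr_eq0 gt_eqF//.
        by apply: le_lt_trans (lip_order_lt gamma0); rewrite ler_nat.
      apply: ger_powR; first by rewrite hle andbT lt_neqAle eq_sym hn0.
      rewrite natrB//; apply: lerB => //; apply/ltW.
      by apply: le_lt_trans (lip_order_lt gamma0); rewrite ler_nat.
    rewrite (le_trans (ler_enorm_sum _ _ _))//.
    apply: (@le_trans _ _ (\sum_(N - j <= l < (K - j).+1) (l`!%:R)^-1 * (M * enorm h ^+ (N - j) * P))).
      apply: ler_sum_seq => l.
      rewrite mem_index_iota => /andP[lN lK].
      apply: le_trans (Dl l _) _; first by lia.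
      rewrite ler_wpM2l ?invr_ge0// ler_wpM2r// ler_wpM2l//.
      exact: ler_wiXn2l.
    rewrite -mulr_suml ler_wpM2r ?mulr_ge0 ?exprn_ge0//.
    apply: le_trans (sum_invfact_le (K - j).+1).
    rewrite -(big_mkord xpredT (fun l => (l`!%:R)^-1)).
    rewrite [leRHS](@big_cat_nat _ _ _ (N - j))//=; last by lia.
    by rewrite lerDr sumr_ge0// => l _; rewrite invr_ge0.
  have h1 m : 1 <= enorm h ^+ m by rewrite exprn_ege1// ltW.
  rewrite (le_trans (ler_enormB _ _))//.
  have -> : 5 * M * enorm h ^+ (N - j) * P =
      M * enorm h ^+ (N - j) * P + 4 * (M * enorm h ^+ (N - j) * P) by ring.
  apply: lerD.
    rewrite (le_trans (Dx y))// -mulrA ler_wpM2l// -[leLHS]mul1r.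
    by rewrite ler_wpM2r.
  rewrite (le_trans (ler_enorm_sum _ _ _))//.
  apply: (@le_trans _ _ (\sum_(l < N - j) (l`!%:R)^-1 * (M * enorm h ^+ (N - j) * P))).
    apply: ler_sum => l _; apply: le_trans (Dl l _) _.
      by have := ltn_ord l; lia.
    rewrite ler_wpM2l ?invr_ge0// ler_wpM2r// ler_wpM2l//.
    by apply: ler_weXn2l; [exact: ltW|exact: ltnW].
  rewrite -mulr_suml ler_wpM2r ?mulr_ge0 ?exprn_ge0//.
  exact: sum_invfact_le.
- by move=> us vs sN; apply: Diter_perm; exact: leq_trans NK.
Qed.

End OfLip.
End Jets.

(** * Iterated Lie derivatives *)

Section Expand.
Context {R : realType} {n d : nat}.
Local Notation V := 'rV[R]_n.
Variable Y : seq 'I_d -> V.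

(* The letters of v are distributed in all possible ways over l ordered slots, and a
   slot which receives the subword u contributes the vector Y u. *)
Fixpoint shp (l : nat) (v : seq 'I_d) (B : seq V -> V) : V :=
  if l is l'.+1 then
    \sum_(q <- unshuffle v) shp l' q.1 (fun us => B (Y q.2 :: us))
  else if v is [::] then B [::] else 0.

Lemma shpS l v B : shp l.+1 v B =
  \sum_(q <- unshuffle v) shp l q.1 (fun us => B (Y q.2 :: us)).
Proof. by []. Qed.

Lemma eq_shp l v (B B' : seq V -> V) :
  (forall us, size us = l -> B us = B' us) -> shp l v B = shp l v B'.
Proof.
elim: l v B B' => [|l IH] v B B' BB' /=; first by case: v => //; exact: BB'.
by apply: eq_bigr => q _; apply: IH => us us_l; rewrite BB'//= us_l.
Qed.

Lemma shp_eq0 l v : shp l v (fun=> 0) = 0.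
Proof. by elim: l v => [|l IH] v /=; [case: v|rewrite big1]. Qed.

(** The last letter falls into one of l + 1 slots. By symmetry of B they all contribute equally,
    whence the factor l + 1, which later turns 1/(l+1)! into 1/l!. *)
Lemma shp_rcons l v a (B : seq V -> V) :
  (forall us us', size us = l.+1 -> perm_eq us us' -> B us = B us') ->
  shp l.+1 (rcons v a) B = l.+1%:R *:
    \sum_(q <- unshuffle v) shp l q.1 (fun us => B (Y (rcons q.2 a) :: us)).
Proof.
elim: l v B => [|l IH] v B Bsym.
  rewrite scale1r [LHS]/= big_unshuffle_rcons; apply: eq_bigr => q _.
  by rewrite /=; case: (q.1) => [|? ?]; rewrite /= add0r.
rewrite -[LHS]/(\sum_(q <- unshuffle (rcons v a))
  shp l.+1 q.1 (fun us => B (Y q.2 :: us))) big_unshuffle_rcons big_split.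
rewrite -[l.+2]addn1 natrD scalerDl scale1r; congr (_ + _).
under eq_bigr => q _.
  rewrite (IH q.1 (fun us => B (Y q.2 :: us))); last first.
    by move=> us us' sus uu; apply: Bsym; rewrite /= ?sus// perm_cons.
  over.
rewrite -scaler_sumr; congr (_ *: _).
under [RHS]eq_bigr do rewrite shpS.
rewrite (unshuffleAC v (fun r1 q2 r2 =>
  shp l r1 (fun us => B (Y q2 :: Y (rcons r2 a) :: us)))).
apply: eq_bigr => q _; apply: eq_bigr => r _; apply: eq_shp => us us_l.
apply: Bsym => /=; first by rewrite us_l.
exact/permPl/(perm_catCA [:: Y r.2] [:: Y (rcons q.2 a)] us).
Qed.

End Expand.

Section Calculus.
Context {R : realType} {n d : nat}.
Local Notation V := 'rV[R]_n.
Variables (p : 'I_d -> R) (pm th : R) (N : 'I_d -> nat) (M : 'I_d -> R).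
Variable f : 'I_d -> V -> V.
Hypothesis p_gt0 : forall i, 0 < p i.
Hypothesis pm_gt0 : 0 < pm.
Hypothesis p_le : forall i, p i <= pm.
Hypothesis th_le : forall i, th <= (p i)^-1 + (N i)%:R / pm.
Hypothesis fJ : forall i, jet_bound (N i) (M i) (f i).
Hypothesis M_ge0 : forall i, 0 <= M i.
Implicit Types (w v : seq 'I_d) (vs us : seq V).

(* For admissible (i, j, w), x |-> D^j f_i(x)(vs) can be differentiated along the
   fields of w and once more: each direction in vs weighs as much as the lightest
   letter, see [adm_size]. *)
Definition adm (i : 'I_d) (j : nat) w : bool :=
  wlen p w + j%:R / pm + (p i)^-1 < th.

(* (f_{w_1} o ... o f_{w_m}) applied to x |-> D^j f_i(x)(vs), with o as in F^w. *)
Definition Tw i w vs : V -> V :=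
  foldr (fun a phi => lie (f a) phi) (Diter (f i) vs) w.

Lemma Tw_cons i a w vs x : Tw i (a :: w) vs x = 'd (Tw i w vs) x (f a x).
Proof. by []. Qed.

Lemma Tw_nil i vs x : Tw i [::] vs x = Diter (f i) vs x.
Proof. by []. Qed.

Lemma pm_inv_le i : pm^-1 <= (p i)^-1.
Proof. by rewrite lef_pV2 ?posrE. Qed.

Lemma wlen_cons i w : wlen p (i :: w) = (p i)^-1 + wlen p w.
Proof. by rewrite /wlen big_cons. Qed.

Lemma wlen_nil : wlen p [::] = 0.
Proof. by rewrite /wlen big_nil. Qed.

Lemma wlen_cat v w : wlen p (v ++ w) = wlen p v + wlen p w.
Proof. by rewrite /wlen big_cat. Qed.

Lemma wlen_rcons i w : wlen p (rcons w i) = wlen p w + (p i)^-1.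
Proof. by rewrite -cats1 wlen_cat wlen_cons wlen_nil addr0. Qed.

Lemma wlen_size w : (size w)%:R / pm <= wlen p w.
Proof.
elim: w => [|i w IH]; first by rewrite mul0r wlen_nil.
by rewrite wlen_cons /= -addn1 natrD mulrDl addrC lerD ?mul1r ?pm_inv_le.
Qed.

Lemma adm_size i j w : adm i j w -> (j + size w < N i)%N.
Proof.
rewrite /adm => wth; rewrite -(ltr_nat R) natrD.
have := wlen_size w; have := th_le i => h1 h2.
have : (j%:R + (size w)%:R) / pm < (N i)%:R / pm by rewrite mulrDl; lra.
by rewrite ltr_pM2r ?invr_gt0.
Qed.

Lemma inv_ge0 i : 0 <= (p i)^-1. Proof. by rewrite invr_ge0 ltW. Qed.

Lemma adm_behead i j a w : adm i j (a :: w) -> adm i j w.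
Proof. by rewrite /adm wlen_cons; have := inv_ge0 a; lra. Qed.

(** When f_a fills a new derivative of f_i, the weight 1/p_a of the letter is replaced by 1/p_max,
    which is not larger; so both factors of the product rule stay admissible. *)
Lemma adm_unshuffle i j a w q : q \in unshuffle w -> adm i j (rcons w a) ->
  adm i j.+1 q.1 /\ adm a 0 q.2.
Proof.
move=> /(unshuffle_wlen p) qw; rewrite /adm wlen_rcons -qw -addn1 natrD mulrDl.
have := pm_inv_le a; have q1 := wlen_ge0 q.1 p_gt0; have q2 := wlen_ge0 q.2 p_gt0.
have j0 : 0 <= j%:R / pm by rewrite divr_ge0// ltW.
have := inv_ge0 i; have := inv_ge0 a; rewrite mul0r mul1r.
by move=> *; split; lra.
Qed.

Lemma Tw_linear_aux m :
  (forall i w vs, (size w < m)%N -> adm i (size vs) w ->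
     forall x, differentiable (Tw i w vs) x) ->
  forall i w vs, (size w <= m)%N -> adm i (size vs).+1 w ->
  forall x, linear (fun u => Tw i w (u :: vs) x).
Proof.
move=> dm i w vs; elim: w => [|a w IH] wm aw x k u v.
  by rewrite !Tw_nil !Diter_cons diff_addr diff_scaler.
have aw' := adm_behead aw.
have -> : Tw i (a :: w) (k *: u + v :: vs) x =
    'd (k *: (Tw i w (u :: vs) : V -> V) + Tw i w (v :: vs)) x (f a x).
  rewrite Tw_cons; apply: diff_eq => y.
  exact: (IH (ltnW wm) aw').
have du : differentiable (Tw i w (u :: vs)) x by exact: dm.
have dv : differentiable (Tw i w (v :: vs)) x by exact: dm.
rewrite (diffD (differentiableZ k du) dv).
have /(congr1 (fun h => h (f a x))) kE := diffZ k du.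
exact: (congr1 (fun z => z + 'd (Tw i w (v :: vs)) x (f a x)) kE).
Qed.

(* Differentiability and the product rule need each other, hence the joint induction. *)
Lemma Tw_joint i w vs : adm i (size vs) w ->
  (forall x, differentiable (Tw i w vs) x) /\
  (forall a w', w = rcons w' a -> forall x, Tw i w vs x =
     \sum_(q <- unshuffle w') Tw i q.1 (Tw a q.2 [::] x :: vs) x).
Proof.
elim: {w}(size w).+1 {-2}w (ltnSn (size w)) i vs => // m IH w wm i vs aw.
have IHd i' w' vs' : (size w' < size w)%N -> adm i' (size vs') w' ->
    forall x, differentiable (Tw i' w' vs') x.
  by move=> sw' a'; apply: (IH w' _ i' vs' a').1; exact: leq_trans sw' _.
have IHl i' w' vs' : (size w' <= size w)%N -> adm i' (size vs').+1 w' ->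
    forall x, linear (fun u => Tw i' w' (u :: vs') x).
  exact: (@Tw_linear_aux (size w)).
case: (lastP w) wm aw IHd IHl => [|{}w a] wm aw IHd IHl.
  split=> [x|a w' /(congr1 size)]; last by rewrite size_rcons.
  by apply: (jet_diff (fJ i)); have := adm_size aw; rewrite addn0.
rewrite size_rcons in wm IHd IHl.
have is_d w1 x : (size w1 <= size w)%N -> adm i (size vs) (rcons w1 a) ->
  is_diff x
   (fun y => \sum_(q <- unshuffle w1) Tw i q.1 (Tw a q.2 [::] y :: vs) y)
   (fun h => \sum_(q <- unshuffle w1)
      ('d (Tw i q.1 (Tw a q.2 [::] x :: vs)) x h +
       Tw i q.1 ('d (Tw a q.2 [::]) x h :: vs) x)).
  move=> sw1 aw1; apply: is_diff_sum => q qw1.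
  have [a1 a2] := adm_unshuffle qw1 aw1.
  have [sq1 sq2] := unshuffle_size_le qw1.
  apply: (@is_diff_app _ _ (fun u y => Tw i q.1 (u :: vs) y)
     (fun u h => 'd (Tw i q.1 (u :: vs)) x h) (Tw a q.2 [::])
     (fun h => 'd (Tw a q.2 [::]) x h)).
  - by move=> y; apply: IHl => //; rewrite (leq_trans sq1)// ltnW.
  - move=> u; apply: DiffDef => //; apply: IHd => //.
    by rewrite ltnS (leq_trans sq1).
  - by apply: DiffDef => //; apply: IHd => //; rewrite ltnS (leq_trans sq2).
have FE x : Tw i (rcons w a) vs x =
    \sum_(q <- unshuffle w) Tw i q.1 (Tw a q.2 [::] x :: vs) x.
  case: w wm aw IHd IHl is_d => [|b w] wm aw IHd IHl is_d.
    by rewrite big_unshuffle_nil.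
  rewrite rcons_cons Tw_cons.
  have aw' : adm i (size vs) (rcons w a) by exact: adm_behead aw.
  have sm : (size (rcons w a) < m)%N by rewrite size_rcons; exact: wm.
  have [_ /(_ a w erefl) wE] := IH (rcons w a) sm i vs aw'.
  (* The product rule for the shorter word is differentiated along f_b: the letter b joins one
     factor or the other, which is the recursion of [unshuffle]. *)
  rewrite (@diff_eq _ _ _ _ x (f b x) wE).
  have [_ ->] := is_d w x (leqnSn _) aw'.
  by rewrite big_unshuffle_cons.
split=> [x|a' w' /rcons_inj[<- <-]//].
rewrite (_ : Tw i (rcons w a) vs = fun y => \sum_(q <- unshuffle w)
  Tw i q.1 (Tw a q.2 [::] y :: vs) y); last exact/funext.
by have [] := is_d w x (leqnn _) aw.
Qed.

Lemma Tw_differentiable i w vs x : adm i (size vs) w ->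
  differentiable (Tw i w vs) x.
Proof. by move=> /Tw_joint[+ _]; exact. Qed.

Lemma Tw_linear i w vs x : adm i (size vs).+1 w ->
  linear (fun u => Tw i w (u :: vs) x).
Proof.
move=> aw; apply: (@Tw_linear_aux (size w)) => // i' w' vs' _ a' y.
exact: Tw_differentiable.
Qed.

(** The innermost field f_a turns D^j f_i(vs) into D^(j+1) f_i(f_a, vs); by Leibniz the other
    letters are then distributed between the two factors. *)
Lemma Tw_rcons i a w vs x : adm i (size vs) (rcons w a) ->
  Tw i (rcons w a) vs x =
  \sum_(q <- unshuffle w) Tw i q.1 (Tw a q.2 [::] x :: vs) x.
Proof. by move=> /Tw_joint[_]; exact. Qed.

(** The field of the last letter is the one differentiated by the others, so every F^w with w
    nonempty belongs to the family [Tw]. *)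
Lemma Fw_rcons w a : Fw f (rcons w a) = Tw a w [::].
Proof.
rewrite /Fw /Tw foldr_rcons; congr (foldr _ _ w).
apply/funext => x; rewrite /lie.
by have [_ ->] := is_diff_id x.
Qed.

Definition Mw w : R := \prod_(i <- w) M i.

Lemma Mw_ge0 w : 0 <= Mw w. Proof. exact: prodr_ge0. Qed.

Lemma Mw_cat v w : Mw (v ++ w) = Mw v * Mw w.
Proof. by rewrite /Mw big_cat. Qed.

Lemma Mw_rcons w a : Mw (rcons w a) = M a * Mw w.
Proof. by rewrite /Mw -cats1 big_cat big_seq1 mulrC. Qed.

(** The product rule yields 2^m terms for a word of length m + 1. The exponent |w|^2 survives the
    induction because a^2 + b^2 <= m^2 for a + b = m, and m^2 + m <= (m+1)^2. *)
Lemma Tw_le i w vs x : adm i (size vs) w ->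
  enorm (Tw i w vs x) <=
  2 ^+ (size w ^ 2) * (M i * Mw w) * \prod_(v <- vs) enorm v.
Proof.
elim: {w}(size w).+1 {-2}w (ltnSn (size w)) i vs => // m IH w wm i vs aw.
case: (lastP w) wm aw => [|{}w a] wm aw.
  rewrite expr0 mul1r /Mw big_nil mulr1.
  apply: (jet_le (fJ i)); have := adm_size aw; rewrite addn0; exact: ltnW.
rewrite size_rcons in wm *.
rewrite Tw_rcons// (le_trans (ler_enorm_sum _ _ _))//.
apply: (@le_trans _ _ (\sum_(q <- unshuffle w) 2 ^+ (size w ^ 2) *
    (M i * (M a * Mw w)) * \prod_(v <- vs) enorm v)).
  apply: ler_sum_seq => q qw.
  have [a1 a2] := adm_unshuffle qw aw.
  have [sq1 sq2] := unshuffle_size_le qw; have sq := unshuffle_size qw.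
  have sq1m : (size q.1 < m)%N by exact: leq_ltn_trans sq1 _.
  have sq2m : (size q.2 < m)%N by exact: leq_ltn_trans sq2 _.
  apply: le_trans (IH q.1 sq1m i (_ :: vs) a1) _.
  rewrite big_cons mulrA ler_wpM2r ?prod_enorm_ge0//.
  have := IH q.2 sq2m a [::] a2; rewrite big_nil mulr1 => h2.
  apply: le_trans (ler_wpM2l _ h2) _.
    by rewrite !mulr_ge0 ?exprn_ge0 ?Mw_ge0.
  have -> : 2 ^+ (size q.1 ^ 2) * (M i * Mw q.1) * (2 ^+ (size q.2 ^ 2) * (M a * Mw q.2))
   = 2 ^+ (size q.1 ^ 2) * 2 ^+ (size q.2 ^ 2) * (M i * (M a * (Mw q.1 * Mw q.2))) by ring.
  rewrite -exprD /Mw (unshuffle_prod M qw) ler_wpM2r ?mulr_ge0 ?prodr_ge0//.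
  apply: ler_weXn2l; first by rewrite ler1n.
  by rewrite -sq; move: (size q.1) (size q.2) => c1 c2; nia.
rewrite big_const_seq count_predT size_unshuffle iter_addr_0 Mw_rcons -!mulrnAl.
rewrite ler_wpM2r ?prod_enorm_ge0// ler_wpM2r ?mulr_ge0 ?Mw_ge0//.
rewrite -mulr_natr natrX -exprD; apply: ler_weXn2l; first by rewrite ler1n.
by nia.
Qed.

Lemma Diter_zero i vs us x : (size vs + size us < N i)%N ->
  Diter (f i) (vs ++ 0 :: us) x = 0.
Proof.
move=> s; rewrite (@jet_sym _ _ _ _ _ (fJ i) _ (0 :: vs ++ us)).
- rewrite Diter_cons; have := diff_scaler (Diter (f i) (vs ++ us)) x 0 0.
  by rewrite !scale0r.
- by rewrite size_cat /=; lia.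
- by rewrite (perm_catCA vs [:: 0] us).
Qed.

(** Faa di Bruno's formula. Slots are ordered, hence the 1/l!; [Y] vanishes at the empty word, so
    every slot must receive a letter. Admissibility leaves fewer than N_i - j letters, hence the
    orders l < N_i - j exhaust the nonzero terms. The induction peels off the last letter. *)
Lemma faa_di_bruno i v vs x (Y := fun w => if w is [::] then 0 else Fw f w x) :
  adm i (size vs) v ->
  Tw i v vs x = \sum_(l < N i - size vs) (l`!%:R)^-1 *:
    shp Y l v (fun us => Diter (f i) (vs ++ us) x).
Proof.
elim: {v}(size v).+1 {-2}v (ltnSn (size v)) i vs => // m IH v vm i vs av.
have sN := adm_size av.
case E : (N i - size vs)%N => [|k]; first by lia.
rewrite big_ord_recl fact0 invr1 scale1r.
case: (lastP v) vm av sN => [|{}v a] vm av sN.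
  rewrite [X in _ = X + _](_ : _ = Tw i [::] vs x); last by rewrite /= cats0.
  rewrite big1 ?addr0// => l _; rewrite lift0 shpS.
  rewrite big_unshuffle_nil (@eq_shp _ _ _ _ _ _ _ (fun=> 0)) ?shp_eq0 ?scaler0// => us us_l.
  by rewrite /= Diter_zero// us_l; have := ltn_ord l; lia.
rewrite [X in X + _](_ : _ = 0) ?add0r; last by rewrite /=; case: (v).
rewrite size_rcons in vm; rewrite Tw_rcons//.
have symB l : (l < k)%N -> forall us us', size us = l.+1 -> perm_eq us us' ->
    Diter (f i) (vs ++ us) x = Diter (f i) (vs ++ us') x.
  move=> lk us us' sus uu; rewrite (@jet_sym _ _ _ _ _ (fJ i) _ (vs ++ us'))//.
    by rewrite size_cat sus; lia.
  by rewrite perm_cat2l.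
under [RHS]eq_bigr => l _.
  rewrite lift0 shp_rcons; last by apply: symB.
  rewrite factS natrM invfM scalerA -mulrA mulrCA mulVf ?pnatr_eq0// mulr1.
  rewrite scaler_sumr.
  over.
rewrite exchange_big/=; rewrite big_seq [RHS]big_seq; apply: eq_bigr => q qv.
have [a1 a2] := adm_unshuffle qv av.
have [sq _] := unshuffle_size_le qv.
rewrite IH//; last exact: leq_ltn_trans sq _.
have -> : (N i - size (Tw a q.2 [::] x :: vs))%N = k by rewrite /=; lia.
apply: eq_bigr => l _; congr (_ *: _); apply: eq_shp => us us_l.
have -> : Y (rcons q.2 a) = Tw a q.2 [::] x.
  by rewrite -Fw_rcons /Y; case: (q.2).
rewrite cat_cons (@jet_sym _ _ _ _ _ (fJ i) _ (vs ++ Tw a q.2 [::] x :: us))//.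
  by rewrite /= size_cat us_l; have := ltn_ord l; lia.
by rewrite perm_sym (perm_catCA vs [:: _] us).
Qed.

End Calculus.

Section PowR.
Context {R : realType}.
Implicit Types r a b c : R.

Lemma powR_le1 r a c : 0 <= r <= 1 -> 0 < c -> c <= a -> r `^ a <= r `^ c.
Proof.
move=> /andP[r0 r1] c0 ca; have [->|rn0] := eqVneq r 0.
  by rewrite powR0 ?powR_ge0// gt_eqF// (lt_le_trans c0).
by apply: ger_powR => //; rewrite r1 andbT lt_neqAle eq_sym rn0.
Qed.

Lemma powR_le_one r c : 0 <= r <= 1 -> 0 < c -> r `^ c <= 1.
Proof.
move=> /andP[r0 r1] c0.
have := @ge0_ler_powR R c (ltW c0) r 1; rewrite powR1 !nnegrE.
by apply.
Qed.

Lemma le_powR_self r c : 0 <= r <= 1 -> 0 < c -> c <= 1 -> r <= r `^ c.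
Proof.
move=> r01 c0 c1; rewrite -{1}(@powRr1 _ r) ?powR_le1//.
by case/andP: r01.
Qed.

End PowR.

Section ShpBounds.
Context {R : realType} {n d : nat}.
Local Notation V := 'rV[R]_n.
Variable Y : seq 'I_d -> V.

Lemma shp_linear l v (B : V -> seq V -> V) :
  (forall us, size us = l -> linear (fun u => B u us)) ->
  linear (fun u => shp Y l v (B u)).
Proof.
elim: l v B => [|l IH] v B Blin k u u'.
  by case: v => [|? ?] /=; [exact: Blin|rewrite scaler0 addr0].
rewrite !shpS scaler_sumr -big_split; apply: eq_bigr => q _ /=.
apply: (IH q.1 (fun u us => B u (Y q.2 :: us))) => us us_l.
by apply: Blin; rewrite /= us_l.
Qed.

(** Linearity of each entry with the earlier ones frozen, in the form in which an induction on the
    number of entries consumes it. *)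
Fixpoint multilinear l (B : seq V -> V) : Prop :=
  if l is l'.+1 then
    (forall us, size us = l' -> linear (fun u => B (u :: us))) /\
    forall u, multilinear l' (fun us => B (u :: us))
  else True.

End ShpBounds.

(** * Taylor expansion along a group-like element *)

Section Remainder.
Context {R : realType} {n d : nat}.
Local Notation V := 'rV[R]_n.
Variables (p : 'I_d -> R) (pm th : R) (N : 'I_d -> nat) (M : 'I_d -> R).
Variable f : 'I_d -> V -> V.
Hypothesis p_gt0 : forall i, 0 < p i.
Hypothesis pm_ge1 : 1 <= pm.
Hypothesis p_le : forall i, p i <= pm.
Hypothesis th_le : forall i, th <= (p i)^-1 + (N i)%:R / pm.
Hypothesis th_le1 : th - pm^-1 <= 1.
Hypothesis th_gt1 : 1 < th.
Hypothesis fJ : forall i, jet_bound (N i) (M i) (f i).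
Hypothesis M_ge0 : forall i, 0 <= M i.
Variable Ws : seq (seq 'I_d).
Variables Lm Nm : nat.
Hypothesis uWs : uniq Ws.
Hypothesis WsP : forall v, (v \in Ws) = (wlen p v < th).
Hypothesis WsL : forall v, v \in Ws -> (size v <= Lm)%N.
Hypothesis NNm : forall i, (N i <= Nm)%N.
(* g is X_{s,t}, x0 and y are the values of the solution at s and t, and r is a
   control of [s,t]. *)
Variables (g : seq 'I_d -> R) (r : R) (x0 y : V).
Hypothesis g_nil : g [::] = 1.
Hypothesis g_sh : forall u v, wlen p u + wlen p v < th ->
  g u * g v = \sum_(w <- shuffle u v) g w.
Hypothesis r01 : 0 <= r <= 1.
Hypothesis g_le : forall v, v \in Ws -> `|g v| * Mw M v <= r `^ wlen p v.
Local Notation h := (y - x0).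
Hypothesis h_le :
  enorm (h - \sum_(v <- Ws | v != [::]) g v *: Fw f v x0) <= r.
Implicit Types (w v : seq 'I_d) (vs us : seq V) (c : R).

Local Notation adm := (adm p pm th).
Local Notation Tw := (Tw f).
Let pm_gt0 : 0 < pm. Proof. exact: lt_le_trans pm_ge1. Qed.
Let r0 : 0 <= r. Proof. by case/andP: r01. Qed.
Let S : R := (size Ws)%:R.
(** The combinatorial factor of [Tw_le], made uniform over the words of [Ws]. *)
Let kap : R := 2 ^+ (Lm ^ 2).
Let S0 : 0 <= S. Proof. by rewrite /S. Qed.
Let kap0 : 0 <= kap. Proof. by rewrite exprn_ge0. Qed.

Let Y v := if v is [::] then 0 else Fw f v x0.

Lemma sum_Ws_le (P : pred (seq 'I_d)) (F : seq 'I_d -> R) (C : R) : 0 <= C ->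
  (forall v, v \in Ws -> P v -> F v <= C) -> \sum_(v <- Ws | P v) F v <= S * C.
Proof.
move=> C0 FC; apply: (@le_trans _ _ (\sum_(v <- Ws) C)).
  rewrite big_mkcond; apply: ler_sum_seq => v vW.
  by case: ifPn => // Pv; exact: FC.
by rewrite big_const_seq count_predT iter_addr_0 /S mulr_natl.
Qed.

Lemma mem_Ws_unshuffle v q : v \in Ws -> q \in unshuffle v ->
  q.1 \in Ws /\ q.2 \in Ws.
Proof.
rewrite !WsP => vW /(unshuffle_wlen p) qv.
have := wlen_ge0 q.1 p_gt0; have := wlen_ge0 q.2 p_gt0.
by move: vW; rewrite -qv => *; split; lra.
Qed.

Lemma Tw_le_kap i w vs x : adm i (size vs) w ->
  enorm (Tw i w vs x) <= kap * (M i * Mw M w) * \prod_(v <- vs) enorm v.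
Proof.
move=> aw; apply: le_trans (Tw_le p_gt0 pm_gt0 p_le th_le fJ M_ge0 x aw) _.
rewrite ler_wpM2r ?prod_enorm_ge0// ler_wpM2r ?mulr_ge0 ?Mw_ge0//.
apply: ler_weXn2l; first by rewrite ler1n.
have : w \in Ws.
  rewrite WsP; move: aw; rewrite /adm.
  have : 0 <= (size vs)%:R / pm by rewrite divr_ge0// ltW.
  by have := inv_ge0 p_gt0 i => *; lra.
by move=> /WsL; rewrite leq_exp2r.
Qed.

Lemma Y_le v : v \in Ws -> enorm (Y v) <= kap * Mw M v.
Proof.
case: (lastP v) => [|{}v a] vW; first by rewrite /= enorm0 mulr_ge0 ?Mw_ge0.
have -> : Y (rcons v a) = Tw a v [::] x0.
  by rewrite -Fw_rcons /Y; case: (v).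
have av : adm a (size (@nil V)) v.
  by move: vW; rewrite WsP wlen_rcons /adm mul0r addr0.
by have := Tw_le_kap x0 av; rewrite big_nil mulr1 Mw_rcons.
Qed.

Lemma gM_le v (b C : R) : v \in Ws -> 0 <= C -> b <= C * Mw M v ->
  `|g v| * b <= C * r `^ wlen p v.
Proof.
move=> vW C0 bC; apply: le_trans (ler_wpM2l (normr_ge0 _) bC) _.
by rewrite mulrCA ler_wpM2l// g_le.
Qed.

Let K4 : R := 1 + S * kap.
Let K41 : 1 <= K4. Proof. by rewrite lerDl mulr_ge0. Qed.
Let K40 : 0 <= K4. Proof. exact: le_trans K41. Qed.

(** Lowering the truncation to c costs a multiple of r^c: a discarded word has |v| >= c and r <= 1,
    and the error r of the full expansion is below r^c because c <= 1. *)
Lemma h_rem c : 0 < c -> c <= 1 ->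
  enorm (h - \sum_(v <- Ws | wlen p v < c) g v *: Y v) <= K4 * r `^ c.
Proof.
move=> c0 c1.
have YE : \sum_(v <- Ws | v != [::]) g v *: Fw f v x0 = \sum_(v <- Ws) g v *: Y v.
  rewrite big_mkcond; apply: eq_bigr => -[|a v] _ //=.
  by rewrite scaler0.
have hle := h_le; rewrite YE in hle.
have -> : h - \sum_(v <- Ws | wlen p v < c) g v *: Y v =
   (h - \sum_(v <- Ws) g v *: Y v) + \sum_(v <- Ws | ~~ (wlen p v < c)) g v *: Y v.
  rewrite (bigID (fun v => wlen p v < c) xpredT)/= opprD addrA.
  by rewrite subrK.
apply: le_trans (ler_enormD _ _) _; rewrite mulrDl mul1r lerD//.
  by rewrite (le_trans hle)// le_powR_self.
apply: le_trans (ler_enorm_sum _ _ _) _; rewrite -mulrA; apply: sum_Ws_le.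
  by rewrite mulr_ge0 ?powR_ge0.
move=> v vW; rewrite -leNgt => cv; rewrite enormZ.
apply: le_trans (gM_le vW kap0 (Y_le vW)) _.
by rewrite ler_wpM2l// powR_le1.
Qed.

(** At truncation level 1/p_max no nonempty word is left in the expansion. *)
Lemma h_le_root : enorm h <= K4 * r `^ pm^-1.
Proof.
have c0 : 0 < pm^-1 by rewrite invr_gt0.
have c1 : pm^-1 <= 1 by rewrite invf_le1.
have := h_rem c0 c1; rewrite big1 ?subr0// => -[|a v]; first by rewrite scaler0.
rewrite wlen_cons; have := wlen_ge0 v p_gt0; have := pm_inv_le p_gt0 pm_gt0 p_le a.
by move=> *; exfalso; lra.
Qed.

Lemma h_le_K4 : enorm h <= K4.
Proof.
apply: le_trans h_le_root _; rewrite ler_piMr//.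
by apply: powR_le_one => //; rewrite invr_gt0.
Qed.

(** The product of two expansions along g. The error is that of a0 applied to z, plus the sum over v
    of g v A_v applied to the error of z at level c - |v|; the latter is of order r^|v| r^(c-|v|) =
    r^c. Group-likeness, through [big_shuffle], puts the product of the two sums back into the form
    of a single expansion. *)
Lemma prod_rem c (a0 : V -> V) (A : seq 'I_d -> V -> V) (z : V)
    (Z : seq 'I_d -> V) (k1 k2 k3 k4 : R) :
  0 <= k1 -> 0 <= k2 -> 0 <= k4 ->
  0 < c -> c <= th ->
  (forall u, enorm (a0 u - \sum_(v <- Ws | wlen p v < c) g v *: A v u) <=
     k1 * r `^ c * enorm u) ->
  (forall v, wlen p v < c -> linear (A v)) ->
  (forall v u, wlen p v < c -> enorm (A v u) <= k2 * Mw M v * enorm u) ->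
  enorm z <= k3 ->
  (forall c', 0 < c' -> c' <= c ->
     enorm (z - \sum_(v <- Ws | wlen p v < c') g v *: Z v) <= k4 * r `^ c') ->
  enorm (a0 z - \sum_(v <- Ws | wlen p v < c)
    g v *: \sum_(q <- unshuffle v) A q.1 (Z q.2)) <=
  (k1 * k3 + S * (k2 * k4)) * r `^ c.
Proof.
move=> k10 k20 k40 c0 cth H1 Alin H2 H3 H4.
rewrite (@big_shuffle _ _ _ p g Ws c (fun v1 v2 => A v1 (Z v2)))//; last 2 first.
  by move=> v vc; rewrite WsP (lt_le_trans vc).
  by move=> u v uv; apply: g_sh; exact: lt_le_trans uv cth.
have A0 v : wlen p v < c -> A v 0 = 0.
  move=> vc; have := Alin v vc (-1) 0 0.
  by rewrite /= scaler0 addr0 scaleN1r addNr.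
have Asum v P (F : seq 'I_d -> V) : wlen p v < c ->
    A v (\sum_(v2 <- Ws | P v2) g v2 *: F v2) =
    \sum_(v2 <- Ws | P v2) g v2 *: A v (F v2).
  move=> vc; elim/big_rec2 : _ => [|v2 y1 y2 _ <-]; first exact: A0.
  by rewrite (Alin v vc).
have AB v u u' : wlen p v < c -> A v (u - u') = A v u - A v u'.
  move=> vc; have := Alin v vc (-1) u' u.
  by rewrite /= !scaleN1r => e; rewrite addrC e addrC.
have -> : a0 z - \sum_(v1 <- Ws | wlen p v1 < c)
    \sum_(v2 <- Ws | wlen p v2 < c - wlen p v1) (g v1 * g v2) *: A v1 (Z v2) =
  (a0 z - \sum_(v <- Ws | wlen p v < c) g v *: A v z) +
  \sum_(v <- Ws | wlen p v < c) g v *: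
     A v (z - \sum_(v2 <- Ws | wlen p v2 < c - wlen p v) g v2 *: Z v2).
  rewrite -addrA; congr (_ + _).
  rewrite -sumrN -sumrN -big_split; apply: eq_bigr => v vc /=.
  rewrite AB// scalerBr addrA addNr add0r Asum// scaler_sumr; congr (- _).
  by apply: eq_bigr => v2 _; rewrite scalerA.
apply: le_trans (ler_enormD _ _) _; rewrite mulrDl lerD//.
  apply: le_trans (H1 z) _; rewrite mulrAC ler_wpM2r ?powR_ge0//.
  by rewrite ler_wpM2l.
apply: le_trans (ler_enorm_sum _ _ _) _; rewrite -mulrA; apply: sum_Ws_le.
  by rewrite !mulr_ge0 ?powR_ge0.
move=> v vW vc; rewrite enormZ.
have c'0 : 0 < c - wlen p v by rewrite subr_gt0.
have c'c : c - wlen p v <= c by rewrite gerBl wlen_ge0.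
have := H4 _ c'0 c'c => zc.
apply: (@le_trans _ _ (k2 * (k4 * r `^ (c - wlen p v)) * r `^ wlen p v)).
  apply: gM_le => //; first by rewrite !mulr_ge0 ?powR_ge0.
  apply: le_trans (H2 v _ vc) _.
  by rewrite mulrAC ler_wpM2r ?Mw_ge0// ler_wpM2l.
rewrite -!mulrA -powRD ?subrK//.
by rewrite gt_eqF.
Qed.

Let D2 : R := 2 ^+ Lm.

Lemma sum_unshuffle_le v (F : seq 'I_d * seq 'I_d -> R) (C : R) : v \in Ws ->
  0 <= C -> (forall q, q \in unshuffle v -> F q <= C) ->
  \sum_(q <- unshuffle v) F q <= D2 * C.
Proof.
move=> vW C0 FC; apply: (@le_trans _ _ (\sum_(q <- unshuffle v) C)).
  exact: ler_sum_seq.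
rewrite big_const_seq count_predT size_unshuffle iter_addr_0 -mulr_natl.
rewrite ler_wpM2r// /D2 natrX; apply: ler_weXn2l; first by rewrite ler1n.
exact: WsL.
Qed.

Lemma shp_le l v (B : seq V -> V) (b : R) : 0 <= b -> v \in Ws ->
  (forall us, size us = l -> enorm (B us) <= b * \prod_(u <- us) enorm u) ->
  enorm (shp Y l v B) <= (D2 * kap) ^+ l * b * Mw M v.
Proof.
elim: l v B b => [|l IH] v B b b0 vW Bb.
  rewrite expr0 mul1r; case: v vW => [|a v] vW /=.
    by have := Bb [::] erefl; rewrite /Mw !big_nil.
  by rewrite enorm0 mulr_ge0 ?Mw_ge0.
have D0 : 0 <= D2 by rewrite exprn_ge0.
rewrite shpS; apply: le_trans (ler_enorm_sum _ _ _) _.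
rewrite exprSr -!mulrA [_ * (D2 * _)]mulrCA; apply: sum_unshuffle_le => //.
  by rewrite !mulr_ge0 ?exprn_ge0 ?Mw_ge0// mulr_ge0.
move=> q qv; have [q1 q2] := mem_Ws_unshuffle vW qv.
apply: le_trans (IH q.1 _ (b * enorm (Y q.2)) _ q1 _) _.
- by rewrite mulr_ge0 ?enorm_ge0.
- move=> us us_l; have := Bb (Y q.2 :: us); rewrite /= us_l big_cons mulrA.
  exact.
have -> : Mw M v = Mw M q.1 * Mw M q.2 by rewrite /Mw (unshuffle_prod M qv).
have -> : (D2 * kap) ^+ l * (b * enorm (Y q.2)) * Mw M q.1 =
  (D2 * kap) ^+ l * b * Mw M q.1 * enorm (Y q.2) by ring.
have -> : (D2 * kap) ^+ l * (kap * (b * (Mw M q.1 * Mw M q.2))) =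
  (D2 * kap) ^+ l * b * Mw M q.1 * (kap * Mw M q.2) by ring.
by rewrite ler_wpM2l ?Y_le// !mulr_ge0 ?Mw_ge0 ?exprn_ge0 ?mulr_ge0.
Qed.

Fixpoint Kl l : R :=
  if l is l'.+1 then Kl l' * K4 + S * ((D2 * kap) ^+ l' * K4) else 0.

Lemma Kl_ge0 l : 0 <= Kl l.
Proof.
have D0 : 0 <= D2 by rewrite exprn_ge0.
by elim: l => //= l IH; rewrite addr_ge0 ?mulr_ge0 ?exprn_ge0 ?mulr_ge0.
Qed.

(** Multiplies the expansion of h by itself l times, one [prod_rem] per entry; [Kl] is the constant
    of this recursion. *)
Lemma monomial_rem c l (B : seq V -> V) (b : R) : 0 < c -> c <= 1 -> 0 <= b ->
  multilinear l B ->
  (forall us, size us = l -> enorm (B us) <= b * \prod_(u <- us) enorm u) ->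
  enorm (B (nseq l h) - \sum_(v <- Ws | wlen p v < c) g v *: shp Y l v B) <=
  Kl l * b * r `^ c.
Proof.
move=> c0 c1; have D0 : 0 <= D2 by rewrite exprn_ge0.
have cth : c <= th by rewrite (le_trans c1)// ltW.
elim: l B b => [|l IH] B b b0 Blin Bb.
  have nW : [::] \in Ws by rewrite WsP wlen_nil (lt_trans _ th_gt1).
  rewrite big_mkcond (bigD1_seq [::])//= wlen_nil c0 g_nil scale1r big1.
    by rewrite addr0 subrr enorm0 !mul0r.
  by case=> //= a v _; case: ifP; rewrite ?scaler0.
case: Blin => Blin1 Blin2.
pose A v u := shp Y l v (fun us => B (u :: us)).
have Bbu u us : size us = l -> enorm (B (u :: us)) <= b * enorm u * \prod_(v <- us) enorm v.
  by move=> us_l; have := Bb (u :: us); rewrite /= us_l big_cons mulrA; exact.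
have vWc v : wlen p v < c -> v \in Ws by move=> vc; rewrite WsP (lt_le_trans vc).
have := @prod_rem c (fun u => B (u :: nseq l h)) A h Y
  (Kl l * b) ((D2 * kap) ^+ l * b) K4 K4.
have -> : Kl l.+1 * b = Kl l * b * K4 + S * ((D2 * kap) ^+ l * b * K4).
  by rewrite /=; ring.
apply => //.
- by rewrite mulr_ge0 ?Kl_ge0.
- by rewrite !mulr_ge0 ?exprn_ge0 ?mulr_ge0.
- move=> u; have := IH (fun us => B (u :: us)) (b * enorm u) _ (Blin2 u) (Bbu u).
  move=> /(_ (mulr_ge0 b0 (enorm_ge0 _))); rewrite /A mulrA => /le_trans; apply.
  by rewrite mulrAC.
- move=> v vc; apply: (@shp_linear _ _ _ Y l v (fun u us => B (u :: us))).
  exact: Blin1.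
- move=> v u vc.
  have := @shp_le l v (fun us => B (u :: us)) (b * enorm u) (mulr_ge0 b0 (enorm_ge0 _)) (vWc _ vc) (Bbu u).
  by rewrite mulrA [X in _ <= X]mulrAC.
- exact: h_le_K4.
- by move=> c' c'0 c'c; apply: h_rem => //; exact: le_trans c1.
Qed.

Let Kb : R := 5 * K4 ^+ Nm + \sum_(l < Nm) Kl l.

Lemma Kb_ge0 : 0 <= Kb.
Proof.
rewrite addr_ge0// ?mulr_ge0 ?exprn_ge0//.
by apply: sumr_ge0 => l _; exact: Kl_ge0.
Qed.

(** Symmetry of the derivatives moves each argument to the front, where linearity is that of a
    differential. *)
Lemma Diter_multilinear i l vs : (size vs + l <= N i)%N ->
  multilinear l (fun us => Diter (f i) (vs ++ us) x0).
Proof.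
elim: l vs => // l IH vs vl; split=> [us us_l k u u'|u].
  have symm (w : V) : Diter (f i) (vs ++ w :: us) x0 = Diter (f i) (w :: vs ++ us) x0.
    rewrite (@jet_sym _ _ _ _ _ (fJ i) _ (w :: vs ++ us))//.
      by rewrite size_cat /= us_l.
    by rewrite (perm_catCA vs [:: w] us).
  by rewrite !symm !Diter_cons diff_addr diff_scaler.
have := IH (rcons vs u); rewrite size_rcons addSnnS => /(_ vl).
rewrite [X in multilinear l X -> _](_ : _ = fun us => Diter (f i) (vs ++ u :: us) x0)//.
by apply/funext => us; rewrite cat_rcons.
Qed.

(** Taylor's formula at x0, each monomial expanded along g and the result recognized by Faa di
    Bruno's formula. The Taylor error is of order |h|^(N_i-j), that is r^((N_i-j)/p_max), and the
    hypotheses on th and c give c <= (N_i-j)/p_max. *)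
Lemma Diter_rem i vs c : 0 < c -> c + (size vs)%:R / pm + (p i)^-1 <= th ->
  enorm (Diter (f i) vs y - \sum_(v <- Ws | wlen p v < c) g v *: Tw i v vs x0) <=
  Kb * M i * r `^ c * \prod_(v <- vs) enorm v.
Proof.
rewrite -/(size vs); set j := size vs; move=> c0 cth; set P := \prod_(v <- vs) _.
have P0 : 0 <= P by exact: prod_enorm_ge0.
have j0 : 0 <= j%:R / pm by rewrite divr_ge0// ltW.
have pi_pm := pm_inv_le p_gt0 pm_gt0 p_le i.
have c1 : c <= 1.
  apply: le_trans th_le1; rewrite lerBrDr; apply: le_trans cth.
  by rewrite lerD// lerDl.
have av v : wlen p v < c -> adm i (size vs) v.
  by move=> vc; rewrite /adm -/j; lra.
have jN : (j < N i)%N.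
  have := adm_size p_gt0 pm_gt0 p_le th_le (av [::] _); rewrite addn0; apply.
  by rewrite wlen_nil.
pose B us := Diter (f i) (vs ++ us) x0.
have -> : Diter (f i) vs y - \sum_(v <- Ws | wlen p v < c) g v *: Tw i v vs x0 =
  (Diter (f i) vs y - \sum_(l < N i - j) (l`!%:R)^-1 *: B (nseq l h)) +
  \sum_(l < N i - j) (l`!%:R)^-1 *:
     (B (nseq l h) - \sum_(v <- Ws | wlen p v < c) g v *: shp Y l v B).
  under [X in _ = _ + X]eq_bigr do rewrite scalerBr.
  rewrite sumrB addrA subrK; congr (_ - _).
  under [RHS]eq_bigr do rewrite scaler_sumr.
  rewrite exchange_big/=; apply: eq_bigr => v vc.
  rewrite (faa_di_bruno p_gt0 pm_gt0 p_le th_le fJ x0 (av v vc)) scaler_sumr.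
  by apply: eq_bigr => l _; rewrite !scalerA mulrC.
apply: le_trans (ler_enormD _ _) _.
have -> : Kb * M i * r `^ c * P =
  5 * K4 ^+ Nm * M i * r `^ c * P + (\sum_(l < Nm) Kl l) * M i * r `^ c * P.
  by rewrite /Kb; ring.
apply: lerD.
  apply: le_trans (jet_taylor (fJ i) x0 y (ltnW jN)) _.
  rewrite -/j -/P ler_wpM2r//.
  rewrite -[5 * _ * M i]mulrA -[5 * _ * _]mulrA -!mulrA ler_wpM2l//.
  rewrite [leRHS]mulrCA ler_wpM2l//.
  apply: (@le_trans _ _ ((K4 * r `^ pm^-1) ^+ (N i - j))).
    by rewrite lerXn2r ?nnegrE ?enorm_ge0 ?mulr_ge0 ?powR_ge0 ?h_le_root.
  rewrite exprMn ler_pM ?exprn_ge0 ?powR_ge0//.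
    apply: ler_weXn2l => //; exact: leq_trans (leq_subr _ _) (NNm i).
  rewrite -powR_mulrn ?powR_ge0// -powRrM; apply: powR_le1 => //.
  rewrite natrB 1?ltnW// mulrBr.
  by have := th_le i; rewrite [pm^-1 * _]mulrC [pm^-1 * _]mulrC; lra.
apply: le_trans (ler_enorm_sum _ _ _) _.
rewrite !mulr_suml.
apply: (@le_trans _ _ (\sum_(l < N i - j) Kl l * M i * r `^ c * P)); last first.
  have NN : (N i - j <= Nm)%N by exact: leq_trans (leq_subr _ _) (NNm i).
  rewrite (big_ord_widen _ (fun l => Kl l * M i * r `^ c * P) NN) big_mkcond/=.
  apply: ler_sum => l _; case: ifP => // _.
  by rewrite !mulr_ge0 ?powR_ge0 ?Kl_ge0.
apply: ler_sum => l _; rewrite enormZ -[leRHS]mul1r ler_pM ?enorm_ge0//.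
  by rewrite ger0_norm ?invr_ge0// invf_le1 ?ltr0n ?fact_gt0// ler1n fact_gt0.
have lN : (j + l <= N i)%N by have := ltn_ord l; rewrite ltn_subRL => /ltnW.
have := @monomial_rem c l B (M i * P) c0 c1 (mulr_ge0 (M_ge0 i) P0).
have -> : Kl l * (M i * P) * r `^ c = Kl l * M i * r `^ c * P by ring.
apply; first exact: Diter_multilinear.
move=> us us_l; have := jet_le (fJ i) (vs := vs ++ us) x0.
by rewrite size_cat us_l big_cat/= mulrA => /(_ lN).
Qed.

Fixpoint krem m : R :=
  if m is m'.+1 then krem m' + D2 * (kap + S * kap) * krem m' else Kb.

Lemma krem_ge0 m : 0 <= krem m.
Proof.
have D0 : 0 <= D2 by rewrite exprn_ge0.
elim: m => [|m IH]; first exact: Kb_ge0.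
by rewrite /= addr_ge0// !mulr_ge0// addr_ge0// mulr_ge0.
Qed.

(** Induction on the length of w: the product rule writes [Tw] as a sum of products of two members
    of the family with shorter words, both expanded by the induction hypothesis and multiplied by
    [prod_rem]. The extra derivative is paid for by the last letter of w, so the constraint on c is
    inherited. *)
Lemma Tw_rem m i w vs c : (size w <= m)%N -> 0 < c ->
  c + wlen p w + (size vs)%:R / pm + (p i)^-1 <= th ->
  enorm (Tw i w vs y - \sum_(v <- Ws | wlen p v < c) g v *: Tw i (v ++ w) vs x0) <=
  krem m * (M i * Mw M w) * r `^ c * \prod_(v <- vs) enorm v.
Proof.
have D0 : 0 <= D2 by rewrite exprn_ge0.
elim: m i w vs c => [|m IH] i w vs c wm c0 cth.
  move: wm cth; rewrite leqn0 size_eq0 => /eqP ->; rewrite wlen_nil addr0 => cth.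
  under [X in enorm (_ - X)]eq_bigr do rewrite cats0.
  have -> : Mw M [::] = 1 by rewrite /Mw big_nil.
  by rewrite mulr1 Diter_rem.
case: (ltnP (size w) m.+1) => [sw|sw].
  apply: le_trans (IH i w vs c sw c0 cth) _.
  rewrite ler_wpM2r ?prod_enorm_ge0// ler_wpM2r ?powR_ge0//.
  rewrite ler_wpM2r ?mulr_ge0 ?Mw_ge0//= lerDl !mulr_ge0 ?krem_ge0//.
  by rewrite addr_ge0// mulr_ge0.
case: (lastP w) wm cth sw => [//|{}w a]; rewrite size_rcons ltnS => wm cth _.
set P := \prod_(v <- vs) _; have P0 : 0 <= P by exact: prod_enorm_ge0.
rewrite wlen_rcons in cth.
have j0 : 0 <= (size vs)%:R / pm by rewrite divr_ge0// ltW.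
have pi0 := inv_ge0 p_gt0 i; have pa0 := inv_ge0 p_gt0 a.
have pa := pm_inv_le p_gt0 pm_gt0 p_le a.
have av v : wlen p v < c -> adm i (size vs) (rcons (v ++ w) a).
  by move=> vc; rewrite /adm wlen_rcons wlen_cat; lra.
have wW : w \in Ws by rewrite WsP; lra.
rewrite (Tw_rcons p_gt0 pm_gt0 p_le th_le fJ); last first.
  by rewrite /adm wlen_rcons; lra.
have TE v : wlen p v < c -> Tw i (v ++ rcons w a) vs x0 =
   \sum_(q <- unshuffle w) \sum_(r <- unshuffle v)
     Tw i (r.1 ++ q.1) (Tw a (r.2 ++ q.2) [::] x0 :: vs) x0.
  move=> vc; rewrite -rcons_cat (Tw_rcons p_gt0 pm_gt0 p_le th_le fJ) ?av//.
  by rewrite big_unshuffle_cat exchange_big.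
under [X in enorm (_ - X)]eq_bigr => v vc do rewrite TE// scaler_sumr.
rewrite exchange_big -sumrB.
apply: le_trans (ler_enorm_sum _ _ _) _ => /=.
have E : D2 * ((kap + S * kap) * krem m * (M i * (M a * Mw M w)) * r `^ c * P) <=
  (krem m + D2 * (kap + S * kap) * krem m) * (M i * Mw M (rcons w a)) * r `^ c * P.
  rewrite Mw_rcons !mulrA ler_wpM2r// ler_wpM2r ?powR_ge0// ler_wpM2r ?Mw_ge0//.
  by rewrite ler_wpM2r// ler_wpM2r// lerDr krem_ge0.
apply: le_trans E; apply: sum_unshuffle_le => //.
  by rewrite !mulr_ge0 ?powR_ge0 ?krem_ge0 ?Mw_ge0// addr_ge0// mulr_ge0.
move=> q qw.
have [s1 s2] := unshuffle_size_le qw.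
have qwl := unshuffle_wlen p qw.
have q10 := wlen_ge0 q.1 p_gt0; have q20 := wlen_ge0 q.2 p_gt0.
have jS : (size vs).+1%:R / pm = (size vs)%:R / pm + pm^-1.
  by rewrite -addn1 natrD mulrDl mul1r.
have := @prod_rem c (fun u => Tw i q.1 (u :: vs) y)
  (fun v u => Tw i (v ++ q.1) (u :: vs) x0) (Tw a q.2 [::] y)
  (fun v => Tw a (v ++ q.2) [::] x0)
  (krem m * (M i * Mw M q.1) * P) (kap * (M i * Mw M q.1) * P)
  (kap * (M a * Mw M q.2)) (krem m * (M a * Mw M q.2)).
have -> : krem m * (M i * Mw M q.1) * P * (kap * (M a * Mw M q.2)) +
   S * (kap * (M i * Mw M q.1) * P * (krem m * (M a * Mw M q.2))) =
   (kap + S * kap) * krem m * (M i * (M a * (Mw M q.1 * Mw M q.2))) * P by ring.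
have -> : Mw M q.1 * Mw M q.2 = Mw M w by rewrite /Mw (unshuffle_prod M qw).
move=> H.
have a1 v : wlen p v < c -> adm i (size vs).+1 (v ++ q.1).
  by move=> vc; rewrite /adm jS wlen_cat; lra.
have a2 v : wlen p v < c -> adm a 0 (v ++ q.2).
  by move=> vc; rewrite /adm mul0r addr0 wlen_cat; lra.
have -> : (kap + S * kap) * krem m * (M i * (M a * Mw M w)) * r `^ c * P =
  (kap + S * kap) * krem m * (M i * (M a * Mw M w)) * P * r `^ c by ring.
apply: H => //.
- by rewrite !mulr_ge0 ?krem_ge0 ?Mw_ge0.
- by rewrite !mulr_ge0 ?Mw_ge0.
- by rewrite !mulr_ge0 ?krem_ge0 ?Mw_ge0.
- by lra.
- move=> u; have := IH i q.1 (u :: vs) c (leq_trans s1 wm) c0.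
  rewrite [size (u :: vs)]/= jS big_cons -/P => /(_ _)/le_trans; apply; first by lra.
  by rewrite le_eqVlt; apply/orP; left; apply/eqP; ring.
- move=> v vc; apply: (Tw_linear p_gt0 pm_gt0 p_le th_le fJ x0); exact: a1.
- move=> v u vc; have := @Tw_le_kap i (v ++ q.1) (u :: vs) x0 (a1 v vc).
  rewrite big_cons -/P Mw_cat => /le_trans; apply.
  by rewrite le_eqVlt; apply/orP; left; apply/eqP; ring.
- have a20 : adm a (size (@nil V)) q.2 by apply: (a2 [::]); rewrite wlen_nil.
  by have := Tw_le_kap y a20; rewrite big_nil mulr1.
- move=> c' c'0 c'c; have := IH a q.2 [::] c' (leq_trans s2 wm) c'0.
  by rewrite mul0r addr0 big_nil mulr1; apply; lra.
Qed.

(** The full order th - |w| is used: multiplied by an increment of order |w|, the error becomes of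
    order th. *)
Lemma Fw_rem w : w \in Ws -> w != [::] ->
  enorm (Fw f w y - \sum_(v <- Ws | wlen p v < th - wlen p w)
     g v *: Fw f (v ++ w) x0) <=
  krem Lm * Mw M w * r `^ (th - wlen p w).
Proof.
case: (lastP w) => [//|{}w i] wW _.
have sw : (size w <= Lm)%N.
  by have := WsL wW; rewrite size_rcons; exact: ltnW.
have c0 : 0 < th - wlen p (rcons w i) by rewrite subr_gt0 -WsP.
have := @Tw_rem Lm i w [::] _ sw c0; rewrite mul0r addr0 wlen_rcons.
rewrite big_nil mulr1 Mw_rcons Fw_rcons => /(_ _)/(le_trans _); apply; last by lra.
rewrite le_eqVlt; apply/orP; left; apply/eqP; congr (enorm (_ - _)).
by apply: eq_bigr => v _; rewrite -rcons_cat Fw_rcons.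
Qed.

End Remainder.

(** * Increments and the discrete sewing lemma *)

Section GroupLike.
Context {R : realType} {d : nat}.
Implicit Types (a b c g : seq 'I_d -> R) (u v w : seq 'I_d) (p : 'I_d -> R).

Definition ssh a u v : R := \sum_(w <- shuffle u v) a w.

Lemma ssh_nill a v : ssh a [::] v = a v.
Proof. by rewrite /ssh big_seq1. Qed.

Lemma ssh_nilr a u : ssh a u [::] = a u.
Proof. by rewrite /ssh shuffle_nil big_seq1. Qed.

Lemma ssh_cons a i j u v : ssh a (i :: u) (j :: v) =
  ssh (fun w => a (i :: w)) u (j :: v) + ssh (fun w => a (j :: w)) (i :: u) v.
Proof. by rewrite /ssh /= big_cat !big_map. Qed.

(** Deconcatenation is a morphism for the shuffle product: cutting a shuffle of u and v means
    cutting u and v and shuffling the pieces on each side. *)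
Lemma ssh_gmul a g u v : ssh (gmul a g) u v =
  \sum_(k < (size u).+1) \sum_(l < (size v).+1)
    ssh a (take k u) (take l v) * ssh g (drop k u) (drop l v).
Proof.
elim: {u v}(size u + size v)%N {-2}u {-2}v (leqnn (size u + size v)) a => [|m IH] u v.
  by case: u v => [|? ?] [|? ?]//= _ a; rewrite !big_ord1 !ssh_nill gmul_nil.
case: u => [|i u].
  move=> _ a; rewrite big_ord1 ssh_nill /gmul.
  by apply: eq_bigr => l _; rewrite !ssh_nill.
case: v => [|j v].
  move=> _ a; rewrite ssh_nilr /gmul.
  by apply: eq_bigr => l _; rewrite big_ord1 !ssh_nilr.
move=> /= uvm a; rewrite ssh_cons.
have E1 h : ssh (fun w => gmul a g (i :: w)) u h =
    a [::] * ssh (fun w => g (i :: w)) u h + ssh (gmul (fun w => a (i :: w)) g) u h.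
  rewrite /ssh mulr_sumr -big_split; apply: eq_bigr => w _.
  by rewrite gmul_cons.
have E2 h : ssh (fun w => gmul a g (j :: w)) h v =
    a [::] * ssh (fun w => g (j :: w)) h v + ssh (gmul (fun w => a (j :: w)) g) h v.
  rewrite /ssh mulr_sumr -big_split; apply: eq_bigr => w _.
  by rewrite gmul_cons.
rewrite E1 E2 addrACA -mulrDr -ssh_cons !IH /=; [|by lia|by lia].
rewrite [RHS]big_ord_recl [X in _ = X + _]big_ord_recl !ssh_nill -[RHS]addrA.
congr (_ + _).
rewrite [X in _ + X = _]big_ord_recl addrCA; congr (_ + _).
  by apply: eq_bigr => l _; rewrite !ssh_nill.
rewrite -big_split; apply: eq_bigr => k _ /=.
rewrite big_ord_recl [in RHS]big_ord_recl /= !ssh_nilr -addrA; congr (_ + _).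
rewrite -big_split; apply: eq_bigr => l _ /=.
by rewrite ssh_cons mulrDl.
Qed.

(** Avoids showing that the Neumann series of an inverse is group-like. In the shuffle identity for
    a g, all terms in which u or v is actually cut agree by induction on the total length; the one
    left is the identity for g at u and v. *)
Lemma in_G_quotient p a g : (forall i, 0 < p i) -> in_G p a -> g [::] = 1 ->
  in_G p (gmul a g) -> in_G p g.
Proof.
move=> p0 [a1 ash] g1 [_ csh]; split=> // u v.
elim: {u v}(size u + size v)%N {-2}u {-2}v (leqnn (size u + size v)) => [|m IH] u v.
  by case: u v => [|? ?] [|? ?]//= _ _; rewrite big_seq1 g1 mulr1.
move=> uvm uv1.
have tdl w (k : nat) : wlen p (take k w) + wlen p (drop k w) = wlen p w.
  by rewrite -wlen_cat cat_take_drop.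
have := csh u v uv1; rewrite -/(ssh _ _ _) ssh_gmul {1 2}/gmul mulr_suml.
under eq_bigr do rewrite mulr_sumr.
move=> /eqP; rewrite -subr_eq0 -sumrB.
under eq_bigr do rewrite -sumrB.
have T (k : 'I_(size u).+1) (l : 'I_(size v).+1) :
    a (take k u) * g (drop k u) * (a (take l v) * g (drop l v)) -
    ssh a (take k u) (take l v) * ssh g (drop k u) (drop l v) =
    a (take k u) * a (take l v) *
     (g (drop k u) * g (drop l v) - ssh g (drop k u) (drop l v)).
  have -> : ssh a (take k u) (take l v) = a (take k u) * a (take l v).
    rewrite ash//; apply: le_trans uv1.
    rewrite lerD//; [rewrite -(tdl u k)|rewrite -(tdl v l)];
      by rewrite lerDl wlen_ge0.
  by rewrite mulrBr; ring.
under eq_bigr do under eq_bigr do rewrite T.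
have T0 (k : 'I_(size u).+1) (l : 'I_(size v).+1) : (0 < k + l)%N ->
    g (drop k u) * g (drop l v) - ssh g (drop k u) (drop l v) = 0.
  move=> kl; apply/eqP; rewrite subr_eq0; apply/eqP/IH.
    by rewrite !size_drop; have := ltn_ord k; have := ltn_ord l; lia.
  apply: le_trans uv1; rewrite lerD//.
    by rewrite -(tdl u k) lerDr wlen_ge0.
  by rewrite -(tdl v l) lerDr wlen_ge0.
rewrite big_ord_recl [X in X + _]big_ord_recl.
rewrite [X in _ + X + _]big1 => [|l _]; last by rewrite T0 ?mulr0.
rewrite [X in _ + X]big1 => [|k _]; last by rewrite big1// => l _; rewrite T0 ?mulr0.
rewrite /= !take0 !drop0 a1 !mul1r.
by rewrite !addr0 subr_eq0 => /eqP.
Qed.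

Lemma gmulVK a g w : a [::] = 1 -> gmul a (gmul (ginv a) g) w = g w.
Proof.
move=> a1; rewrite gmulA; rewrite -[RHS]gmul1l.
by apply: eq_gmul => // v; rewrite gmulV.
Qed.

Lemma eq_in_G p a b : a =1 b -> in_G p a -> in_G p b.
Proof.
move=> ab [a1 ash]; split=> [|u v uv]; first by rewrite -ab.
by rewrite -!ab ash//; apply: eq_bigr => w _.
Qed.

Lemma ginv_nil a : ginv a [::] = 1.
Proof. by rewrite /ginv big_ord_recl big_ord0 addr0. Qed.

Lemma incr_nil (X : R -> seq 'I_d -> R) s t : X t [::] = 1 -> incr X s t [::] = 1.
Proof. by move=> Xt; rewrite /incr gmul_nil ginv_nil Xt mul1r. Qed.

Lemma incr_in_G p (X : R -> seq 'I_d -> R) s t : (forall i, 0 < p i) ->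
  in_G p (X s) -> in_G p (X t) -> in_G p (incr X s t).
Proof.
move=> p0 Xs Xt; apply: (in_G_quotient p0 Xs); first by apply: incr_nil; case: Xt.
by apply: eq_in_G Xt => w; rewrite /incr gmulVK//; case: Xs.
Qed.

Lemma incr_chen (X : R -> seq 'I_d -> R) (s u t : R) w : X u [::] = 1 ->
  incr X s t w = gmul (incr X s u) (incr X u t) w.
Proof.
move=> Xu; rewrite /incr -gmulA; apply: eq_gmul => // v.
by rewrite gmulVK.
Qed.

Lemma incrxx (X : R -> seq 'I_d -> R) s w : X s [::] = 1 -> incr X s s w = gone w.
Proof. exact: gmulVl. Qed.

Lemma gmul_scale (m : 'I_d -> R) a b w :
  gmul (fun v => (\prod_(i <- v) m i) * a v) (fun v => (\prod_(i <- v) m i) * b v) w =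
  (\prod_(i <- w) m i) * gmul a b w.
Proof.
rewrite /gmul mulr_sumr; apply: eq_bigr => k _.
have -> : \prod_(i <- w) m i = \prod_(i <- take k w) m i * \prod_(i <- drop k w) m i.
  by rewrite -big_cat cat_take_drop.
by ring.
Qed.

(** Scaling by a multiplicative weight is a morphism for the product, so the scaled inverse is a
    right inverse of the scaled element, and inverses are unique. *)
Lemma ginv_scale (m : 'I_d -> R) a w : a [::] = 1 ->
  ginv (fun v => (\prod_(i <- v) m i) * a v) w = (\prod_(i <- w) m i) * ginv a w.
Proof.
move=> a1; set P := fun v => \prod_(i <- v) m i; set b := fun v => P v * a v.
have b1 : b [::] = 1 by rewrite /b /P big_nil mul1r.
rewrite -[LHS]gmul1r.
transitivity (gmul (ginv b) (gmul b (fun v => P v * ginv a v)) w).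
  apply: eq_gmul => // v; rewrite gmul_scale gmulV// /gone /P.
  by case: v => [|i v]; rewrite ?big_nil ?mul1r// mulr0.
rewrite gmulA -[RHS](gmul1l (fun v => P v * ginv a v)); apply: eq_gmul => // v.
by rewrite gmulVl.
Qed.

Lemma incr_rescale n gamma (f : 'I_d -> 'rV[R]_n -> 'rV[R]_n)
    (X : R -> seq 'I_d -> R) s t w : X s [::] = 1 ->
  incr (rescale gamma f X) s t w =
  (\prod_(i <- w) Lip_norm (gamma i) (f i)) * incr X s t w.
Proof.
move=> Xs; rewrite /incr -gmul_scale; apply: eq_gmul => // v.
exact: ginv_scale.
Qed.

End GroupLike.

Section Davie.
Context {R : realType} {n : nat}.
Variables (N : nat) (J : nat -> nat -> 'rV[R]_n) (om : nat -> nat -> R).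
Variables (th K : R).
Hypothesis th1 : 1 < th.
Hypothesis K0 : 0 <= K.
Hypothesis om0 : forall a b, (a <= b <= N)%N -> 0 <= om a b.
Hypothesis omD : forall a b c, (a <= b)%N -> (b <= c <= N)%N ->
  om a b + om b c <= om a c.
Hypothesis J0 : forall a, J a a = 0.
Let E a b := \sum_(a <= k < b) enorm (J k k.+1).
Hypothesis JE : forall a b, (a <= b <= N)%N -> 2 * E a b <= om a b.
Hypothesis Jdef : forall a b c, (a <= b)%N -> (b <= c <= N)%N ->
  enorm (J a b) <= om a b -> enorm (J a c - J a b - J b c) <= K * om a c `^ th.
Variables A de : R.
Hypothesis A0 : 0 <= A.
Hypothesis AK : A * (1 - 2 `^ (1 - th)) = 2 * K.
Hypothesis omde : om 0 N <= de.
Hypothesis Ade : A * de `^ (th - 1) <= 2^-1.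

Let omM a b c e : (c <= a)%N -> (a <= b)%N -> (b <= e <= N)%N -> om a b <= om c e.
Proof.
move=> ca ab /andP[be eN]; apply: (@le_trans _ _ (om c b)).
  apply: le_trans (omD ca _); last by rewrite ab (leq_trans be).
  by rewrite lerDr om0// ca (leq_trans ab)// (leq_trans be).
apply: le_trans (omD (leq_trans ca ab) _); last by rewrite be.
by rewrite lerDl om0// be.
Qed.

Let rhs_ge0 a b : 0 <= A * om a b `^ th + E a b.
Proof.
rewrite addr_ge0 ?(mulr_ge0 A0) ?powR_ge0//.
by apply: sumr_ge0 => k _; exact: enorm_ge0.
Qed.

(* [a, b] is split at the last k with om a k <= om a b / 2, so that om k.+1 b is at
   most om a b / 2 as well. *)
Lemma davie a b : (a <= b <= N)%N ->
  enorm (J a b) <= A * om a b `^ th + E a b.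
Proof.
elim: {b}(b - a)%N {-2}a {-2}b (leqnn (b - a)) => [|m IH] {}a b.
  rewrite leqn0 subn_eq0 => ba /andP[ab bN].
  have -> : a = b by apply/eqP; rewrite eqn_leq ab.
  by rewrite J0 enorm0.
move=> bam /andP[ab bN].
have [ab2|ab2] := leqP b a.+1.
  have [->|ba] : a = b \/ b = a.+1 by lia.
    by rewrite J0 enorm0.
  by rewrite ba /E big_nat1 lerDr mulr_ge0 ?powR_ge0.
(* The a priori bound demanded by [Jdef]: in the induction hypothesis A om^th <= om/2 by the choice
   of de, and the sum of the steps is at most om/2 by [JE]. *)
have small k l : (a <= k)%N -> (k <= l)%N -> (l <= b)%N -> (l - k <= m)%N ->
    enorm (J k l) <= om k l.
  move=> ak kl lb lkm.
  have klN : (k <= l <= N)%N by rewrite kl (leq_trans lb).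
  apply: le_trans (IH k l lkm klN) _.
  have o0 := om0 klN.
  rewrite [leRHS](_ : _ = 2^-1 * om k l + 2^-1 * om k l); last by lra.
  apply: lerD; last by rewrite ler_pdivlMl// JE.
  have [e0|n0] := eqVneq (om k l) 0.
    by rewrite e0 powR0 ?mulr0// gt_eqF// (lt_trans _ th1).
  rewrite -(@mulr_powRB1 _ (om k l) th)// ?(lt_trans _ th1)// mulrCA mulrC.
  rewrite ler_wpM2r//; apply: le_trans Ade; rewrite ler_wpM2l//.
  have dd : om k l <= de by apply: le_trans omde; apply: omM => //; rewrite (leq_trans lb bN) leqnn.
  by rewrite ge0_ler_powR ?nnegrE ?subr_ge0 ?(ltW th1)// (le_trans o0).
pose P k := (a <= k < b)%N && (om a k <= om a b / 2).
have abN : (a <= b <= N)%N by rewrite ab.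
have oab := om0 abN.
have Pa : P a.
  rewrite /P leqnn (ltn_trans _ ab2)//=.
  have := @omD a a a (leqnn _); rewrite leqnn (leq_trans ab bN) => /(_ isT) oaa.
  apply: (@le_trans _ _ 0); first by lra.
  by rewrite divr_ge0.
have Pb k : P k -> (k <= b)%N by move=> /andP[/andP[_ /ltnW]].
pose k := ex_maxn (ex_intro _ a Pa) Pb.
have [Pk kmax] : P k /\ forall j, P j -> (j <= k)%N by rewrite /k; case: ex_maxnP.
have /andP[/andP[ak kb] oak] := Pk.
have okb : om k.+1 b <= om a b / 2.
  have [kb'|kb'] := ltnP k.+1 b.
    have : ~~ P k.+1 by apply/negP => /kmax; rewrite ltnn.
    rewrite /P (leqW ak) kb' /= -ltNge => ok1.
    have := @omD a k.+1 b (leqW ak); rewrite kb bN => /(_ isT); lra.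
  have -> : k.+1 = b by lia.
  have := @omD b b b (leqnn _); rewrite leqnn bN => /(_ isT) oaa.
  by apply: (@le_trans _ _ 0); [lra|rewrite divr_ge0].
have akm : (k - a <= m)%N by clear -bam kb ak; lia.
have kbm : (b - k.+1 <= m)%N by clear -bam kb ak; lia.
have kbm' : (k.+1 - k <= m)%N by clear -bam ab2; lia.
have akN : (a <= k <= N)%N by rewrite ak (leq_trans (ltnW kb)).
have kbN : (k.+1 <= b <= N)%N by rewrite kb bN.
have d1 := @Jdef a k b ak _ (small a k (leqnn _) ak (ltnW kb) akm).
have d2 : enorm (J k b - J k k.+1 - J k.+1 b) <= K * om k b `^ th.
  by apply: Jdef; rewrite ?leqnSn//; apply: small.
have i1 := IH a k akm akN; have i2 := IH k.+1 b kbm kbN.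
have half x : 0 <= x -> x <= om a b / 2 -> A * x `^ th <= A * 2 `^ (- th) * om a b `^ th.
  move=> x0 xo; rewrite -mulrA ler_wpM2l//.
  apply: (@le_trans _ _ ((om a b / 2) `^ th)).
    by rewrite ge0_ler_powR ?nnegrE ?divr_ge0// (le_trans _ (ltW th1)).
  rewrite powRM ?invr_ge0// mulrC -(@powR_inv1 _ 2)// -powRrM mulN1r.
  by [].
have o1 := half _ (om0 akN) oak; have o2 := half _ (om0 kbN) okb.
have Jd : J a b = (J a b - J a k - J k b) + (J k b - J k k.+1 - J k.+1 b)
    + J a k + J k k.+1 + J k.+1 b.
  set x1 := J a b; set x2 := J a k; set x3 := J k b; set x4 := J k k.+1.
  set x5 := J k.+1 b; apply/rowP => e; rewrite !mxE; ring.
have kbo : K * om k b `^ th <= K * om a b `^ th.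
  rewrite ler_wpM2l// ge0_ler_powR ?nnegrE ?(le_trans _ (ltW th1))//.
    by apply: om0; rewrite (ltnW kb).
  by apply: omM; rewrite // ?(ltnW kb)// leqnn bN.
have EE : E a b = E a k + enorm (J k k.+1) + E k.+1 b.
  rewrite /E (@big_cat_nat _ _ _ k)//= ?(ltnW kb)// [X in _ + X = _]big_ltn//.
  by rewrite addrA.
(* Each half costs A (om/2)^th and each of the two defects K om^th; A is the fixed point of this
   recursion. *)
have AE : A = 2 * (A * 2 `^ (- th)) + 2 * K.
  have t2 : 2 * 2 `^ (- th) = 2 `^ (1 - th) :> R.
    rewrite powRD; last by rewrite pnatr_eq0 implybT.
    by rewrite powRr1.
  by rewrite mulrCA t2 -AK; ring.
have := d1; rewrite (ltnW kb) bN => /(_ isT) {}d1.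
have JJ : enorm (J a b) <= enorm (J a b - J a k - J k b) +
    enorm (J k b - J k k.+1 - J k.+1 b) + enorm (J a k) + enorm (J k k.+1) +
    enorm (J k.+1 b).
  by rewrite {1}Jd; do 4 !(apply: le_trans (ler_enormD _ _) _; apply: lerD => //).
apply: le_trans JJ _.
rewrite EE {1}AE mulrDl.
move: d1 d2 i1 i2 o1 o2 kbo.
set x1 := enorm (J a b - _ - _); set x2 := enorm (J k b - _ - _).
set x3 := enorm (J a k); set x4 := enorm (J k k.+1); set x5 := enorm (J k.+1 b).
set z := om a b `^ th; set z1 := A * _; set z2 := A * om k.+1 b `^ th.
by rewrite -[2 * _ * z]mulrA -[2 * K * z]mulrA; lra.
Qed.

End Davie.

(** * Variations and the local estimate *)

Section Exponents.
Context {R : realType} {d : nat}.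
Variable p : 'I_d -> R.
Hypothesis d_gt0 : (0 < d)%N.
Hypothesis p_ge1 : forall i, 1 <= p i.
Implicit Types w v : seq 'I_d.

Lemma p_gt0 i : 0 < p i. Proof. exact: lt_le_trans (p_ge1 i). Qed.

Lemma le_pmax i : p i <= pmax p. Proof. exact: le_bigmax. Qed.

Lemma pmax_attained : exists i, pmax p = p i.
Proof.
pose i0 := Ordinal d_gt0.
have [p0|//] : pmax p = 0 \/ exists i, pmax p = p i.
  rewrite /pmax; elim/big_ind : _ => [|x y [->|[i ->]] [->|[j ->]]|i _].
  - by left.
  - by left; rewrite maxxx.
  - by right; exists j; rewrite max_r ?(ltW (p_gt0 j)).
  - by right; exists i; rewrite max_l ?(ltW (p_gt0 i)).
  - by right; case: (leP (p i) (p j)) => _; [exists j|exists i].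
  - by right; exists i.
by have := le_pmax i0; rewrite p0 leNgt p_gt0.
Qed.

Lemma pmax_ge1 : 1 <= pmax p.
Proof. by have [i ->] := pmax_attained; exact: p_ge1. Qed.

Lemma pmax_gt0 : 0 < pmax p. Proof. exact: lt_le_trans pmax_ge1. Qed.

(** The least integer N with 1/p_i + N/p_max > 1. It is at most p_max (1 - 1/p_i) + 1, hence below
    gamma_i. *)
Definition jet_order i := (Num.truncn (pmax p * (1 - (p i)^-1))).+1.

Lemma excess_ge0 i : 0 <= pmax p * (1 - (p i)^-1).
Proof. by rewrite mulr_ge0 ?(ltW pmax_gt0)// subr_ge0 invf_le1 ?p_gt0. Qed.

Lemma theta_gt1 : 1 < theta p.
Proof. by have [[w w1 <-] _] := theta_min d_gt0 p_gt0. Qed.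

Lemma theta_le w : 1 < wlen p w -> theta p <= wlen p w.
Proof. by have [_] := theta_min d_gt0 p_gt0; exact. Qed.

(** No length lies strictly between 1 and theta, so the strict truncation at theta used in the
    expansions selects the words of the theorem. *)
Lemma wlen_lt_theta w : (wlen p w < theta p) = (wlen p w <= 1).
Proof.
apply/idP/idP => [|w1]; last exact: le_lt_trans theta_gt1.
by apply: contraTT; rewrite -ltNge -leNgt; exact: theta_le.
Qed.

(** The right-hand side is the length of the letter i followed by [jet_order i] copies of a lightest
    letter; it exceeds 1 by the choice of the order. *)
Lemma theta_le_jet i : theta p <= (p i)^-1 + (jet_order i)%:R / pmax p.
Proof.
have [i0 pi0] := pmax_attained.
have -> : (p i)^-1 + (jet_order i)%:R / pmax p = wlen p (i :: nseq (jet_order i) i0).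
  rewrite wlen_cons; congr (_ + _); rewrite /wlen big_nseq pi0.
  by elim: (jet_order i) => [|m IH]; rewrite ?mul0r//= -IH -addn1 natrD mulrDl addrC mul1r.
apply: theta_le; rewrite wlen_cons.
have -> : wlen p (nseq (jet_order i) i0) = (jet_order i)%:R / pmax p.
  rewrite /wlen big_nseq pi0.
  by elim: (jet_order i) => [|m IH]; rewrite ?mul0r//= IH -addn1 natrD mulrDl addrC mul1r.
have : 1 - (p i)^-1 < (jet_order i)%:R / pmax p.
  by rewrite ltr_pdivlMr ?pmax_gt0// mulrC truncnS_gt.
by rewrite ltrBlDl.
Qed.

(** For a letter with p_i = p_max the jet order is at most p_max, so theta <= 1/p_max + 1. This
    keeps the exponent c of [Diter_rem] at most 1, as [h_rem] requires. *)
Lemma theta_subr_le1 : theta p - (pmax p)^-1 <= 1.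
Proof.
have [i0 pi0] := pmax_attained.
have := theta_le_jet i0; rewrite -pi0.
have : (jet_order i0)%:R / pmax p <= 1.
  rewrite ler_pdivrMr ?pmax_gt0// mul1r /jet_order -natr1.
  have /andP[+ _] := truncn_itv (excess_ge0 i0).
  have E : pmax p * (p i0)^-1 = 1 by rewrite pi0 divff// gt_eqF// p_gt0.
  by rewrite mulrBr mulr1 E; lra.
by lra.
Qed.

Lemma jet_order_le gamma i : pmax p * (1 - (p i)^-1) + 1 < gamma ->
  (jet_order i <= lip_order gamma)%N.
Proof.
move=> g; have h : (jet_order i)%:R < gamma.
  apply: le_lt_trans g; rewrite /jet_order -natr1 lerD2r.
  by have /andP[] := truncn_itv (excess_ge0 i).
have c : (jet_order i)%:Z < Num.ceil gamma.
  by rewrite -(ltr_int R); apply: lt_le_trans h _; exact: ceil_ge.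
rewrite /lip_order; case: (Num.ceil gamma) c => [m|m] //=.
by rewrite ltz_nat; case: m.
Qed.

Lemma gamma_gt0 gamma i : pmax p * (1 - (p i)^-1) + 1 < gamma -> 0 < gamma.
Proof. by apply: lt_trans; rewrite ltr_wpDl// excess_ge0. Qed.

Lemma wlen_gt0 w : (0 < wlen p w) = (w != [::]).
Proof.
case: w => [|i w]; first by rewrite wlen_nil ltxx.
by rewrite wlen_cons ltr_wpDr ?invr_gt0 ?p_gt0// wlen_ge0// => j; exact: p_gt0.
Qed.

Lemma short_words : exists Ws : seq (seq 'I_d),
  [/\ uniq Ws, forall v, (v \in Ws) = (wlen p v <= 1) &
      words p = [set` [seq v <- Ws | v != [::]]]].
Proof.
have := finite_wlen_le 1 p_gt0; rewrite finite_seqP => -[s sE].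
have sP v : (v \in undup s) = (wlen p v <= 1).
  rewrite mem_undup; apply/idP/idP => vs.
    by have : [set` s] v by []; rewrite -sE.
  by have : [set w | wlen p w <= 1] v by []; rewrite sE.
exists (undup s); split=> //; first exact: undup_uniq.
apply/seteqP; split=> v /=; rewrite mem_filter sP -wlen_gt0 //.
Qed.

End Exponents.

Section Pvar.
Context {R : realType}.
Implicit Types (s t u v q : R) (P : seq R) (A F : R -> R -> R).

Fixpoint psum F s P : R := if P is x :: P' then F s x + psum F x P' else 0.

Lemma psumE F s t P : \sum_(0 <= k < size P)
  F (nth t (s :: P) k) (nth t (s :: P) k.+1) = psum F s P.
Proof.
elim: P s => [|x P IH] s; first by rewrite big_nil.
by rewrite big_nat_recl//= -(IH x).
Qed.

Lemma psum_cat F s P Q : psum F s (P ++ Q) = psum F s P + psum F (last s P) Q.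
Proof. by elim: P s => [|x P IH] s /=; rewrite ?add0r// IH addrA. Qed.

Lemma psum_ge0 F s P : (forall u v, 0 <= F u v) -> 0 <= psum F s P.
Proof. by move=> F0; elim: P s => //= x P IH s; rewrite addr_ge0. Qed.

(* Partitions are strictly increasing, so that of a degenerate interval is empty. *)
Definition tpart s t := if s == t then [::] else [:: t].

Lemma tpartP s t : s <= t -> itv_partition s t (tpart s t).
Proof.
rewrite le_eqVlt /tpart; case: eqP => [->|] //= _ st.
by rewrite /itv_partition /= st eqxx.
Qed.

Local Notation Fq q A := (fun u v => `|A u v| `^ q).

Lemma pvarE q A s t : pvar q A s t =
  ereal_sup [set (psum (Fq q A) s P)%:E | P in [set P | itv_partition s t P]].
Proof.
rewrite /pvar; congr ereal_sup; apply: eq_imagel => P _.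
by rewrite -(psumE (Fq q A) s t).
Qed.

Lemma pvar_le q A s t (c : R) :
  (forall P, itv_partition s t P -> psum (Fq q A) s P <= c) ->
  (pvar q A s t <= c%:E)%E.
Proof.
by move=> Pc; rewrite pvarE; apply: ge_ereal_sup => _ [P /= Pp <-]; rewrite lee_fin Pc.
Qed.

Lemma le_pvar q A s t P : itv_partition s t P ->
  ((psum (Fq q A) s P)%:E <= pvar q A s t)%E.
Proof. by move=> Pp; rewrite pvarE; apply: ereal_sup_ubound; exists P. Qed.

Lemma pvar_ge0 q A s t : s <= t -> (0 <= pvar q A s t)%E.
Proof.
move=> st; apply: le_trans (le_pvar q A (tpartP st)).
by rewrite lee_fin psum_ge0// => u v; exact: powR_ge0.
Qed.

Lemma pvar_mono q A s u v t : s <= u -> u <= v -> v <= t ->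
  (pvar q A u v <= pvar q A s t)%E.
Proof.
move=> su uv vt; rewrite pvarE; apply: ge_ereal_sup => _ [P /= Pp <-].
have su' := tpartP su; have vt' := tpartP vt.
have sv := itv_partition_cat su' Pp.
apply: le_trans (le_pvar q A (itv_partition_cat sv vt')).
rewrite lee_fin !psum_cat.
have -> : last s (tpart s u) = u by rewrite /tpart; case: eqP => //=.
by rewrite -addrA addrC -addrA lerDl addr_ge0// psum_ge0.
Qed.

(* Meaningful only when the variation is finite, since fine +oo = 0. *)
Definition vr q A s t : R := fine (pvar q A s t).

Lemma vrE q A s t : s <= t -> (pvar q A s t < +oo)%E ->
  pvar q A s t = (vr q A s t)%:E.
Proof. by move=> st fin; rewrite /vr fineK// ge0_fin_numE// pvar_ge0. Qed.

Lemma vr_ge0 q A s t : s <= t -> 0 <= vr q A s t.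
Proof. by move=> st; rewrite fine_ge0// pvar_ge0. Qed.

Lemma le_vr q A s t P : s <= t -> (pvar q A s t < +oo)%E ->
  itv_partition s t P -> psum (Fq q A) s P <= vr q A s t.
Proof. by move=> st fin Pp; rewrite -lee_fin -vrE// le_pvar. Qed.

Lemma vr_le q A s t (c : R) : s <= t -> (pvar q A s t < +oo)%E ->
  (forall P, itv_partition s t P -> psum (Fq q A) s P <= c) -> vr q A s t <= c.
Proof. by move=> st fin Pc; rewrite -lee_fin -vrE// pvar_le. Qed.

Lemma vrD q A s u t : s <= u -> u <= t -> (pvar q A s t < +oo)%E ->
  vr q A s u + vr q A u t <= vr q A s t.
Proof.
move=> su ut fin; have st := le_trans su ut.
have fsu : (pvar q A s u < +oo)%E by apply: le_lt_trans fin; exact: pvar_mono.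
have fut : (pvar q A u t < +oo)%E by apply: le_lt_trans fin; exact: pvar_mono.
rewrite -lerBrDr; apply: vr_le => // P Pp; rewrite lerBrDr addrC -lerBrDr.
apply: vr_le => // Q Qp; rewrite lerBrDr addrC.
apply: le_trans (le_vr st fin (itv_partition_cat Pp Qp)).
by rewrite psum_cat; have [_ /eqP ->] := Pp.
Qed.

Lemma norm_le_vr q A s t : 0 < q -> s < t -> (pvar q A s t < +oo)%E ->
  `|A s t| <= vr q A s t `^ q^-1.
Proof.
move=> q0 st fin; have := le_vr (ltW st) fin (tpartP (ltW st)).
rewrite /tpart lt_eqF//= addr0 => h.
have := @ge0_ler_powR R q^-1; rewrite invr_ge0 (ltW q0) => /(_ isT) mono.
have := mono _ _ _ _ h; rewrite !nnegrE powR_ge0 vr_ge0 ?(ltW st)// => /(_ isT isT).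
by rewrite -powRrM divff ?gt_eqF// powRr1.
Qed.

End Pvar.

Section Reindex.
Context {R : realType} {d : nat}.
Implicit Types (v w : seq 'I_d).

(** The pairing of a product with F, regrouped by the right factor w of each cut: the inner sum is
    then the expansion of F^w that [Fw_rem] compares with its value at the new point. *)
Lemma big_gmul (E : lmodType R) (p : 'I_d -> R) (Ws : seq (seq 'I_d)) (th : R)
    (a b : seq 'I_d -> R) (F : seq 'I_d -> E) :
  (forall i, 0 < p i) -> uniq Ws -> (forall v, (v \in Ws) = (wlen p v < th)) ->
  \sum_(w <- Ws) gmul a b w *: F w =
  \sum_(w <- Ws) b w *: \sum_(v <- Ws | wlen p v < th - wlen p w) a v *: F (v ++ w).
Proof.
move=> p0 uW WP.
pose P q := wlen p q.1 + wlen p q.2 < th.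
pose W2 := [seq (v, w) | v <- Ws, w <- Ws].
have uW2 : uniq W2 by apply: allpairs_uniq => // -[? ?] [? ?] _ _ /=.
pose dec w := [seq (take k w, drop k w) | k <- iota 0 (size w).+1].
have decP w q : q \in dec w -> q.1 ++ q.2 = w.
  by move=> /mapP[k _ ->] /=; rewrite cat_take_drop.
have count_dec w q : count_mem q (dec w) = (q.1 ++ q.2 == w).
  case: eqP => [qw|qw]; last first.
    by apply/count_memPn/negP => /decP.
  have ud : uniq (dec w).
    rewrite map_inj_in_uniq ?iota_uniq// => k l; rewrite !mem_iota/= !add0n !ltnS => kw lw.
    by case=> /(congr1 size) + _; rewrite !size_takel.
  rewrite count_uniq_mem//; apply/eqP; rewrite eqb1; apply/mapP.
  exists (size q.1); first by rewrite mem_iota/= add0n ltnS -qw size_cat leq_addr.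
  by rewrite -qw take_size_cat// drop_size_cat//; case: (q).
transitivity (\sum_(w <- Ws) \sum_(q <- W2 | P q)
    ((a q.1 * b q.2) *: F (q.1 ++ q.2)) *+ count_mem q (dec w)).
  rewrite big_seq [RHS]big_seq; apply: eq_bigr => w wW.
  rewrite -(big_count (P := P) _ uW2) => [|q qw]; last first.
    have qE := decP _ _ qw.
    have Pq : P q by rewrite /P -wlen_cat qE -WP.
    rewrite Pq andbT; case: q {qw qE} Pq => u v; rewrite /P /= => Pq.
    apply: allpairs_f; rewrite WP; apply: le_lt_trans Pq.
      by rewrite lerDl wlen_ge0.
    by rewrite lerDr wlen_ge0.
  rewrite /gmul scaler_suml big_map -(big_mkord xpredT (fun k => (a (take k w) * b (drop k w)) *: F w)).
  rewrite /index_iota subn0; apply: eq_bigr => k _ /=.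
  by rewrite cat_take_drop.
rewrite exchange_big.
transitivity (\sum_(q <- W2 | P q) (a q.1 * b q.2) *: F (q.1 ++ q.2)).
  apply: eq_bigr => q Pq; under eq_bigr do rewrite count_dec.
  have qW : q.1 ++ q.2 \in Ws by rewrite WP wlen_cat.
  rewrite (bigD1_seq _ qW uW)/= eqxx mulr1n big1 ?addr0// => w.
  by rewrite eq_sym => /negbTE ->; rewrite mulr0n.
rewrite big_mkcond big_allpairs exchange_big; apply: eq_bigr => w _.
rewrite scaler_sumr [RHS]big_mkcond; apply: eq_bigr => v _ /=.
by rewrite /P/= ltrBrDr; case: ifP => //; rewrite scalerA mulrC.
Qed.

End Reindex.

(** For b > 0 the choice e = min(b/2, b^th) gives (b + 2e)^th <= 2^th b^th and e <= b^th, without a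
    passage to the limit; for b = 0 the right-hand side is made arbitrarily small. *)
Lemma powR_limit (R : realType) (th A de a b : R) : 1 < th -> 0 <= A ->
  0 < de -> de <= 1 -> 0 <= b -> b <= de / 2 ->
  (forall e, 0 < e -> b + 2 * e <= de -> a <= A * (b + 2 * e) `^ th + e) ->
  a <= (A * 2 `^ th + 1) * b `^ th.
Proof.
move=> th1 A0 de0 de1 b0 bd step.
have th0 : 0 < th by exact: lt_trans th1.
have [z0|n0] := eqVneq (b) 0.
  rewrite z0 powR0 ?gt_eqF// mulr0.
  apply/ler_addgt0Pr => e e0; rewrite add0r.
  pose e1 := Num.min (de / 2) (e / (2 * A + 1)).
  have A1 : 0 < 2 * A + 1 by rewrite ltr_wpDl ?mulr_ge0.
  have e10 : 0 < e1 by rewrite lt_min !divr_gt0.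
  have e1d : 2 * e1 <= de by rewrite -ler_pdivlMl// mulrC ge_min lexx.
  have := step e1 e10; rewrite z0 add0r => /(_ e1d)/le_trans; apply.
  apply: (@le_trans _ _ (A * (2 * e1) + e1)).
    rewrite lerD2r ler_wpM2l//.
    rewrite -[leRHS]powRr1 ?mulr_ge0 ?(ltW e10)// powR_le1 ?(ltW th1)//.
    by rewrite mulr_ge0 ?(ltW e10)//= (le_trans e1d).
  rewrite (_ : _ + _ = (2 * A + 1) * e1); last by ring.
  by rewrite -ler_pdivlMl// mulrC ge_min lexx orbT.
have op : 0 < b by rewrite lt_neqAle eq_sym n0.
pose e := Num.min (b / 2) (b `^ th).
have e0 : 0 < e by rewrite lt_min divr_gt0//= powR_gt0.
have e2 : 2 * e <= b by rewrite -ler_pdivlMl// mulrC ge_min lexx.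
have ode : b + 2 * e <= de.
  by move: bd; rewrite ler_pdivlMr//; lra.
apply: le_trans (step e e0 ode) _.
rewrite [leRHS]mulrDl mul1r lerD//; last by rewrite ge_min lexx orbT.
rewrite -mulrA ler_wpM2l// -powRM//.
by rewrite ge0_ler_powR ?nnegrE ?(ltW th0) ?addr_ge0 ?mulr_ge0 ?(ltW e0)//; lra.
Qed.

Section Local.
Context {R : realType} {d : nat}.
Variable p : 'I_d -> R.
Hypothesis d_gt0 : (0 < d)%N.
Hypothesis p_ge1 : forall i, 1 <= p i.
Implicit Types w : seq 'I_d.
Local Notation th := (theta p).

Definition remainder n (f : 'I_d -> 'rV[R]_n -> 'rV[R]_n)
    (Z : R -> R -> seq 'I_d -> R) (y : R -> 'rV[R]_n) (u v : R) : 'rV[R]_n :=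
  y v - y u - \sum_(w \in words p) Z u v w *: Fw f w (y u).

(** Covers both the increments of the rough path and the signatures of its approximations, so that
    the local estimate serves in both passes. *)
Record is_increment (Z : R -> R -> seq 'I_d -> R) (s t : R) : Prop := {
  increment_G : forall u v, s <= u -> u <= v -> v <= t -> in_G p (Z u v);
  increment_chen : forall u v x, s <= u -> u <= v -> v <= x -> x <= t ->
    forall w, wlen p w <= 1 -> Z u x w = gmul (Z u v) (Z v x) w;
  increment_id : forall u w, s <= u -> u <= t -> Z u u w = gone w }.

Record is_control (om : R -> R -> R) (s t : R) : Prop := {
  control_ge0 : forall u v, s <= u -> u <= v -> v <= t -> 0 <= om u v;
  controlD : forall u v x, s <= u -> u <= v -> v <= x -> x <= t ->
    om u v + om v x <= om u x }.

Lemma nth_partition_le s t (P : seq R) (a b : nat) : itv_partition s t P ->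
  (a <= b)%N -> (b <= size P)%N -> nth t (s :: P) a <= nth t (s :: P) b.
Proof.
move=> [Pp _] ab bP.
have : sorted <=%R (s :: P) by apply: (sub_path _ Pp) => ? ? /ltW.
move/(sorted_leq_nth le_trans lexx); apply => //; rewrite inE /= ltnS//.
exact: leq_trans bP.
Qed.

Lemma nth_partition_bounds s t (P : seq R) (a : nat) : itv_partition s t P ->
  (a <= size P)%N -> s <= nth t (s :: P) a /\ nth t (s :: P) a <= t.
Proof.
move=> Pp aP; split; first by have := nth_partition_le Pp (leq0n a) aP.
by have := nth_partition_le Pp aP (leqnn _); rewrite (itv_partition_nth_size _ Pp).
Qed.

(** The sewing lemma on the points of P. The two constants are fixed before n, f, Z and y, hence
    depend on p and d only; e stays in the bound because nothing makes it small yet. *)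
Lemma remainder_le_partition : exists2 Ad : R * R, 0 <= Ad.1 /\ 0 < Ad.2 <= 1 &
  forall n (f : 'I_d -> 'rV[R]_n -> 'rV[R]_n) (M : 'I_d -> R) Z om y s t,
  (forall i, jet_bound (jet_order p i) (M i) (f i)) -> (forall i, 0 <= M i) ->
  s <= t -> is_increment Z s t -> is_control om s t ->
  (forall u v w, s <= u -> u <= v -> v <= t -> wlen p w <= 1 -> w != [::] ->
     `|Z u v w| * Mw M w <= om u v `^ wlen p w) ->
  forall P, itv_partition s t P ->
  let e := psum (fun u v => enorm (remainder f Z y u v)) s P in
  om s t + 2 * e <= Ad.2 ->
  enorm (remainder f Z y s t) <= Ad.1 * (om s t + 2 * e) `^ th + e.
Proof.
have [Ws [uW WP0 wordsE]] := short_words p_ge1.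
have WP v : (v \in Ws) = (wlen p v < th) by rewrite WP0 (wlen_lt_theta d_gt0 p_ge1).
pose Lm := (\max_(v <- Ws) size v)%N.
have WL v : v \in Ws -> (size v <= Lm)%N.
  by move=> vW; rewrite /Lm; apply: (@leq_bigmax_seq _ _ xpredT size v).
pose Nm := (\max_(i < d) jet_order p i)%N.
have NN i : (jet_order p i <= Nm)%N by exact: (leq_bigmax (F := jet_order p) i).
have th1 := theta_gt1 d_gt0 p_ge1.
have th0 : 0 < th by exact: lt_trans th1.
pose K := (size Ws)%:R * krem Ws Lm Nm Lm : R.
have kr0 : 0 <= krem Ws Lm Nm Lm :> R by exact: krem_ge0.
have K0 : 0 <= K by rewrite mulr_ge0.
have q0 : 0 < 1 - 2 `^ (1 - th) :> R.
  rewrite subr_gt0 -[X in _ < X](powRr0 2).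
  have -> : 2 `^ (1 - th) = (2 `^ (th - 1))^-1 :> R by rewrite -powRN opprB.
  rewrite powRr0 invf_lt1 ?powR_gt0//.
  have := @gt0_ltr_powR R (th - 1); rewrite subr_gt0 => /(_ th1) h.
  by have := h 1 2; rewrite powR1 !nnegrE; apply; rewrite ?ler01 ?ler0n ?ltr1n.
pose A := 2 * K / (1 - 2 `^ (1 - th)).
have A0 : 0 <= A by rewrite divr_ge0 ?mulr_ge0// ltW.
have AK : A * (1 - 2 `^ (1 - th)) = 2 * K by rewrite divfK// gt_eqF.
have th10 : 0 < th - 1 by rewrite subr_gt0.
(* Chosen so that A z^(th-1) = A / (2 (A + 1)) <= 1/2; the minimum with 1 in [de] keeps the control
   at most 1, as the expansions require. *)
pose z := (2 * (A + 1))^-1 `^ (th - 1)^-1.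
have z0 : 0 < z by rewrite powR_gt0// invr_gt0 mulr_gt0// ltr_wpDl.
pose de := Num.min 1 z.
have de0 : 0 < de by rewrite lt_min ltr01.
have Ade : A * de `^ (th - 1) <= 2^-1.
  apply: (@le_trans _ _ (A * z `^ (th - 1))).
    rewrite ler_wpM2l// ge0_ler_powR ?nnegrE ?(ltW th10) ?(ltW de0) ?(ltW z0)//.
    by rewrite ge_min lexx orbT.
  rewrite /z -powRrM mulVf ?gt_eqF// powRr1 ?invr_ge0 ?mulr_ge0 ?addr_ge0//.
  rewrite invfM mulrCA -[leRHS]mulr1 ler_wpM2l// ler_pdivrMr ?ltr_wpDl// mul1r.
  by rewrite lerDl.
exists (A, de); first by rewrite A0 de0 ge_min lexx.
move=> n f M Z om y s t fJ M0 st ZI omC Zom P Pp e ed.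
pose tk := nth t (s :: P).
have tkb a : (a <= size P)%N -> s <= tk a /\ tk a <= t by exact: nth_partition_bounds.
have tkm a b : (a <= b)%N -> (b <= size P)%N -> tk a <= tk b by exact: nth_partition_le.
pose J a b := remainder f Z y (tk a) (tk b).
pose E a b := \sum_(a <= k < b) enorm (J k k.+1).
have E0 a b : 0 <= E a b by apply: sumr_ge0 => k _; exact: enorm_ge0.
(* [E] is additive, so this is still a control, and it dominates 2 [E] by construction. *)
pose om' a b := om (tk a) (tk b) + 2 * E a b.
have nW : [::] \in Ws by rewrite WP wlen_nil.
have JWs u v : s <= u -> u <= v -> v <= t ->
    remainder f Z y u v = y v - \sum_(w <- Ws) Z u v w *: Fw f w (y u).
  move=> su uv vt; have [Z1 _] := increment_G ZI su uv vt.
  rewrite (bigD1_seq [::])//= Z1 scale1r opprD addrA /remainder; congr (_ - _).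
  by rewrite wordsE -fsbig_seq ?filter_uniq// big_filter.
have eE : e = E 0 (size P).
  by rewrite /e -(psumE (fun u v => enorm (remainder f Z y u v)) s t P).
have -> : remainder f Z y s t = J 0%N (size P).
  by rewrite /J /tk (itv_partition_nth_size _ Pp).
have omE : om s t + 2 * e = om' 0%N (size P).
  by rewrite /om' eE /tk (itv_partition_nth_size _ Pp).
have EC a b c : (a <= b)%N -> (b <= c)%N -> E a c = E a b + E b c.
  by move=> ab bc; rewrite /E (@big_cat_nat _ _ _ b).
have om'0 a b : (a <= b <= size P)%N -> 0 <= om' a b.
  move=> /andP[ab bP]; have [sa _] := tkb a (leq_trans ab bP); have [_ bt] := tkb b bP.
  by rewrite addr_ge0 ?(control_ge0 omC) ?mulr_ge0// tkm.
have om'D a b c : (a <= b)%N -> (b <= c <= size P)%N -> om' a b + om' b c <= om' a c.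
  move=> ab /andP[bc cP]; have bP := leq_trans bc cP.
  have [sa _] := tkb a (leq_trans ab bP); have [_ ct] := tkb c cP.
  rewrite /om' (EC a b c)// mulrDr addrACA lerD2r.
  by apply: (controlD omC) => //; exact: tkm.
rewrite omE eE; rewrite omE in ed.
apply: (@davie R n (size P) J om' th K th1 _ om'0 om'D _ _ _ A de) => //.
- move=> a; have [sa at'] : s <= tk a /\ tk a <= t.
    case: (leqP a (size P)) => [/tkb//|aP].
    by rewrite /tk nth_default// st.
  rewrite /J JWs// (bigD1_seq [::])//= (increment_id ZI _ sa at') scale1r.
  rewrite big1 ?addr0 ?subrr// => w wn.
  by rewrite (increment_id ZI _ sa at') /gone (negbTE wn) scale0r.
- move=> a b /andP[ab bP]; have [sa _] := tkb a (leq_trans ab bP); have [_ bt] := tkb b bP.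
  by rewrite -/(E a b) lerDr (control_ge0 omC)// tkm.
- move=> a b c ab /andP[bc cP] Jab; have bP := leq_trans bc cP.
  have [sa _] := tkb a (leq_trans ab bP); have [sb _] := tkb b bP.
  have [_ bt] := tkb b bP; have [_ ct] := tkb c cP.
  have tab := tkm a b ab bP; have tbc := tkm b c bc cP.
  have tac := le_trans tab tbc.
  have oab := om'0 a b; have obc := om'0 b c.
  rewrite ab bP in oab; rewrite bc cP in obc.
  have {}oab := oab isT; have {}obc := obc isT.
  have oac : 0 <= om' a c by apply: om'0; rewrite (leq_trans ab bc).
  have ab_ac : om' a b <= om' a c.
    by apply: le_trans (om'D a b c ab _); rewrite ?lerDl// bc.
  have bc_ac : om' b c <= om' a c.
    by apply: le_trans (om'D a b c ab _); rewrite ?lerDr// bc.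
  have om1 : om' a c <= 1.
    apply: (@le_trans _ _ de); last by rewrite ge_min lexx.
    apply: le_trans ed.
    apply: (@le_trans _ _ (om' 0%N c)).
      apply: le_trans (om'D 0%N a c (leq0n _) _); last by rewrite (leq_trans ab bc).
      by rewrite lerDr om'0// (leq_trans (leq_trans ab bc)).
    apply: le_trans (om'D 0%N c (size P) (leq0n _) _); last by rewrite cP leqnn.
    by rewrite lerDl om'0// cP leqnn.
  have om_om' u v : (u <= v)%N -> om (tk u) (tk v) <= om' u v.
    by move=> uv; rewrite lerDl mulr_ge0.
  have Zom' u v w : (u <= v)%N -> (v <= size P)%N -> w \in Ws ->
      `|Z (tk u) (tk v) w| * Mw M w <= om' u v `^ wlen p w.
    move=> uv vP wW; have [su _] := tkb u (leq_trans uv vP); have [_ vt] := tkb v vP.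
    have [->|wn] := eqVneq w [::].
      have [-> _] := increment_G ZI su (tkm _ _ uv vP) vt.
      by rewrite wlen_nil powRr0 normr1 mul1r /Mw big_nil.
    apply: le_trans (Zom _ _ _ su (tkm _ _ uv vP) vt _ wn) _; first by rewrite -WP0.
    have w0 := wlen_ge0 w (p_gt0 p_ge1).
    rewrite ge0_ler_powR ?nnegrE ?(control_ge0 omC) ?tkm ?om_om'//.
    by rewrite om'0// uv.
  have GR := increment_G ZI sa tab bt.
  have [Z1 Zsh] := GR.
  (* Chen's relation, grouped by the right factor w: the empty w reproduces the expansion contained
     in J a b and cancels, and each other w leaves the error in the expansion of F^w. *)
  have defect : J a c - J a b - J b c = \sum_(w <- Ws | w != [::])
      Z (tk b) (tk c) w *: (Fw f w (y (tk b)) -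
       \sum_(v <- Ws | wlen p v < th - wlen p w) Z (tk a) (tk b) v *: Fw f (v ++ w) (y (tk a))).
    rewrite /J !JWs//.
    have -> : \sum_(w <- Ws) Z (tk a) (tk c) w *: Fw f w (y (tk a)) =
        \sum_(w <- Ws) gmul (Z (tk a) (tk b)) (Z (tk b) (tk c)) w *: Fw f w (y (tk a)).
      rewrite big_seq [RHS]big_seq; apply: eq_bigr => w wW.
      by rewrite (increment_chen ZI sa tab tbc ct)// -WP0.
    rewrite (big_gmul _ _ _ (p_gt0 p_ge1) uW WP).
    rewrite (bigD1_seq [::])//= wlen_nil subr0.
    have [-> _] := increment_G ZI sb tbc ct; rewrite scale1r.
    have -> : \sum_(v <- Ws | wlen p v < th) Z (tk a) (tk b) v *: Fw f (v ++ [::]) (y (tk a))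
      = \sum_(v <- Ws) Z (tk a) (tk b) v *: Fw f v (y (tk a)).
      rewrite big_mkcond big_seq [RHS]big_seq; apply: eq_bigr => v vW.
      by rewrite -WP vW cats0.
    rewrite [X in _ - (_ - X)](bigD1_seq [::])//=.
    have [-> _] := increment_G ZI sb tbc ct; rewrite scale1r.
    under [RHS]eq_bigr do rewrite scalerBr.
    rewrite sumrB.
    set S1 := \sum_(_ <- Ws) _; set S2 := \sum_(_ <- Ws | _) _; set S3 := \sum_(_ <- Ws | _) _.
    rewrite /Fw/=; apply/rowP => k; rewrite !mxE; ring.
  rewrite defect.
  apply: le_trans (ler_enorm_sum _ _ _) _.
  rewrite /K -mulrA.
  apply: (@le_trans _ _ (\sum_(w <- Ws) krem Ws Lm Nm Lm * om' a c `^ th)); last first.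
    by rewrite big_const_seq count_predT iter_addr_0 mulr_natl.
  rewrite big_mkcond; apply: ler_sum_seq => w wW.
  case: ifP => wn; last by rewrite mulr_ge0 ?powR_ge0.
  rewrite enormZ.
  have wth : wlen p w < th by rewrite -WP.
  have w0 := wlen_ge0 w (p_gt0 p_ge1).
  have := @Fw_rem R n d p (pmax p) th (jet_order p) M f (p_gt0 p_ge1)
    (pmax_ge1 d_gt0 p_ge1) (@le_pmax R d p) (theta_le_jet d_gt0 p_ge1)
    (theta_subr_le1 d_gt0 p_ge1) th1 fJ M0 Ws Lm Nm uW WP WL NN
    (Z (tk a) (tk b)) (om' a b) (y (tk a)) (y (tk b)) Z1.
  move=> /(_ _ _ _ _ w wW wn) rem.
  apply: le_trans (ler_wpM2l (normr_ge0 _) (rem _ _ _ _)) _ => //.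
  + by move=> u v uv; apply: Zsh; rewrite -wlen_cat -(wlen_lt_theta d_gt0 p_ge1) wlen_cat.
  + by rewrite oab (le_trans ab_ac).
  + by move=> v vW; exact: Zom'.
  + move: Jab; rewrite /J /remainder wordsE -fsbig_seq ?filter_uniq// big_filter.
    by [].
  rewrite -mulrA mulrCA mulrA.
  rewrite [X in X <= _](_ : _ = krem Ws Lm Nm Lm * (`|Z (tk b) (tk c) w| * Mw M w *
     om' a b `^ (th - wlen p w))); last by ring.
  rewrite ler_wpM2l//.
  have -> : om' a c `^ th = om' a c `^ (wlen p w) * om' a c `^ (th - wlen p w).
    by rewrite -powRD addrC subrK// gt_eqF.
  apply: ler_pM; rewrite ?powR_ge0 ?mulr_ge0 ?Mw_ge0//.
    apply: le_trans (Zom' b c w bc cP wW) _.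
    by rewrite ge0_ler_powR ?nnegrE.
  by rewrite ge0_ler_powR ?nnegrE// subr_ge0 ltW.
- by rewrite leqnn andbT.
Qed.

Lemma local_estimate : exists2 Ad : R * R, 0 <= Ad.1 /\ 0 < Ad.2 <= 1 &
  forall n (f : 'I_d -> 'rV[R]_n -> 'rV[R]_n) (M : 'I_d -> R) Z om y s t,
  (forall i, jet_bound (jet_order p i) (M i) (f i)) -> (forall i, 0 <= M i) ->
  s <= t -> is_increment Z s t -> is_control om s t ->
  (forall u v w, s <= u -> u <= v -> v <= t -> wlen p w <= 1 -> w != [::] ->
     `|Z u v w| * Mw M w <= om u v `^ wlen p w) ->
  (forall e, 0 < e -> exists2 P, itv_partition s t P &
     psum (fun u v => enorm (remainder f Z y u v)) s P <= e) ->
  om s t <= Ad.2 ->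
  enorm (remainder f Z y s t) <= Ad.1 * om s t `^ th.
Proof.
have th1 := theta_gt1 d_gt0 p_ge1.
have th0 : 0 < th by exact: lt_trans th1.
have [[A de] /= [A0 /andP[de0 de1]] AP] := remainder_le_partition.
exists (A * 2 `^ th + 1, de / 2) => /=.
  by rewrite addr_ge0 ?mulr_ge0 ?powR_ge0// divr_gt0//= ler_pdivrMr// (le_trans de1)// mul1r ler1n.
move=> n f M Z om y s t fJ M0 st ZI omC Zom small omd.
have om0 := control_ge0 omC (lexx s) st (lexx t).
have step e : 0 < e -> om s t + 2 * e <= de ->
    enorm (remainder f Z y s t) <= A * (om s t + 2 * e) `^ th + e.
  move=> e0 ode; have [P Pp Pe] := small e e0.
  have ps0 := @psum_ge0 R (fun u v => enorm (remainder f Z y u v)) s P (fun u v => enorm_ge0 _).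
  have oo : om s t + 2 * psum (fun u v => enorm (remainder f Z y u v)) s P <= om s t + 2 * e.
    by rewrite lerD2l ler_wpM2l.
  apply: le_trans (AP n f M Z om y s t fJ M0 st ZI omC Zom P Pp (le_trans oo ode)) _.
  rewrite lerD// ler_wpM2l// ge0_ler_powR ?nnegrE ?(ltW th0) ?addr_ge0 ?mulr_ge0 ?(ltW e0)//.
exact: (powR_limit th1 A0 de0 de1 om0 omd step).
Qed.

End Local.

(** * Riemann-Stieltjes integrals and signatures *)

Section UniformContinuity.
Context {R : realType}.

(** Heine's theorem, from the near-covering form of compactness: half the radius of continuity at x
    serves all points within that half radius. *)
Lemma within_ucont (U : normedModType R) (a b : R) (f : R -> U) :
  {within `[a, b], continuous f} -> forall e, 0 < e ->
  exists2 de, 0 < de & forall s t, a <= s <= b -> a <= t <= b ->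
    `|s - t| < de -> `|f s - f t| < e.
Proof.
move=> /subspace_continuousP fc e e0.
pose P (de s : R) := forall t, a <= s <= b -> a <= t <= b ->
  `|s - t| < de -> `|f s - f t| < e.
have cov : near_covering `[a, b]%classic.
  by apply/compact_near_coveringP; exact: segment_compact.
have := cov R (0^'+) P _ => /(_ _)[].
  move=> x /= xab.
  have /cvgrPdist_lt/(_ (e / 2))[|eta /= eta0 etaP] := fc x xab; first by rewrite divr_gt0.
  exists (ball x (eta / 2), [set de | 0 < de < eta / 2]) => /=.
    split; first by apply: nbhsx_ballx; rewrite divr_gt0.
    have : \forall de \near 0^'+, de < eta / 2 by apply: nbhs_right_lt; rewrite divr_gt0.
    have : \forall de \near 0^'+, 0 < de :> R by exact: nbhs_right_gt.
    apply: filterS2 => de d0 d1 /=.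
    by rewrite d0.
  move=> [s de] /= [xs /andP[d0 de2]] t sab tab st.
  have sx : `|x - s| < eta / 2 by [].
  have h1 := etaP s; rewrite /ball/= in h1.
  have h2 := etaP t; rewrite /ball/= in h2.
  have {}h1 : `|f x - f s| < e / 2.
    by apply: h1; [rewrite (lt_trans sx)// ltr_pdivrMr// ltr_pMr ?ltr1n|rewrite in_itv].
  have {}h2 : `|f x - f t| < e / 2.
    apply: h2; last by rewrite in_itv.
    rewrite -(subrKA s) (le_lt_trans (ler_normD _ _))// (splitr eta) ltrD//.
    exact: lt_trans st de2.
  rewrite -(subrKA (f x)) (le_lt_trans (ler_normD _ _))// (splitr e) ltrD//.
  by rewrite distrC.
move=> de /= de0 deP; exists (de / 2); first by rewrite divr_gt0.
move=> s t sab tab st; apply: (deP (de / 2)) => //=.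
- by rewrite sub0r normrN gtr0_norm ?divr_gt0// ltr_pdivrMr// ltr_pMr ?ltr1n.
- by rewrite divr_gt0.
Qed.

End UniformContinuity.

Section Primitive.
Context {R : realType}.
Implicit Types (f g v H Phi : R -> R) (s t c e T : R).

Definition ucont T f := forall e, 0 < e -> exists2 de, 0 < de &
  forall s t, 0 <= s <= T -> 0 <= t <= T -> `|s - t| < de -> `|f s - f t| <= e.

Definition ctrl T g v := forall s t, 0 <= s -> s <= t -> t <= T ->
  `|g t - g s| <= v t - v s.

(* dPhi = f dg, uniformly with respect to the increments of v. *)
Definition prim T f g v Phi := forall e, 0 < e -> exists2 de, 0 < de &
  forall s c t, 0 <= s -> s <= c -> c <= t -> t <= T -> t - s < de ->
  `|Phi t - Phi s - f c * (g t - g s)| <= e * (v t - v s).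

Lemma ctrl_mono T g v s t : ctrl T g v -> 0 <= s -> s <= t -> t <= T -> v s <= v t.
Proof. by move=> gv s0 st tT; rewrite -subr_ge0 (le_trans (normr_ge0 _) (gv _ _ _ _ _)). Qed.

Lemma ctrl_le T T' g v : T' <= T -> ctrl T g v -> ctrl T' g v.
Proof. by move=> TT gv s t s0 st tT; apply: gv => //; exact: le_trans TT. Qed.

Lemma prim_leT T T' f g v Phi : T' <= T -> prim T f g v Phi -> prim T' f g v Phi.
Proof.
move=> TT fp e e0; have [de de0 deP] := fp e e0; exists de => // s c t s0 sc ct tT.
by apply: deP => //; exact: le_trans TT.
Qed.

(** The bound is additive over adjacent intervals, so it propagates from short intervals to long
    ones. *)
Lemma small_steps (a b C de : R) H v : 0 < de ->
  (forall s t, a <= s -> s <= t -> t <= b -> t - s < de ->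
     `|H t - H s| <= C * (v t - v s)) ->
  forall s t, a <= s -> s <= t -> t <= b -> `|H t - H s| <= C * (v t - v s).
Proof.
move=> de0 Hd s t a_s st tb.
have [m] : exists m : nat, t - s < m%:R * (de / 2).
  exists (Num.truncn ((t - s) / (de / 2))).+1.
  by rewrite -ltr_pdivrMr ?divr_gt0// truncnS_gt.
elim: m t st tb => [|m IH] t st tb tm.
  by move: tm; rewrite mul0r ltNge subr_ge0 st.
have [tde|tde] := ltP (t - s) de; first exact: Hd.
pose u := t - de / 2.
have d2 : de / 2 < de by rewrite ltr_pdivrMr// ltr_pMr ?ltr1n.
have d20 : 0 < de / 2 by rewrite divr_gt0.
have su : s <= u by rewrite lerBrDr -lerBrDl (le_trans (ltW d2)).
have ut : u <= t by rewrite gerBl ltW.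
have um : u - s < m%:R * (de / 2).
  by move: tm; rewrite -natr1 mulrDl mul1r /u; lra.
have h1 := IH u su (le_trans ut tb) um.
have h2 : `|H t - H u| <= C * (v t - v u).
  by apply: Hd => //; [exact: le_trans su|rewrite /u opprB addrC subrK].
rewrite -(subrKA (H u)) (le_trans (ler_normD _ _))//.
have -> : C * (v t - v s) = C * (v t - v u) + C * (v u - v s) by ring.
exact: lerD.
Qed.

Lemma prim_le T f g v Phi B a b : ctrl T g v -> prim T f g v Phi ->
  0 <= a -> a <= b -> b <= T -> (forall c, a <= c <= b -> `|f c| <= B) ->
  `|Phi b - Phi a| <= B * (v b - v a).
Proof.
move=> gv fp a0 ab bT fB.
have vab : 0 <= v b - v a by rewrite subr_ge0; exact: (ctrl_mono gv).
apply/ler_addgt0Pr => e e0.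
pose e1 := e / (v b - v a + 1).
have e10 : 0 < e1 by rewrite divr_gt0// ltr_wpDl.
have [de de0 deP] := fp _ e10.
apply: (@le_trans _ _ ((B + e1) * (v b - v a))); last first.
  rewrite mulrDl lerD2l /e1 mulrAC ler_pdivrMr ?ltr_wpDl//.
  by rewrite ler_wpM2l ?(ltW e0)// lerDl.
apply: (@small_steps a b _ de Phi v) => // s t a_s st tb tsde.
have s0 := le_trans a0 a_s; have tT := le_trans tb bT.
have := deP s s t s0 (lexx _) st tT tsde.
have gst := gv s t s0 st tT.
rewrite -{2}[Phi t - Phi s](subrK (f s * (g t - g s))) => h.
apply: le_trans (ler_normD _ _) _; rewrite [leRHS]mulrDl addrC lerD//.
by rewrite normrM ler_pM// fB// a_s (le_trans st).
Qed.

(** The difference is a primitive of 0, to which [prim_le] applies with the bound 0. *)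
Lemma prim_unique T f f' g v Phi Phi' a b : ctrl T g v ->
  prim T f g v Phi -> prim T f' g v Phi' -> (forall c, 0 <= c <= T -> f c = f' c) ->
  0 <= a -> a <= b -> b <= T -> Phi b - Phi a = Phi' b - Phi' a.
Proof.
move=> gv p1 p2 ff a0 ab bT.
have p0 : prim T (fun=> 0) g v (fun t => Phi t - Phi' t).
  move=> e e0; have e2 : 0 < e / 2 by rewrite divr_gt0.
  have [d1 d10 d1P] := p1 _ e2; have [d2 d20 d2P] := p2 _ e2.
  exists (Num.min d1 d2); first by rewrite lt_min d10.
  move=> s c t s0 sc ct tT; rewrite lt_min => /andP[t1 t2].
  have h1 := d1P s c t s0 sc ct tT t1; have h2 := d2P s c t s0 sc ct tT t2.
  rewrite mul0r subr0 -ff in h2 *; last by rewrite (le_trans s0)//= (le_trans ct).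
  have -> : Phi t - Phi' t - (Phi s - Phi' s) = (Phi t - Phi s - f c * (g t - g s))
     - (Phi' t - Phi' s - f c * (g t - g s)) by ring.
  rewrite (le_trans (ler_normB _ _))// (splitr e) mulrDl.
  exact: lerD.
have := prim_le gv p0 a0 ab bT (B := 0) => /(_ _)/[!mul0r] h.
have : `|Phi b - Phi' b - (Phi a - Phi' a)| <= 0 by apply: h => c _; rewrite normr0.
rewrite normr_le0 subr_eq0 => /eqP e.
by rewrite -(subrK (Phi' b) (Phi b)) e; ring.
Qed.

Lemma primD T f f' g v Phi Phi' : prim T f g v Phi -> prim T f' g v Phi' ->
  prim T (fun c => f c + f' c) g v (fun t => Phi t + Phi' t).
Proof.
move=> p1 p2 e e0; have e2 : 0 < e / 2 by rewrite divr_gt0.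
have [d1 d10 d1P] := p1 _ e2; have [d2 d20 d2P] := p2 _ e2.
exists (Num.min d1 d2); first by rewrite lt_min d10.
move=> s c t s0 sc ct tT; rewrite lt_min => /andP[t1 t2].
have h1 := d1P s c t s0 sc ct tT t1; have h2 := d2P s c t s0 sc ct tT t2.
have -> : Phi t + Phi' t - (Phi s + Phi' s) - (f c + f' c) * (g t - g s) =
  (Phi t - Phi s - f c * (g t - g s)) + (Phi' t - Phi' s - f' c * (g t - g s)) by ring.
by rewrite (le_trans (ler_normD _ _))// (splitr e) mulrDl lerD.
Qed.

Lemma primZ T (k : R) f g v Phi : ctrl T g v -> prim T f g v Phi ->
  prim T (fun c => k * f c) g v (fun t => k * Phi t).
Proof.
move=> gv p1 e e0; have e2 : 0 < e / (`|k| + 1) by rewrite divr_gt0// ltr_wpDl.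
have [d1 d10 d1P] := p1 _ e2; exists d1 => // s c t s0 sc ct tT tsd.
have -> : k * Phi t - k * Phi s - k * f c * (g t - g s) =
  k * (Phi t - Phi s - f c * (g t - g s)) by ring.
rewrite normrM; apply: le_trans (ler_wpM2l (normr_ge0 _) (d1P s c t s0 sc ct tT tsd)) _.
rewrite mulrA ler_wpM2r ?subr_ge0; first by [].
  by apply: (ctrl_mono gv) => //; exact: le_trans ct.
by rewrite ler_pdivD1// ltW.
Qed.

Lemma prim_const T g v : ctrl T g v -> prim T (fun=> 1) g v g.
Proof.
move=> gv e e0; exists 1 => // s c t s0 sc ct tT _.
rewrite mul1r subrr normr0 mulr_ge0 ?(ltW e0)// subr_ge0.
by apply: (ctrl_mono gv) => //; exact: le_trans ct.
Qed.

Lemma prim0 T g v : ctrl T g v -> prim T (fun=> 0) g v (fun=> 0).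
Proof.
move=> gv e e0; exists 1 => // s c t s0 sc ct tT _.
rewrite mul0r !subrr normr0 mulr_ge0 ?(ltW e0)// subr_ge0.
by apply: (ctrl_mono gv) => //; exact: le_trans ct.
Qed.

Lemma prim_sum T (I : Type) (r : seq I) (F Psi : I -> R -> R) g v : ctrl T g v ->
  (forall i, prim T (F i) g v (Psi i)) ->
  prim T (fun c => \sum_(i <- r) F i c) g v (fun t => \sum_(i <- r) Psi i t).
Proof.
move=> gv Fp; elim: r => [|i r IH].
  have -> : (fun c : R => \sum_(i <- [::]) F i c) = fun=> 0 by apply/funext => c; rewrite big_nil.
  have -> : (fun c : R => \sum_(i <- [::]) Psi i c) = fun=> 0 by apply/funext => c; rewrite big_nil.
  exact: prim0.
have -> : (fun c => \sum_(i <- i :: r) F i c) = fun c => F i c + \sum_(i <- r) F i c.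
  by apply/funext => c; rewrite big_cons.
have -> : (fun c => \sum_(i <- i :: r) Psi i c) = fun c => Psi i c + \sum_(i <- r) Psi i c.
  by apply/funext => c; rewrite big_cons.
exact: primD.
Qed.

Lemma cauchy_lim (u : nat -> R) :
  (forall e, 0 < e -> exists N0, forall n m, (N0 <= n)%N -> (N0 <= m)%N -> `|u n - u m| <= e) ->
  exists l, forall e, 0 < e -> exists N0, forall n, (N0 <= n)%N -> `|u n - l| <= e.
Proof.
move=> cu; have : cauchy (u @ \oo).
  apply/cauchy_ballP => e e0; have [N0 N0P] := cu (e / 2) ltac:(by rewrite divr_gt0).
  rewrite near_map2; exists ([set n | (N0 <= n)%N], [set n | (N0 <= n)%N]); first by split; exists N0.
  move=> [n m] /= [nN mN]; rewrite /ball/=.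
  by rewrite (le_lt_trans (N0P n m nN mN))// ltr_pdivrMr// ltr_pMr ?ltr1n.
move=> /cauchy_cvgP/cvg_ex[l ul]; exists l => e e0.
move/cvgrPdist_le : ul => /(_ _ e0)[N0 _ N0P]; exists N0 => n nN.
by rewrite distrC; exact: N0P.
Qed.

Section Existence.
Variables (T : R) (f g v : R -> R).
Hypothesis T0 : 0 <= T.
Hypothesis gv : ctrl T g v.
Let tau (N k : nat) : R := k%:R * (T / N.+1%:R).
Let I (N : nat) t : R := \sum_(k < N.+1)
  f (tau N k) * (g (Num.min t (tau N k.+1)) - g (Num.min t (tau N k))).

(** [I N t] is the left-point Riemann sum on the uniform grid of [0, T], stopped at t. Clamping the
    grid to [s, t] expresses the difference of two such sums by the cells that meet [s, t]: the
    others contribute 0, and the left end of a cell that counts is within t - s + T/(N+1) of c. *)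
Lemma riemann_diff N s c t e : 0 <= e -> 0 <= s -> s <= c -> c <= t -> t <= T ->
  (forall x, 0 <= x <= T -> `|x - c| <= t - s + T / N.+1%:R -> `|f x - f c| <= e) ->
  `|I N t - I N s - f c * (g t - g s)| <= e * (v t - v s).
Proof.
move=> e0 s0 sc ct tT fe.
have st := le_trans sc ct; have t0 := le_trans s0 st.
pose cl x := Num.max s (Num.min t x).
have clb x : s <= cl x <= t.
  by rewrite /cl le_max lexx/= ge_max st/= ge_min lexx.
have h0 : 0 <= T / N.+1%:R by rewrite divr_ge0.
have taum k : tau N k <= tau N k.+1 by rewrite ler_wpM2r// ler_nat.
have clm k : cl (tau N k) <= cl (tau N k.+1).
  by rewrite /cl; have := taum k; rewrite !maxEle !minEle; do ?case: ifP; lra.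
have gcl x : g (Num.min t x) - g (Num.min s x) = g (cl x) - g s.
  by rewrite /cl !minEle !maxEle; do ?case: ifP; lra.
have -> : I N t - I N s = \sum_(k < N.+1) f (tau N k) *
    (g (cl (tau N k.+1)) - g (cl (tau N k))).
  rewrite /I -sumrB; apply: eq_bigr => k _.
  by have := gcl (tau N k.+1); have := gcl (tau N k) => e1 e2; rewrite -mulrBr; congr (_ * _); lra.
have tele (h : R -> R) : \sum_(k < N.+1) (h (cl (tau N k.+1)) - h (cl (tau N k))) = h t - h s.
  rewrite -(big_mkord xpredT (fun k => h (cl (tau N k.+1)) - h (cl (tau N k)))).
  rewrite telescope_sumr// /cl /tau mul0r mulrC divfK ?pnatr_eq0//.
  by rewrite (min_l tT) (max_r st) (min_r t0) (max_l s0).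
rewrite -(tele g) mulr_sumr -sumrB.
apply: le_trans (ler_norm_sum _ _ _) _.
rewrite -(tele v) mulr_sumr; apply: ler_sum => k _; rewrite -mulrBl normrM.
have gvk : `|g (cl (tau N k.+1)) - g (cl (tau N k))| <= v (cl (tau N k.+1)) - v (cl (tau N k)).
  have /andP[b1 b2] := clb (tau N k); have /andP[b3 b4] := clb (tau N k.+1).
  by apply: gv => //; [exact: le_trans b1|exact: le_trans tT].
have [eqc|neqc] := eqVneq (cl (tau N k)) (cl (tau N k.+1)).
  by rewrite eqc !subrr normr0 !mulr0.
apply: ler_pM => //; apply: fe.
  rewrite /tau mulr_ge0//= -[leRHS](divfK (x := N.+1%:R)) ?pnatr_eq0// mulrC.
  by rewrite ler_wpM2l// ler_nat ltnW.
have tauS : tau N k.+1 = tau N k + T / N.+1%:R.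
  by rewrite /tau -natr1 mulrDl mul1r.
have [h1 h2] : tau N k < t /\ s < tau N k.+1.
  split; rewrite ltNge; apply: contra neqc => h; apply/eqP; rewrite /cl.
    by rewrite !min_l// (le_trans h).
  by rewrite !min_r ?max_l// ?(le_trans h)// (le_trans (taum k))// (le_trans h).
have dist (a q : R) : a < t -> s < a + q -> 0 <= q -> `|a - c| <= t - s + q.
  by move=> at' sq q0; rewrite ler_norml; apply/andP; split; lra.
by apply: dist => //; rewrite -tauS.
Qed.

(** For large N all [I N] satisfy the estimate of a primitive to accuracy e on short intervals.
    Hence the increments of [I n - I m] are small relative to those of v, by [small_steps] on all of
    [0, t]; the sequence is Cauchy at each t and its limit inherits the estimate. *)
Lemma prim_exists : ucont T f -> exists Phi, prim T f g v Phi.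
Proof.
move=> fu.
have close e : 0 < e -> exists2 de, 0 < de & exists N0 : nat, forall N, (N0 <= N)%N ->
    forall s c t, 0 <= s -> s <= c -> c <= t -> t <= T -> t - s < de ->
    `|I N t - I N s - f c * (g t - g s)| <= e * (v t - v s).
  move=> e0; have [de de0 deP] := fu e e0.
  exists (de / 2); first by rewrite divr_gt0.
  pose N0 := Num.truncn (T / (de / 2)).
  exists N0 => N NN s c t s0 sc ct tT tsd.
  apply: riemann_diff => //; first exact: ltW.
  move=> x x0T xc; apply: deP => //.
    by rewrite (le_trans s0)//= (le_trans ct).
  apply: le_lt_trans xc _; rewrite (splitr de) ltrD//.
  rewrite ltr_pdivrMr// mulrC -ltr_pdivrMr ?divr_gt0//.
  by apply: lt_le_trans (truncnS_gt _) _; rewrite ler_nat ltnS.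
have I0 N : I N 0 = 0.
  rewrite /I big1// => k _.
  have ta0 j : 0 <= tau N j by rewrite mulr_ge0// divr_ge0.
  by rewrite !min_l// subrr mulr0.
have cau t : 0 <= t <= T -> forall e, 0 < e -> exists N0, forall n m,
    (N0 <= n)%N -> (N0 <= m)%N -> `|I n t - I m t| <= e.
  move=> /andP[t0 tT] e e0.
  have vt : 0 <= v t - v 0 by rewrite subr_ge0; exact: (ctrl_mono gv).
  pose e1 := e / (2 * (v t - v 0) + 1).
  have e10 : 0 < e1 by rewrite divr_gt0// ltr_wpDl// mulr_ge0.
  have [de de0 [N0 N0P]] := close _ e10; exists N0 => n m nN mN.
  have : `|(I n t - I m t) - (I n 0 - I m 0)| <= (2 * e1) * (v t - v 0).
    apply: (@small_steps 0 T (2 * e1) de (fun t => I n t - I m t) v) => // s u s0 su uT usd.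
    have h1 := N0P n nN s s u s0 (lexx _) su uT usd.
    have h2 := N0P m mN s s u s0 (lexx _) su uT usd.
    have -> : I n u - I m u - (I n s - I m s) = (I n u - I n s - f s * (g u - g s)) -
       (I m u - I m s - f s * (g u - g s)) by ring.
    rewrite (le_trans (ler_normB _ _))// -mulrA mulr_natl mulr2n.
    exact: lerD.
  rewrite !I0 !subr0 => /le_trans; apply.
  rewrite -mulrA mulrCA /e1 mulrAC ler_pdivrMr ?ltr_wpDl ?mulr_ge0//.
  by rewrite ler_wpM2l ?(ltW e0)// lerDl.
have lims t : exists l, 0 <= t <= T -> forall e, 0 < e -> exists N0, forall n,
    (N0 <= n)%N -> `|I n t - l| <= e.
  have [tT|tT] := boolP (0 <= t <= T); last by exists 0.
  by have [l lP] := cauchy_lim (cau t tT); exists l.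
have [Phi PhiP] := choice lims.
exists Phi => e e0; have e2 : 0 < e by [].
have [de de0 [N0 N0P]] := close _ e2; exists de => // s c t s0 sc ct tT tsd.
have st := le_trans sc ct.
apply/ler_addgt0Pr => eta eta0; have eta2 : 0 < eta / 2 by rewrite divr_gt0.
have tb : 0 <= t <= T by rewrite (le_trans s0 st).
have sb : 0 <= s <= T by rewrite s0 (le_trans st).
have [N1 N1P] := PhiP t tb _ eta2; have [N2 N2P] := PhiP s sb _ eta2.
pose N := maxn N0 (maxn N1 N2).
have h0 := N0P N (leq_maxl _ _) s c t s0 sc ct tT tsd.
have h1 := N1P N (leq_trans (leq_maxl _ _) (leq_maxr _ _)).
have h2 := N2P N (leq_trans (leq_maxr _ _) (leq_maxr _ _)).
have -> : Phi t - Phi s - f c * (g t - g s) =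
  (I N t - I N s - f c * (g t - g s)) - (I N t - Phi t) + (I N s - Phi s) by ring.
apply: le_trans (ler_normD _ _) _; rewrite (splitr eta) addrA lerD//.
by apply: le_trans (ler_normB _ _) _; rewrite lerD.
Qed.

End Existence.

Lemma fine_partition (a b de : R) : 0 < de -> a <= b ->
  exists2 P, itv_partition a b P & path (fun x y => y - x < de) a P.
Proof.
move=> de0 ab.
have [m] : exists m : nat, b - a < m%:R * (de / 2).
  exists (Num.truncn ((b - a) / (de / 2))).+1.
  by rewrite -ltr_pdivrMr ?divr_gt0// truncnS_gt.
elim: m a ab => [|m IH] a ab am.
  by move: am; rewrite mul0r ltNge subr_ge0 ab.
have [tde|tde] := ltP (b - a) de.
  exists (tpart a b); first exact: tpartP.
  by rewrite /tpart; case: eqP => //= _; rewrite tde.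
have d2 : de / 2 < de by rewrite ltr_pdivrMr// ltr_pMr ?ltr1n.
have d20 : 0 < de / 2 by rewrite divr_gt0.
have [||P Pp Pd] := IH (a + de / 2); [by lra|by move: am; rewrite -natr1 mulrDl mul1r; lra|].
exists (a + de / 2 :: P); last by rewrite /= Pd andbT addrAC subrr add0r.
rewrite -cat1s; apply: itv_partition_cat Pp.
by apply: itv_partition1; rewrite ltrDl.
Qed.

Lemma is_RS_prim T f g v Phi a b : ctrl T g v -> prim T f g v Phi ->
  0 <= a -> a <= b -> b <= T -> is_RS f g a b (Phi b - Phi a).
Proof.
move=> gv fp a0 ab bT e e0.
have vab : 0 <= v b - v a by rewrite subr_ge0; exact: (ctrl_mono gv).
pose e1 := e / (v b - v a + 1).
have e10 : 0 < e1 by rewrite divr_gt0// ltr_wpDl.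
have [de de0 deP] := fp _ e10; exists de => // P c Pp Pc.
have nE := itv_partition_nth_size b Pp.
have tele (h : R -> R) : \sum_(0 <= k < size P)
   (h (nth b (a :: P) k.+1) - h (nth b (a :: P) k)) = h b - h a.
  by rewrite (telescope_sumr (fun k => h (nth b (a :: P) k)))// nE.
rewrite -(tele Phi) -sumrB.
apply: (@le_lt_trans _ _ (e1 * (v b - v a))); last first.
  rewrite /e1 mulrAC ltr_pdivrMr ?ltr_wpDl//.
  by rewrite ltr_pM2l// ltrDl.
apply: le_trans (ler_norm_sum _ _ _) _.
rewrite -(tele v) mulr_sumr big_nat [leRHS]big_nat; apply: ler_sum => k /andP[_ kP].
have [kd /andP[ck1 ck2]] := Pc k kP.
have [ak _] := nth_partition_bounds Pp (ltnW kP).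
have [_ kb] := nth_partition_bounds Pp kP.
rewrite distrC; apply: deP => //; first exact: le_trans ak.
exact: le_trans bT.
Qed.

Lemma is_RS_unique f g a b (I1 I2 : R) : a <= b ->
  is_RS f g a b I1 -> is_RS f g a b I2 -> I1 = I2.
Proof.
move=> ab R1 R2; apply/eqP/negPn/negP => I12.
have e0 : 0 < `|I1 - I2| / 2 by rewrite divr_gt0// normr_gt0 subr_eq0.
have [d1 d10 h1] := R1 _ e0; have [d2 d20 h2] := R2 _ e0.
have d0 : 0 < Num.min d1 d2 by rewrite lt_min d10.
have [P Pp /(pathP b) Pd] := fine_partition d0 ab.
have cP k : (k < size P)%N -> nth b (a :: P) k <= nth b (a :: P) k <= nth b (a :: P) k.+1.
  move=> kP; rewrite lexx/=.
  by have := nth_partition_le Pp (leqnSn k) kP.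
have {}h1 := h1 P (nth b (a :: P)) Pp; have {}h2 := h2 P (nth b (a :: P)) Pp.
have {}h1 := h1 ltac:(by move=> k kP; split; [have := Pd k kP; rewrite lt_min => /andP[]|exact: cP]).
have {}h2 := h2 ltac:(by move=> k kP; split; [have := Pd k kP; rewrite lt_min => /andP[]|exact: cP]).
set S := \sum_(_ <= _ < _) _ in h1 h2.
have : `|I1 - I2| <= `|S - I1| + `|S - I2|.
  by rewrite -(subrKA S) (le_trans (ler_normD _ _))// (distrC I1).
by move: h1 h2; set x1 := `|S - I1|; set x2 := `|S - I2|; set x := `|I1 - I2|; lra.
Qed.

(** [RS] is defined by choice; existence and uniqueness of the limit of the Riemann sums give it its
    value. *)
Lemma RS_prim T f g v Phi a b : ctrl T g v -> prim T f g v Phi ->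
  0 <= a -> a <= b -> b <= T -> RS f g a b = Phi b - Phi a.
Proof.
move=> gv fp a0 ab bT; have h := is_RS_prim gv fp a0 ab bT.
apply: (is_RS_unique ab _ h); rewrite /RS.
by have /= := @xgetPex R 0 [set I | is_RS f g a b I] (ex_intro _ _ h).
Qed.

End Primitive.

Section Signature.
Context {R : realType} {d : nat}.
Variables (T : R) (x : R -> 'rV[R]_d) (v : R -> R).
Local Notation xc i := (fun t => x t 0 i).
Hypothesis xv : forall i, ctrl T (xc i) v.
Hypothesis vu : ucont T v.
Implicit Types (w : seq 'I_d) (s t u : R).
Local Notation S := (signature x).

Lemma sig_cons i w s t : S (i :: w) s t = RS (fun u => S w u t) (xc i) s t.
Proof. by []. Qed.

(** The two claims feed each other: continuity in the lower end point makes the next iterated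
    integral exist, and the size bound makes that integral continuous. A bound without the factor
    1/m! is enough. *)
Lemma sig_main w t : 0 <= t -> t <= T ->
  ucont t (fun u => S w u t) /\
  forall s, 0 <= s -> s <= t -> `|S w s t| <= (v t - v s) ^+ size w.
Proof.
move=> t0 tT; elim: w => [|i w [IHu IHb]].
  split=> [e e0|s s0 st]; last by rewrite /= normr1.
  by exists 1 => // s u _ _ _; rewrite /= subrr normr0 ltW.
have gv := ctrl_le tT (xv i).
have mono s u : 0 <= s -> s <= u -> u <= t -> v s <= v u by exact: (ctrl_mono gv).
have [Phi Php] := prim_exists t0 gv IHu.
have SE s : 0 <= s -> s <= t -> S (i :: w) s t = Phi t - Phi s.
  by move=> s0 st; rewrite sig_cons (RS_prim gv Php).
have fB s c : 0 <= s -> s <= c -> c <= t -> `|S w c t| <= (v t - v s) ^+ size w.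
  move=> s0 sc ct; have c0 := le_trans s0 sc; apply: le_trans (IHb c c0 ct) _.
  rewrite lerXn2r ?nnegrE ?subr_ge0 ?mono// ?lerB ?mono//.
  exact: le_trans ct.
split=> [e e0|s s0 st]; last first.
  rewrite SE// exprSr; apply: (prim_le gv Php) => // c /andP[sc ct].
  exact: fB.
pose B := (v t - v 0) ^+ size w.
have vt0 : 0 <= v t - v 0 by rewrite subr_ge0 mono.
have B0 : 0 <= B by rewrite exprn_ge0.
have e10 : 0 < e / (B + 1) by rewrite divr_gt0// ltr_wpDl.
have [de de0 deP] := vu e10; exists de => //.
have key s u : 0 <= s -> s <= u -> u <= t -> `|s - u| < de -> `|S (i :: w) s t - S (i :: w) u t| <= e.
  move=> s0 su ut sud; have u0 := le_trans s0 su; have st := le_trans su ut.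
  rewrite !SE// (_ : _ - _ = Phi u - Phi s); last by ring.
  apply: le_trans (prim_le gv Php s0 su ut (B := B) _) _.
    by move=> c /andP[sc cu]; apply: fB => //; [exact: le_trans sc|exact: le_trans ut].
  have := deP s u; rewrite s0 u0 (le_trans st tT) (le_trans ut tT) => /(_ isT isT sud).
  rewrite distrC ger0_norm ?subr_ge0 ?mono// => h.
  exact: le_trans (ler_wpM2l B0 h) (ler_pdivD1 (ltW e0) B0).
move=> s u /andP[s0 st] /andP[u0 ut] sud.
have [su|us] := leP s u; first exact: key.
by rewrite distrC key// 1?distrC// ltW.
Qed.

Lemma sig_le w s t : 0 <= s -> s <= t -> t <= T ->
  `|S w s t| <= (v t - v s) ^+ size w.
Proof. by move=> s0 st tT; have [_] := sig_main w (le_trans s0 st) tT; exact. Qed.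

Lemma sig_ucont w t : 0 <= t -> t <= T -> ucont t (fun u => S w u t).
Proof. by move=> t0 tT; have [] := sig_main w t0 tT. Qed.

Lemma sigxx i w t : 0 <= t -> t <= T -> S (i :: w) t t = 0.
Proof.
move=> t0 tT; apply/eqP; rewrite -normr_le0; have := sig_le (i :: w) t0 (lexx t) tT.
by rewrite subrr expr0n.
Qed.

Lemma sig_prim i w t : 0 <= t -> t <= T ->
  exists2 Phi, prim t (fun u => S w u t) (xc i) v Phi &
    forall s, 0 <= s -> s <= t -> S (i :: w) s t = Phi t - Phi s.
Proof.
move=> t0 tT; have gv := ctrl_le tT (xv i).
have [Phi Php] := prim_exists t0 gv (sig_ucont w t0 tT).
by exists Phi => // s s0 st; rewrite sig_cons (RS_prim gv Php).
Qed.

(** The integral over u_1 is split at u. On [s, u] the induction hypothesis writes the integrand as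
    a combination of iterated integrals up to u, each of which has a known primitive; uniqueness of
    primitives concludes. *)
Lemma sig_chen w s u t : 0 <= s -> s <= u -> u <= t -> t <= T ->
  S w s t = gmul (fun w' => S w' s u) (fun w' => S w' u t) w.
Proof.
move=> + + ut tT; elim: w s => [|i w IH] s s0 su; first by rewrite gmul_nil mulr1.
have u0 := le_trans s0 su; have uT := le_trans ut tT; have t0 := le_trans u0 ut.
have [Phi Php SPhi] := sig_prim i w t0 tT.
rewrite gmul_cons [X in X * _]/= mul1r SPhi ?(le_trans su)// SPhi//.
have -> : Phi t - Phi s = Phi t - Phi u + (Phi u - Phi s) by rewrite subrKA.
congr (_ + _).
have gv := ctrl_le uT (xv i).
have /choice[Psi PsiP] : forall k : 'I_(size w).+1, exists Psi,
    prim u (fun r => S (take k w) r u) (xc i) v Psi /\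
    forall s, 0 <= s -> s <= u -> S (i :: take k w) s u = Psi u - Psi s.
  by move=> k; have [Psi p1 p2] := sig_prim i (take k w) u0 uT; exists Psi.
have Psip : prim u (fun r => \sum_(k < (size w).+1) S (drop k w) u t * S (take k w) r u)
    (xc i) v (fun r => \sum_(k < (size w).+1) S (drop k w) u t * Psi k r).
  apply: (@prim_sum _ u _ (index_enum _)
    (fun (k : 'I_(size w).+1) r => S (drop k w) u t * S (take k w) r u)
    (fun (k : 'I_(size w).+1) r => S (drop k w) u t * Psi k r) (xc i) v gv) => k.
  by apply: primZ => //; have [] := PsiP k.
rewrite (prim_unique gv (prim_leT ut Php) Psip _ s0 su (lexx u)); last first.
  move=> c /andP[c0 cu]; rewrite IH// /gmul; apply: eq_bigr => k _.
  by rewrite mulrC.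
rewrite -sumrB /gmul; apply: eq_bigr => k _.
by have [_ ->//] := PsiP k; rewrite -mulrBr mulrC.
Qed.

(** Integration by parts. With A and B the two factors as functions of the lower end point r, and
    F1, F2 primitives of the integrands that start with either first letter, A B + F1 + F2 is
    constant; A vanishes at t. *)
Lemma sig_shuffle (u' w' : seq 'I_d) s t : 0 <= s -> s <= t -> t <= T ->
  S u' s t * S w' s t = ssh (fun w => S w s t) u' w'.
Proof.
move=> + + tT.
elim: {u' w'}(size u' + size w')%N {-2}u' {-2}w' (leqnn (size u' + size w')) s => [|m IH] u w.
  by case: u w => [|? ?] [|? ?]//= _ s _ _; rewrite ssh_nill mul1r.
case: u => [|i u]; first by move=> _ s _ _; rewrite ssh_nill mul1r.
case: w => [|j w]; first by move=> _ s _ _; rewrite ssh_nilr mulr1.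
move=> /= uwm s s0 st; have t0 := le_trans s0 st.
rewrite ssh_cons.
have [Pa Pap SPa] := sig_prim i u t0 tT; have [Pb Pbp SPb] := sig_prim j w t0 tT.
have gi := ctrl_le tT (xv i); have gj := ctrl_le tT (xv j).
have mono r1 r2 : 0 <= r1 -> r1 <= r2 -> r2 <= t -> v r1 <= v r2 by exact: (ctrl_mono gi).
pose A r := S (i :: u) r t; pose Bf r := S (j :: w) r t.
have /choice[G1 G1P] : forall w0 : seq 'I_d, exists Phi,
    prim t (fun u => S w0 u t) (xc i) v Phi /\
    forall s, 0 <= s -> s <= t -> S (i :: w0) s t = Phi t - Phi s.
  by move=> w0; have [Phi ? ?] := sig_prim i w0 t0 tT; exists Phi.
have /choice[G2 G2P] : forall w0 : seq 'I_d, exists Phi,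
    prim t (fun u => S w0 u t) (xc j) v Phi /\
    forall s, 0 <= s -> s <= t -> S (j :: w0) s t = Phi t - Phi s.
  by move=> w0; have [Phi ? ?] := sig_prim j w0 t0 tT; exists Phi.
pose F1 r := \sum_(w0 <- shuffle u (j :: w)) G1 w0 r.
pose F2 r := \sum_(w0 <- shuffle (i :: u) w) G2 w0 r.
have F1p : prim t (fun r => \sum_(w0 <- shuffle u (j :: w)) S w0 r t) (xc i) v F1.
  by apply: (prim_sum _ gi) => w0; have [] := G1P w0.
have F2p : prim t (fun r => \sum_(w0 <- shuffle (i :: u) w) S w0 r t) (xc j) v F2.
  by apply: (prim_sum _ gj) => w0; have [] := G2P w0.
have -> : ssh (fun w0 => S (i :: w0) s t) u (j :: w) = F1 t - F1 s.
  by rewrite /ssh -sumrB; apply: eq_bigr => w0 _; have [_ ->] := G1P w0.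
have -> : ssh (fun w0 => S (j :: w0) s t) (i :: u) w = F2 t - F2 s.
  by rewrite /ssh -sumrB; apply: eq_bigr => w0 _; have [_ ->] := G2P w0.
have f1E r : 0 <= r -> r <= t -> \sum_(w0 <- shuffle u (j :: w)) S w0 r t = S u r t * Bf r.
  by move=> r0 rt; rewrite /Bf IH//=; move: uwm; clear; lia.
have f2E r : 0 <= r -> r <= t -> \sum_(w0 <- shuffle (i :: u) w) S w0 r t = A r * S w r t.
  by move=> r0 rt; rewrite /A IH//=; move: uwm; clear; lia.
pose V := (v t - v 0).
have V0 : 0 <= V by rewrite subr_ge0 mono.
have bound (w0 : seq 'I_d) r : 0 <= r -> r <= t -> `|S w0 r t| <= V ^+ size w0.
  move=> r0 rt; apply: le_trans (sig_le w0 r0 rt tT) _.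
  by rewrite lerXn2r ?nnegrE ?subr_ge0 ?mono// lerB// mono.
pose H r := A r * Bf r + F1 r + F2 r.
pose C := V ^+ (size w).+1 + V ^+ (size u).+1 + 2.
have C0 : 0 < C by rewrite ltr_wpDl// addr_ge0// exprn_ge0.
have Hc : H t - H s = 0.
  apply/eqP; rewrite -normr_le0; apply/ler_addgt0Pr => e e0; rewrite add0r.
  have vts : 0 <= v t - v s by rewrite subr_ge0 mono.
  pose e1 := e / (C * (v t - v s) + 1).
  have e10 : 0 < e1 by rewrite divr_gt0// ltr_wpDl// mulr_ge0// ltW.
  have [d1 d10 d1P] := Pap _ e10; have [d2 d20 d2P] := Pbp _ e10.
  have [d3 d30 d3P] := F1p _ e10; have [d4 d40 d4P] := F2p _ e10.
  pose de := Num.min (Num.min d1 d2) (Num.min d3 d4).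
  have de0 : 0 < de by rewrite !lt_min d10 d20 d30.
  apply: (@le_trans _ _ (C * e1 * (v t - v s))); last first.
    by rewrite mulrAC ler_pdivD1 ?(ltW e0)// mulr_ge0// ltW.
  apply: (@small_steps _ s t (C * e1) de H v) => // r1 r2 sr1 r12 r2t.
  rewrite !lt_min => /andP[/andP[r1d r2d] /andP[r3d r4d]].
  have r10 := le_trans s0 sr1; have r20 := le_trans r10 r12; have r1t := le_trans r12 r2t.
  have h1 := d1P r1 r2 r2 r10 r12 (lexx _) r2t r1d.
  have h2 := d2P r1 r1 r2 r10 (lexx _) r12 r2t r2d.
  have h3 := d3P r1 r2 r2 r10 r12 (lexx _) r2t r3d.
  have h4 := d4P r1 r1 r2 r10 (lexx _) r12 r2t r4d.
  rewrite f1E// in h3; rewrite f2E// in h4.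
  have A12 : A r2 - A r1 = - (Pa r2 - Pa r1) by rewrite /A !SPa//; ring.
  have B12 : Bf r2 - Bf r1 = - (Pb r2 - Pb r1) by rewrite /Bf !SPb//; ring.
  set D := v r2 - v r1 in h1 h2 h3 h4 *.
  (* A is taken at the left end and B at the right end, which makes the product rule exact: each of
     the four terms is an error of a primitive. *)
  have -> : H r2 - H r1 =
    - (Pa r2 - Pa r1 - S u r2 t * (xc i r2 - xc i r1)) * Bf r2
    - A r1 * (Pb r2 - Pb r1 - S w r1 t * (xc j r2 - xc j r1))
    + (F1 r2 - F1 r1 - S u r2 t * Bf r2 * (xc i r2 - xc i r1))
    + (F2 r2 - F2 r1 - A r1 * S w r1 t * (xc j r2 - xc j r1)).
    rewrite /H; have -> : A r2 * Bf r2 + F1 r2 + F2 r2 - (A r1 * Bf r1 + F1 r1 + F2 r1) =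
      (A r2 - A r1) * Bf r2 + A r1 * (Bf r2 - Bf r1) + (F1 r2 - F1 r1) + (F2 r2 - F2 r1) by ring.
    by rewrite A12 B12; ring.
  have -> : C * e1 * D = e1 * D * V ^+ (size w).+1 + V ^+ (size u).+1 * (e1 * D) + e1 * D + e1 * D.
    by rewrite /C; ring.
  have bB : `|Bf r2| <= V ^+ (size w).+1 by exact: bound.
  have bA : `|A r1| <= V ^+ (size u).+1 by exact: bound.
  apply: le_trans (ler_normD _ _) _; apply: lerD => //.
  apply: le_trans (ler_normD _ _) _; apply: lerD => //.
  apply: le_trans (ler_normB _ _) _; apply: lerD.
    by rewrite normrM normrN ler_pM.
  by rewrite normrM ler_pM.
have At : A t = 0 by exact: sigxx.
move: Hc; rewrite /H At mul0r add0r /A /Bf => Hc.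
change (S (i :: u) s t * S (j :: w) s t = F1 t - F1 s + (F2 t - F2 s)).
change (F1 t + F2 t - (S (i :: u) s t * S (j :: w) s t + F1 s + F2 s) = 0) in Hc.
by move: Hc; set q := _ * _; lra.
Qed.

End Signature.

(** * Drivers of bounded variation *)

Section Subinterval.
Context {R : realType}.
Implicit Types (s t a b : R).

Lemma is_control_sub om s t a b : s <= a -> b <= t -> is_control om s t -> is_control om a b.
Proof.
move=> sa bt omC; split=> [u v au uv vb|u v x au uv vx xb].
  by apply: (control_ge0 omC) => //; [exact: le_trans au|exact: le_trans bt].
by apply: (controlD omC) => //; [exact: le_trans au|exact: le_trans bt].
Qed.

Lemma is_controlZ om s t (k : R) : 0 <= k -> is_control om s t ->
  is_control (fun u v => k * om u v) s t.
Proof.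
move=> k0 omC; split=> [u v su uv vt|u v x su uv vx xt].
  by rewrite mulr_ge0// (control_ge0 omC).
by rewrite -mulrDr ler_wpM2l// (controlD omC).
Qed.

Lemma is_increment_sub d (p : 'I_d -> R) Z s t a b : s <= a -> b <= t ->
  is_increment p Z s t -> is_increment p Z a b.
Proof.
move=> sa bt ZI; split=> [u v au uv vb|u v x au uv vx xb|u w au ub].
- by apply: (increment_G ZI) => //; [exact: le_trans au|exact: le_trans bt].
- by apply: (increment_chen ZI) => //; [exact: le_trans au|exact: le_trans bt].
- by apply: (increment_id ZI) => //; [exact: le_trans au|exact: le_trans bt].
Qed.

End Subinterval.

Section PvarDomination.
Context {R : realType}.
Implicit Types (s t u v q : R) (P : seq R) (A F : R -> R -> R).

Lemma psum_le_linear F F1 F2 (c1 c2 : R) s t P : itv_partition s t P ->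
  (forall u v, s <= u -> u <= v -> v <= t -> F u v <= c1 * F1 u v + c2 * F2 u v) ->
  psum F s P <= c1 * psum F1 s P + c2 * psum F2 s P.
Proof.
elim: P s => [|x P IH] s Pp FF; first by rewrite /= !mulr0 addr0.
have [/= /andP[sx xP] lastP] := Pp.
have Pp' : itv_partition x t P by [].
have xt := itv_partition_le Pp'.
have h1 := FF s x (lexx _) (ltW sx) xt.
have h2 : psum F x P <= c1 * psum F1 x P + c2 * psum F2 x P.
  by apply: IH => // u v xu; apply: FF; exact: le_trans (ltW sx) xu.
by rewrite /= !mulrDr addrACA; exact: lerD.
Qed.

Lemma psum_fine F om (c de : R) s t P : 0 <= c -> is_control om s t ->
  (forall u v, s <= u -> u <= v -> v <= t -> v - u < de -> F u v <= c * om u v) ->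
  itv_partition s t P -> path (fun x y => y - x < de) s P ->
  psum F s P <= c * om s t.
Proof.
move=> c0 omC FF Pp Pd; elim: P s omC FF Pp Pd => [|x P IH] s omC FF Pp.
  by move=> _; rewrite mulr_ge0// (control_ge0 omC)//; exact: itv_partition_le Pp.
have [/= /andP[sx xP] lastP] := Pp.
have Pp' : itv_partition x t P by [].
have xt := itv_partition_le Pp'; have sx' := ltW sx.
move=> /andP[xd Pd].
apply: (@le_trans _ _ (c * (om s x + om x t))).
  rewrite mulrDr lerD ?FF//; apply: IH => //.
    split=> [u v xu|u v z xu]; first by apply: (control_ge0 omC); exact: le_trans xu.
    by apply: (controlD omC); exact: le_trans xu.
  by move=> u v xu; apply: FF; exact: le_trans xu.
by rewrite ler_wpM2l// (controlD omC).
Qed.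

Lemma pvar_dom q q1 q2 A A1 A2 (c1 c2 : R) s t : s <= t -> 0 <= c1 -> 0 <= c2 ->
  (pvar q1 A1 s t < +oo)%E -> (pvar q2 A2 s t < +oo)%E ->
  (forall u v, s <= u -> u <= v -> v <= t ->
     `|A u v| `^ q <= c1 * `|A1 u v| `^ q1 + c2 * `|A2 u v| `^ q2) ->
  (pvar q A s t < +oo)%E /\ vr q A s t <= c1 * vr q1 A1 s t + c2 * vr q2 A2 s t.
Proof.
move=> st c10 c20 fin1 fin2 AA.
have PP P : itv_partition s t P ->
    psum (fun u v => `|A u v| `^ q) s P <= c1 * vr q1 A1 s t + c2 * vr q2 A2 s t.
  move=> Pp; apply: le_trans (psum_le_linear Pp AA) _.
  by rewrite lerD// ler_wpM2l// le_vr.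
have fin : (pvar q A s t < +oo)%E by apply: le_lt_trans (pvar_le PP) _; rewrite ltry.
by split=> //; exact: vr_le.
Qed.

Lemma powR_normD (a b q : R) : 0 < q ->
  `|a + b| `^ q <= 2 `^ q * `|a| `^ q + 2 `^ q * `|b| `^ q.
Proof.
move=> q0; wlog ab : a b / `|a| <= `|b|.
  move=> W; have [/W//|/ltW/W] := leP `|a| `|b|.
  by rewrite addrC [leRHS]addrC.
apply: (@le_trans _ _ (2 `^ q * `|b| `^ q)); last first.
  by rewrite lerDr mulr_ge0 ?powR_ge0.
rewrite -powRM// ge0_ler_powR ?nnegrE ?(ltW q0) ?mulr_ge0//.
by rewrite (le_trans (ler_normD _ _))// mulr_natl mulr2n lerD2r.
Qed.

End PvarDomination.

Section WordControl.
Context {R : realType} {d : nat}.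
Variables (p : 'I_d -> R) (W : seq (seq 'I_d)).
Hypothesis W_gt0 : forall w, w \in W -> 0 < wlen p w.
Implicit Types A : R -> R -> seq 'I_d -> R.

(** With W enumerating the words of length at most 1 and A the rescaled increments, this is the
    real-valued form of the control in the theorem. *)
Definition word_control A (u v : R) : R :=
  \sum_(w <- W) vr (wlen p w)^-1 (fun a b => A a b w) u v.

Lemma word_controlP A s t :
  (forall w, w \in W -> (pvar (wlen p w)^-1 (fun a b => A a b w) s t < +oo)%E) ->
  is_control (word_control A) s t.
Proof.
move=> fin; split=> [u v su uv vt|u v x su uv vx xt].
  by apply: sumr_ge0 => w _; exact: vr_ge0.
rewrite /word_control -big_split/=; apply: ler_sum_seq => w wW.
apply: vrD => //; apply: le_lt_trans (fin w wW).
by apply: pvar_mono => //; exact: le_trans vx.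
Qed.

Lemma le_word_control A u v w : w \in W -> u <= v ->
  (pvar (wlen p w)^-1 (fun a b => A a b w) u v < +oo)%E -> A u u w = 0 ->
  `|A u v w| <= word_control A u v `^ wlen p w.
Proof.
move=> wW + fin Auu; rewrite le_eqVlt => /predU1P[<-|uv].
  by rewrite Auu normr0 powR_ge0.
have w0 := W_gt0 wW.
have := norm_le_vr _ uv fin; rewrite invr_gt0 invrK => /(_ w0)/le_trans; apply.
have v0 w' : 0 <= vr (wlen p w')^-1 (fun a b => A a b w') u v by rewrite vr_ge0// ltW.
rewrite ge0_ler_powR ?nnegrE ?(ltW w0)//; first by rewrite sumr_ge0.
rewrite /word_control (big_rem w)//= lerDl sumr_ge0//.
Qed.

End WordControl.

Section VectorFields.
Context {R : realType} {d n : nat}.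
Variables (p : 'I_d -> R) (f : 'I_d -> 'rV[R]_n -> 'rV[R]_n) (M : 'I_d -> R).
Hypothesis d_gt0 : (0 < d)%N.
Hypothesis p_ge1 : forall i, 1 <= p i.
Hypothesis fJ : forall i, jet_bound (jet_order p i) (M i) (f i).
Hypothesis M_ge0 : forall i, 0 <= M i.
Implicit Types w : seq 'I_d.

Let admP w a : wlen p (rcons w a) <= 1 -> adm p (pmax p) (theta p) a (size (@nil 'rV[R]_n)) w.
Proof.
move=> w1; rewrite /adm mul0r addr0 -wlen_rcons wlen_lt_theta//.
Qed.

Lemma Fw_continuous w : wlen p w <= 1 -> continuous (Fw f w).
Proof.
case/lastP: w => [|w a] w1 x; first exact: cvg_id.
rewrite Fw_rcons; apply: differentiable_continuous.
apply: (Tw_differentiable (p_gt0 p_ge1) (pmax_gt0 d_gt0 p_ge1) (@le_pmax R d p)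
  (theta_le_jet d_gt0 p_ge1) fJ x (admP w1)).
Qed.

Lemma Fw_le w x : wlen p w <= 1 -> w != [::] ->
  enorm (Fw f w x) <= 2 ^+ (size w ^ 2) * Mw M w.
Proof.
case/lastP: w => [|w a] w1 // _; rewrite Fw_rcons.
have := Tw_le (p_gt0 p_ge1) (pmax_gt0 d_gt0 p_ge1) (@le_pmax R d p)
  (theta_le_jet d_gt0 p_ge1) fJ M_ge0 x (admP w1).
move=> /le_trans; apply; rewrite big_nil mulr1 Mw_rcons.
rewrite [M a * _]mulrC ler_wpM2r ?mulr_ge0 ?Mw_ge0//.
by rewrite ler_eXn2l ?ltr1n// size_rcons leq_sqr.
Qed.

End VectorFields.

Lemma within_ucont_real (R : realType) (T : R) (g : R -> R) :
  {within `[0, T], continuous g} -> ucont T g.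
Proof.
move=> gc e e0; have [de de0 deP] := within_ucont gc e0.
by exists de => // s t s0 t0 st; apply/ltW/deP.
Qed.

Section BoundedVariation.
Context {R : realType} {d : nat}.
Variables (T : R) (x : R -> 'rV[R]_d).
Hypothesis T0 : 0 <= T.

(** The sum of the total variations of the coordinates controls all of them at once. For T = 0 any
    constant will do. *)
Lemma bv_control : continuous_BV T x ->
  exists2 v : R -> R, forall i, ctrl T (fun t => x t 0 i) v & ucont T v.
Proof.
move=> xBV; move: T0; rewrite le_eqVlt => /predU1P[T00|Tpos].
  exists (fun=> 0) => [i s t s0 st|e e0].
    by rewrite -T00 => t0; rewrite (_ : t = s) ?subrr ?normr0//; lra.
  by exists 1 => // s t _ _ _; rewrite subrr normr0 ltW.
pose v i t := fine (total_variation 0 t (fun r => x r 0 i)).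
have fin i s t : 0 <= s -> s <= t -> t <= T ->
    total_variation s t (fun r => x r 0 i) \is a fin_num.
  move=> s0 st tT; have [_ /(bounded_variationP _ T0)] := xBV i.
  rewrite (total_variationD _ s0 (le_trans st tT)) (total_variationD _ st tT).
  by rewrite !fin_numD => /andP[_ /andP[]].
have vi i s t : 0 <= s -> s <= t -> t <= T ->
    v i t - v i s = fine (total_variation s t (fun r => x r 0 i)).
  move=> s0 st tT; rewrite /v (total_variationD _ s0 st) fineD ?fin//.
    by rewrite addrC addrA addNr add0r.
  exact: le_trans tT.
have vi0 i s t : 0 <= s -> s <= t -> t <= T -> 0 <= v i t - v i s.
  by move=> s0 st tT; rewrite vi// fine_ge0// total_variation_ge0.
exists (fun t => \sum_i v i t) => [i s t s0 st tT|].
  rewrite -sumrB (bigD1 i)//=; apply: (@le_trans _ _ (v i t - v i s)).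
    by rewrite vi// -lee_fin fineK ?fin// total_variation_ge.
  by rewrite lerDl sumr_ge0// => j _; exact: vi0.
apply: within_ucont_real => t.
have -> : (fun t => \sum_i v i t) = \sum_i v i.
  by apply/funext => r; rewrite fct_sumE.
elim/big_ind : _ => [|g h gc hc|i _]; first exact: cvg_cst.
  exact: cvgD.
have [xc xb] := xBV i; exact: (total_variation_continuous Tpos xc xb).
Qed.

End BoundedVariation.

Section SmoothEquation.
Context {R : realType} {d n : nat}.
Variables (p : 'I_d -> R) (f : 'I_d -> 'rV[R]_n -> 'rV[R]_n) (M : 'I_d -> R).
Variables (T : R) (x : R -> 'rV[R]_d) (xi : 'rV[R]_n) (y : R -> 'rV[R]_n).
Hypothesis d_gt0 : (0 < d)%N.
Hypothesis p_ge1 : forall i, 1 <= p i.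
Hypothesis fJ : forall i, jet_bound (jet_order p i) (M i) (f i).
Hypothesis M_ge0 : forall i, 0 <= M i.
Hypothesis T0 : 0 <= T.
Hypothesis xBV : continuous_BV T x.
Hypothesis yS : ode_solution T f x xi y.
Local Notation Z := (fun u v w => signature x w u v).

Lemma signature_increment : is_increment p Z 0 T.
Proof.
have [v xv vu] := bv_control T0 xBV.
split=> [s t s0 st tT|s u t s0 su ut tT w _|u w u0 uT].
- by split=> // w1 w2 _; rewrite (sig_shuffle xv vu).
- exact: (sig_chen xv vu).
- case: w => [|i w]; first by [].
  by rewrite (sigxx xv vu).
Qed.

(** Single letters give the first-order part of the equation, longer words are of order at least two
    in the variation of x. All single letters are present because p_i >= 1. *)
Lemma letter_words : exists W : seq (seq 'I_d),
  [/\ uniq W, words p = [set` W] & forall (E : nmodType) (G : seq 'I_d -> E),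
   \sum_(w <- W) G w = \sum_(i < d) G [:: i] + \sum_(w <- W | (size w != 1)%N) G w].
Proof.
have [Ws [uW WP wE]] := short_words p_ge1.
exists [seq v <- Ws | v != [::]]; split=> [||E G]; [exact: filter_uniq|by []|].
rewrite (bigID (fun w => size w == 1)%N)/=; congr (_ + _).
rewrite -[LHS]big_filter -[RHS](big_map (fun i => [:: i]) xpredT G).
apply: perm_big; apply: uniq_perm.
- by rewrite !filter_uniq.
- by rewrite map_inj_uniq ?index_enum_uniq// => i j [].
move=> w; rewrite !mem_filter WP; apply/idP/mapP => [|[i _ ->]/=].
  by case: w => [|i [|//]]// _; exists i => //; rewrite mem_index_enum.
by rewrite wlen_cons wlen_nil addr0 invf_le1 ?(p_gt0 p_ge1)// p_ge1.
Qed.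

(** The increment of y differs from the sum of f_i(y_a) times the increment of x^i by o(dv), since y
    is a sum of Stieltjes integrals; a longer word contributes O(dv^2) by the bound on the
    signature. *)
Lemma bv_remainder_local : exists2 v, is_control (fun a b => v b - v a) 0 T &
  forall e : R, 0 < e -> exists2 de : R, 0 < de & forall a b, 0 <= a -> a <= b -> b <= T -> b - a < de ->
    enorm (remainder p f Z y a b) <= e * (v b - v a).
Proof.
have [v xv vu] := bv_control T0 xBV.
have mono a b : 0 <= a -> a <= b -> b <= T -> v a <= v b.
  exact: (ctrl_mono (xv (Ordinal d_gt0))).
exists v.
  by split=> [a b a0 ab bT|a b c a0 ab bc cT]; [rewrite subr_ge0 mono|rewrite addrC subrKA].
move=> e e0; have [W [uW wE sumW]] := letter_words.
have [yc yE] := yS.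
have Fw1 i : Fw f [:: i] = f i by rewrite (Fw_rcons f [::] i).
have fc i j : ucont T (fun t => f i (y t) 0 j).
  apply: within_ucont_real; apply/subspace_continuousP => t tT.
  have /subspace_continuousP/(_ t tT) yt := yc.
  have w1 : wlen p [:: i] <= 1.
    by rewrite wlen_cons wlen_nil addr0 invf_le1 ?(p_gt0 p_ge1)// p_ge1.
  have fic : {for y t, continuous (fun z => f i z 0 j)}.
    have := Fw_continuous d_gt0 p_ge1 fJ w1 (x := y t); rewrite Fw1 => fic.
    by apply: (cvg_comp (f i) (fun z : 'rV[R]_n => z 0 j) fic); exact: coord_continuous.
  exact: (cvg_comp y (fun z => f i z 0 j) yt fic).
have /choice[Ph PhP] : forall ij : 'I_d * 'I_n, exists Ph,
    prim T (fun t => f ij.1 (y t) 0 ij.2) (fun t => x t 0 ij.1) v Ph.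
  by move=> [i j]; apply: prim_exists => //=.
have yD a b j : 0 <= a -> a <= b -> b <= T ->
    y b 0 j - y a 0 j = \sum_i (Ph (i, j) b - Ph (i, j) a).
  move=> a0 ab bT; have b0 := le_trans a0 ab; have aT := le_trans ab bT.
  have yt t : 0 <= t -> t <= T -> y t 0 j = xi 0 j + \sum_i (Ph (i, j) t - Ph (i, j) 0).
    move=> t0 tT; rewrite yE ?t0//; congr (_ + _); apply: eq_bigr => i _.
    exact: (RS_prim (xv i) (PhP (i, j))).
  rewrite !yt// opprD addrACA subrr add0r -sumrB; apply: eq_bigr => i _.
  by rewrite opprB addrA subrK.
pose B := \sum_(w <- W) 2 ^+ (size w ^ 2) * Mw M w.
have B0 : 0 <= B by apply: sumr_ge0 => w _; rewrite mulr_ge0 ?Mw_ge0.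
(* The budget: one share for each coordinate and each letter, and B shares for the longer words. *)
pose e1 := e / ((n * d)%:R + B + 1).
have D0 : 0 < (n * d)%:R + B + 1 by rewrite ltr_wpDl// addr_ge0.
have e10 : 0 < e1 by rewrite divr_gt0.
have /choice[de' de'P] : forall ij : 'I_d * 'I_n, exists de, 0 < de /\
    forall s c t, 0 <= s -> s <= c -> c <= t -> t <= T -> t - s < de ->
    `|Ph ij t - Ph ij s - f ij.1 (y c) 0 ij.2 * (x t 0 ij.1 - x s 0 ij.1)| <= e1 * (v t - v s).
  by move=> ij; have [de de0 deP] := PhP ij _ e10; exists de.
have [dv dv0 dvP] : exists2 dv, 0 < dv & forall a b, 0 <= a -> a <= b -> b <= T -> b - a < dv ->
    v b - v a <= Num.min 1 e1.
  have m0 : 0 < Num.min 1 e1 by rewrite lt_min ltr01.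
  have [dv dv0 dvP] := vu _ m0; exists dv => // a b a0 ab bT abd.
  have := dvP a b; rewrite a0 bT (le_trans ab bT) (le_trans a0 ab) => /(_ isT isT).
  rewrite distrC ger0_norm ?subr_ge0// => /(_ abd).
  by rewrite distrC ger0_norm ?subr_ge0// mono.
pose de := \big[Num.min/dv]_(ij : 'I_d * 'I_n) de' ij.
have de0 : 0 < de by apply: lt_bigmin => // ij _; have [] := de'P ij.
exists de => // a b a0 ab bT abd.
have Dv0 : 0 <= v b - v a by rewrite subr_ge0 mono.
have abdv : b - a < dv by apply: lt_le_trans abd _; exact: bigmin_le_id.
have /(_ a b a0 ab bT abdv) := dvP; rewrite le_min => /andP[Dv1 Dve].
have -> : remainder p f Z y a b = (y b - y a - \sum_i (x b 0 i - x a 0 i) *: f i (y a))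
    - \sum_(w <- W | (size w != 1)%N) Z a b w *: Fw f w (y a).
  rewrite /remainder wE -fsbig_seq// sumW opprD addrA; congr (_ - _ - _).
  apply: eq_bigr => i _; rewrite Fw1; congr (_ *: _).
  exact: (RS_prim (xv i) (prim_const (xv i))).
have -> : e * (v b - v a) = n%:R * (d%:R * (e1 * (v b - v a))) + (B + 1) * (e1 * (v b - v a)).
  have -> : e = e1 * ((n * d)%:R + B + 1) by rewrite /e1 divfK// gt_eqF.
  by rewrite natrM; ring.
apply: le_trans (ler_enormB _ _) _; apply: lerD.
  apply: le_trans (enorm_le_norm _) _; rewrite ler_wpM2l//.
  rewrite /Num.Def.normr/= mx_normrE; apply/bigmax_leP; split=> [|[k j] _ /=].
    exact: mulr_ge0 (ler0n _ _) (mulr_ge0 (ltW e10) Dv0).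
  rewrite (ord1 k) !mxE yD// summxE -sumrB.
  apply: le_trans (ler_norm_sum _ _ _) _.
  rewrite mulr_natl -[X in _ *+ X]card_ord -sumr_const; apply: ler_sum => i _.
  rewrite mxE mulrC; have [_ /(_ a a b a0 (lexx _) ab bT)/=] := de'P (i, j).
  by apply; apply: lt_le_trans abd _; exact: bigmin_le.
apply: le_trans (ler_enorm_sum _ _ _) _.
apply: (@le_trans _ _ (B * (e1 * (v b - v a)))); last first.
  by rewrite ler_wpM2r ?lerDl// mulr_ge0// ltW.
rewrite /B mulr_suml big_mkcond/=; apply: ler_sum_seq => w wW.
have wp : words p w by rewrite wE.
move: wp => /andP[]; rewrite (wlen_gt0 p_ge1) => wn w1.
have e1v := mulr_ge0 (ltW e10) Dv0.
case: ifP => sw; last by rewrite mulr_ge0// mulr_ge0// Mw_ge0.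
rewrite enormZ [leRHS]mulrC ler_pM ?enorm_ge0// ?(Fw_le d_gt0 p_ge1 fJ M_ge0)//.
apply: le_trans (sig_le xv vu w a0 ab bT) _.
case: w wn sw {wW w1} => [//|i [//|j w]] _ _.
rewrite !exprS mulrCA [e1 * _]mulrC ler_wpM2l//.
apply: le_trans Dve; rewrite -[leRHS]mulr1 ler_wpM2l//.
by rewrite exprn_ile1.
Qed.

Lemma bv_remainder_small s t e : 0 <= s -> s <= t -> t <= T -> 0 < e ->
  exists2 P, itv_partition s t P &
    psum (fun u v => enorm (remainder p f Z y u v)) s P <= e.
Proof.
move=> s0 st tT e0; have [v vC vP] := bv_remainder_local.
have vst : 0 <= v t - v s by apply: (control_ge0 vC).
have D0 : 0 < v t - v s + 1 by rewrite ltr_wpDl.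
have e10 : 0 < e / (v t - v s + 1) by rewrite divr_gt0.
have [de de0 deP] := vP _ e10; have [P Pp Pd] := fine_partition de0 st.
exists P => //.
apply: le_trans (psum_fine (ltW e10) (is_control_sub s0 tT vC) _ Pp Pd) _ => [a b sa ab bt|].
  by apply: deP => //; [exact: le_trans sa|exact: le_trans tT].
by rewrite mulrC ler_pdivD1 ?(ltW e0).
Qed.

End SmoothEquation.

Lemma uniform_pointwise (R : realType) (n : nat) (T : R) (ym : nat -> R -> 'rV[R]_n) y t :
  {uniform `[0, T], ym @ \oo --> y} -> 0 <= t <= T -> ym m t @[m --> \oo] --> y t.
Proof.
move=> yu tT; apply/cvgrPdist_lt => e e0.
have /yu : nbhs (y : {uniform` `[0, T]%classic -> 'rV[R]_n})
    [set h | forall s, `[0, T]%classic s -> `|y s - h s| < e].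
  apply/uniform_nbhs; exists [set xy | ball xy.1 e xy.2]; split.
    exact: (entourage_ball ('rV[R]_n : pseudoMetricType R) (PosNum e0)).
  by move=> h /= hP s /hP; rewrite -ball_normE.
case=> N0 _ N0P; exists N0 => // m /N0P /= /(_ t); apply.
by rewrite /= in_itv.
Qed.

Lemma vr_mono (R : realType) (q : R) A s u v t : s <= u -> u <= v -> v <= t ->
  (pvar q A s t < +oo)%E -> vr q A u v <= vr q A s t.
Proof.
move=> su uv vt fin; have st := le_trans su (le_trans uv vt).
have fuv : (pvar q A u v < +oo)%E by apply: le_lt_trans fin; exact: pvar_mono.
by rewrite -lee_fin -!vrE//; exact: pvar_mono.
Qed.

(** For m = [Mw M], with M the Lip norms, these are the increments of the rescaled path. *)
Definition wscale (R : realType) (d : nat) (m : seq 'I_d -> R)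
  (Z : R -> R -> seq 'I_d -> R) (s t : R) (w : seq 'I_d) : R := m w * Z s t w.

(** * Rough drivers *)

Section RoughPaths.
Context {R : realType} {d : nat}.
Variables (p : 'I_d -> R) (T : R) (X : R -> seq 'I_d -> R).
Hypothesis p_ge1 : forall i, 1 <= p i.
Hypothesis T0 : 0 <= T.
Hypothesis Xw : weakly_geometric p T X.
Implicit Types w : seq 'I_d.

Lemma rough_nil t : 0 <= t -> t <= T -> X t [::] = 1.
Proof. by move=> t0 tT; have [XG _ _] := Xw; have [] := XG t ltac:(by rewrite t0). Qed.

Lemma rough_increment : is_increment p (incr X) 0 T.
Proof.
have [XG _ _] := Xw; split=> [s t s0 st tT|s u t s0 su ut tT w _|u w u0 uT].
- apply: incr_in_G (p_gt0 p_ge1) (XG _ _) (XG _ _).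
    by rewrite s0 (le_trans st).
  by rewrite (le_trans s0).
- by apply: incr_chen; apply: rough_nil; [exact: le_trans su|exact: le_trans ut tT].
- by apply: incrxx; exact: rough_nil.
Qed.

Lemma rough_bounded w : wlen p w <= 1 ->
  exists B, forall t, 0 <= t -> t <= T -> `|X t w| <= B.
Proof.
move=> w1; have [_ /(_ w w1) Xc _] := Xw.
have [b _ bP] := EVT_max T0 Xc; have [a _ aP] := EVT_min T0 Xc.
exists (Num.max `|X a w| `|X b w|) => t t0 tT.
have tI : t \in `[0, T] by rewrite in_itv/= t0.
have h1 := aP t tI; have h2 := bP t tI.
rewrite le_max; have [Xt0|Xt0] := leP 0 (X t w).
  by rewrite (ger0_norm Xt0) (le_trans h2 (ler_norm _)) orbT.
rewrite (ltr0_norm Xt0); apply/orP; left.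
by rewrite -normrN (le_trans _ (ler_norm _))// lerN2.
Qed.

(** The relation X_t = X_s X_{s,t} at the word gives X_{s,t} as the difference X_t - X_s minus
    products of bounded values of X_s with increments over shorter words; continuity of X settles
    the former, induction the latter. *)
Lemma incr_small w e : wlen p w <= 1 -> w != [::] -> 0 < e ->
  exists2 de, 0 < de & forall s t, 0 <= s -> s <= t -> t <= T -> t - s < de ->
    `|incr X s t w| <= e.
Proof.
elim: {w}(size w) {-2}w (leqnn (size w)) e => [|m IH] w.
  by rewrite leqn0 size_eq0 => -> e.
case: w => [//|i w]; rewrite /= ltnS => wm e iw1 _ e0.
have [_ /(_ _ iw1) /within_ucont Xc _] := Xw.
have p0 := p_gt0 p_ge1.
have kw (k : 'I_(size w)) : wlen p (take k.+1 (i :: w)) <= 1 /\ wlen p (drop k.+1 (i :: w)) <= 1.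
  move: iw1; rewrite -{1}(cat_take_drop k.+1 (i :: w)) wlen_cat => kw.
  by split; apply: le_trans kw; rewrite ?lerDl ?lerDr wlen_ge0.
have /choice[B BP] : forall k : 'I_(size w), exists B, forall t, 0 <= t -> t <= T ->
    `|X t (take k.+1 (i :: w))| <= B.
  by move=> k; have [k1 _] := kw k; exact: rough_bounded.
have e20 : 0 < e / 2 by rewrite divr_gt0.
pose D := \sum_k `|B k| + 1.
have D0 : 0 < D by rewrite ltr_wpDl// sumr_ge0.
have e3 : 0 < e / 2 / D by rewrite divr_gt0.
have /choice[de deP] : forall k : 'I_(size w), exists de, 0 < de /\
    forall s t, 0 <= s -> s <= t -> t <= T -> t - s < de ->
    `|incr X s t (drop k.+1 (i :: w))| <= e / 2 / D.
  move=> k; have [_ k2] := kw k.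
  have [] := IH (drop k w) _ _ k2 _ e3.
  - by rewrite size_drop (leq_trans (leq_subr _ _)).
  - by rewrite -size_eq0 size_drop subn_eq0 -ltnNge.
  by move=> de de0 deP; exists de.
have [d1 d10 d1P] := Xc _ e20.
exists (\big[Num.min/d1]_k de k).
  by apply: lt_bigmin => // k _; have [] := deP k.
move=> s t s0 st tT std.
have t0 := le_trans s0 st; have sT := le_trans st tT.
have : X t (i :: w) = incr X s t (i :: w) + (\sum_(k < size w)
    X s (take k.+1 (i :: w)) * incr X s t (drop k.+1 (i :: w)) + X s (i :: w)).
  rewrite -{1}(@gmulVK _ _ (X s) (X t)) ?rough_nil// -/(incr X s t) {1}/gmul.
  rewrite big_ord_recl [take _ _]take0 rough_nil//.
  rewrite drop0 mul1r; congr (_ + _); rewrite big_ord_recr; congr (_ + _).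
  by rewrite take_oversize// drop_oversize// incr_nil ?mulr1// rough_nil.
move=> XE; have -> : incr X s t (i :: w) = (X t (i :: w) - X s (i :: w)) - \sum_(k < size w)
    X s (take k.+1 (i :: w)) * incr X s t (drop k.+1 (i :: w)).
  by rewrite XE; ring.
apply: le_trans (ler_normB _ _) _; rewrite (splitr e); apply: lerD.
  rewrite distrC ltW// d1P ?s0 ?t0// distrC ger0_norm ?subr_ge0//.
  by apply: lt_le_trans std _; exact: bigmin_le_id.
apply: le_trans (ler_norm_sum _ _ _) _.
apply: (@le_trans _ _ (\sum_k `|B k| * (e / 2 / D))).
  apply: ler_sum => k _; rewrite normrM ler_pM//.
    by rewrite (le_trans (BP k s s0 sT))// ler_norm.
  have [_] := deP k; apply => //; apply: lt_le_trans std _; exact: bigmin_le.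
by rewrite -mulr_suml ler_pdivD1 ?(ltW e20)// sumr_ge0.
Qed.

Lemma rough_pvar w : words p w ->
  (pvar (wlen p w)^-1 (fun u v => incr X u v w) 0 T < +oo)%E.
Proof.
move=> ww; have [_ _] := Xw; rewrite /omega.
have [Ws [uW WP wE]] := short_words p_ge1.
rewrite wE in ww; rewrite wE -fsbig_seq ?filter_uniq// (big_rem w)//=.
apply: le_lt_trans; rewrite leeDl// sume_ge0// => v _; exact: pvar_ge0.
Qed.

Section LargerExponents.
Variables (q : 'I_d -> R) (m : seq 'I_d -> R).
Hypothesis pq : forall i, p i < q i.

Lemma wlen_lt w : w != [::] -> wlen q w < wlen p w.
Proof.
have p0 := p_gt0 p_ge1; have q0 i : 0 < q i by exact: lt_trans (pq i).
have le1 i : (q i)^-1 < (p i)^-1 by rewrite ltf_pV2 ?posrE.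
case: w => // i w _; rewrite !wlen_cons ltr_leD//.
by elim: w => [|j w IH]; rewrite ?wlen_nil// !wlen_cons lerD// ltW.
Qed.

Lemma larger_exponent w : words p w ->
  [/\ w != [::], 0 < wlen q w, 0 < wlen p w & 0 < (wlen q w)^-1 - (wlen p w)^-1].
Proof.
move=> /andP[lp _]; have wn : w != [::] by rewrite -(wlen_gt0 p_ge1).
have q_ge1 i : 1 <= q i by exact: le_trans (p_ge1 i) (ltW (pq i)).
have lq : 0 < wlen q w by rewrite wlen_gt0.
by split=> //; rewrite subr_gt0 ltf_pV2 ?posrE// wlen_lt.
Qed.

(** Interpolation: writing |a|^(1/|w|') as |a|^(1/|w|' - 1/|w|) |a|^(1/|w|), the first factor has a
    positive exponent and is bounded by means of B. As B is small on short intervals, so is the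
    variation for the larger exponents. *)
Lemma larger_pvar w s t B : words p w -> 0 <= s -> s <= t -> t <= T -> 0 <= B ->
  (forall a b, s <= a -> a <= b -> b <= t -> `|incr X a b w| <= B) ->
  (pvar (wlen q w)^-1 (fun a b => wscale m (incr X) a b w) s t < +oo)%E /\
  vr (wlen q w)^-1 (fun a b => wscale m (incr X) a b w) s t <=
    `|m w| `^ (wlen q w)^-1 * B `^ ((wlen q w)^-1 - (wlen p w)^-1) *
     vr (wlen p w)^-1 (fun a b => incr X a b w) 0 T.
Proof.
move=> ww s0 st tT B0 BP.
have [wn lq lp qp] := larger_exponent ww.
set c := _ * _ `^ _; have c0 : 0 <= c by rewrite mulr_ge0 ?powR_ge0.
have fin0 := rough_pvar ww.
have fin : (pvar (wlen p w)^-1 (fun u v => incr X u v w) s t < +oo)%E.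
  by apply: le_lt_trans fin0; exact: pvar_mono.
have [|f1 f2] := @pvar_dom R (wlen q w)^-1 _ _ (fun a b => wscale m (incr X) a b w) _ _ c 0 s t st c0
    (lexx 0) fin fin.
  move=> u v su uv vt; rewrite mul0r addr0 /wscale normrM powRM// /c -mulrA ler_wpM2l ?powR_ge0//.
  rewrite -{1}((subrK (wlen p w)^-1 (wlen q w)^-1)) powRD; last first.
    by rewrite subrK gt_eqF// invr_gt0.
  rewrite ler_wpM2r ?powR_ge0// ge0_ler_powR ?nnegrE ?(ltW qp)//.
  exact: BP.
split=> //; apply: le_trans f2 _; rewrite mul0r addr0 ler_wpM2l//.
exact: vr_mono.
Qed.

Lemma larger_pvar_fin w : words p w ->
  (pvar (wlen q w)^-1 (fun a b => wscale m (incr X) a b w) 0 T < +oo)%E.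
Proof.
move=> ww; have fin := rough_pvar ww.
pose B := vr (wlen p w)^-1 (fun u v => incr X u v w) 0 T `^ (wlen p w).
have [wn _ lp _] := larger_exponent ww.
have [] // := larger_pvar (B := B) ww (lexx 0) T0 (lexx T) (powR_ge0 _ _).
move=> a b a0; rewrite le_eqVlt => /predU1P[<- aT|ab bT].
  by rewrite (increment_id rough_increment)// /gone (negbTE wn) normr0 powR_ge0.
have fab : (pvar (wlen p w)^-1 (fun u v => incr X u v w) a b < +oo)%E.
  by apply: le_lt_trans fin; apply: pvar_mono => //; exact: ltW.
have := norm_le_vr _ ab fab; rewrite invr_gt0 invrK => /(_ lp)/le_trans; apply.
rewrite ge0_ler_powR ?nnegrE ?(ltW lp) ?vr_ge0 ?(ltW ab)//.
exact: vr_mono (ltW ab) bT fin.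
Qed.

Lemma larger_pvar_small w e : words p w -> 0 < e -> exists2 de, 0 < de &
  forall s t, 0 <= s -> s <= t -> t <= T -> t - s < de ->
  vr (wlen q w)^-1 (fun a b => wscale m (incr X) a b w) s t <= e.
Proof.
move=> ww e0; have [wn lq lp qp] := larger_exponent ww.
have w1 : wlen p w <= 1 by move: ww => /andP[].
pose V := `|m w| `^ (wlen q w)^-1 * vr (wlen p w)^-1 (fun a b => incr X a b w) 0 T.
have V0 : 0 <= V by rewrite mulr_ge0 ?powR_ge0 ?vr_ge0.
have V1 : 0 < V + 1 by rewrite ltr_wpDl.
(* Makes the interpolated bound equal to V e / (V + 1). *)
pose B := (e / (V + 1)) `^ ((wlen q w)^-1 - (wlen p w)^-1)^-1.
have B0 : 0 < B by rewrite powR_gt0// divr_gt0.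
have [de de0 deP] := incr_small w1 wn B0; exists de => // s t s0 st tT std.
have [|_ h] := larger_pvar ww s0 st tT (ltW B0).
  move=> a b sa ab bt; apply: deP => //; [exact: le_trans sa|exact: le_trans tT|].
  by apply: le_lt_trans std; rewrite lerB.
apply: le_trans h _; rewrite /B -powRrM mulVf ?gt_eqF// powRr1 ?divr_ge0 ?(ltW e0) ?(ltW V1)//.
by rewrite mulrAC -/V ler_pdivD1 ?(ltW e0).
Qed.

End LargerExponents.

End RoughPaths.

Section Approximation.
Context {R : realType} {d n : nat}.
Variables (p q : 'I_d -> R) (T : R) (X : R -> seq 'I_d -> R).
Variables (f : 'I_d -> 'rV[R]_n -> 'rV[R]_n) (M : 'I_d -> R) (xi : 'rV[R]_n).
Variables (x : nat -> R -> 'rV[R]_d) (ym : nat -> R -> 'rV[R]_n) (y : R -> 'rV[R]_n).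
Hypothesis d_gt0 : (0 < d)%N.
Hypothesis p_ge1 : forall i, 1 <= p i.
Hypothesis T0 : 0 <= T.
Hypothesis Xw : weakly_geometric p T X.
Hypothesis pq : forall i, p i < q i.
Hypothesis pq1 : forall w, (wlen q w <= 1) = (wlen p w <= 1).
Hypothesis fJ : forall i, jet_bound (jet_order q i) (M i) (f i).
Hypothesis M_ge0 : forall i, 0 <= M i.
Hypothesis xBV : forall m, continuous_BV T (x m).
Hypothesis xX : forall w, words p w -> pvar (wlen q w)^-1
  (fun s t => signature (x m) w s t - incr X s t w) 0 T @[m --> \oo] --> 0%E.
Hypothesis ymS : forall m, ode_solution T f (x m) xi (ym m).
Hypothesis ymy : {uniform `[0, T], ym @ \oo --> y}.
Local Notation Z m := (fun u v w => signature (x m) w u v).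
Local Notation D m w := (fun s t => signature (x m) w s t - incr X s t w).

Let q_ge1 i : 1 <= q i. Proof. exact: le_trans (p_ge1 i) (ltW (pq i)). Qed.

Lemma words_eq : words q = words p.
Proof. by apply/seteqP; split=> w; rewrite /words /= pq1 (wlen_gt0 q_ge1) (wlen_gt0 p_ge1). Qed.

Lemma remainder_eq Y u v : remainder q f Y y u v = remainder p f Y y u v.
Proof. by rewrite /remainder words_eq. Qed.

(** Convergence to 0 in the extended reals includes eventual finiteness; as there are finitely many
    words, one rank N serves them all. *)
Lemma approx_pvar (W : seq (seq 'I_d)) e : words p = [set` W] -> 0 < e ->
  exists N, forall m, (N <= m)%N -> forall w, w \in W ->
  (pvar (wlen q w)^-1 (D m w) 0 T < +oo)%E /\ vr (wlen q w)^-1 (D m w) 0 T <= e.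
Proof.
move=> wE e0; suff : forall W' : seq (seq 'I_d), {subset W' <= W} -> exists N, forall m, (N <= m)%N ->
    forall w, w \in W' ->
    (pvar (wlen q w)^-1 (D m w) 0 T < +oo)%E /\ vr (wlen q w)^-1 (D m w) 0 T <= e.
  by apply.
elim=> [_|w W' IH W'W]; first by exists 0%N.
have [w' w'W'|N0 N0P] := IH; first by apply: W'W; rewrite inE w'W' orbT.
have ww : words p w by rewrite wE /= W'W// mem_head.
have /fine_cvgP[[N1 _ N1P] /cvgrPdist_le/(_ _ e0)[N2 _ N2P]] := xX ww.
exists (maxn N0 (maxn N1 N2)) => m; rewrite !geq_max => /andP[m0 /andP[m1 m2]] w'.
rewrite inE => /predU1P[->|/N0P]; last exact.
have f0 := N1P m m1; split; first by move: f0; rewrite fin_numElt => /andP[].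
have /= := N2P m m2; rewrite sub0r normrN ger0_norm//.
by rewrite fine_ge0// pvar_ge0.
Qed.

Lemma approx_cvg s t w : 0 <= s -> s <= t -> t <= T -> words p w ->
  signature (x m) w s t @[m --> \oo] --> incr X s t w.
Proof.
move=> s0 st tT ww; apply/cvgrPdist_le => e e0.
have ww' : words q w by rewrite words_eq.
have lq : 0 < wlen q w by move: ww' => /andP[].
have e1 : 0 < e `^ (wlen q w)^-1 by rewrite powR_gt0.
have [Ws [_ _ wE]] := short_words p_ge1.
have [N NP] := approx_pvar wE e1; exists N => // m /= Nm.
have wn : w != [::] by rewrite -(wlen_gt0 q_ge1).
move: st; rewrite le_eqVlt => /predU1P[est|st].
  subst t; rewrite (increment_id (rough_increment p_ge1 Xw))//.
  by rewrite (increment_id (signature_increment q T0 (xBV m)))// subrr normr0 ltW.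
have wW : w \in [seq v <- Ws | v != [::]] by move: ww; rewrite wE.
have [fin le] := NP m Nm w wW.
have fin' : (pvar (wlen q w)^-1 (D m w) s t < +oo)%E.
  by apply: le_lt_trans fin; apply: pvar_mono => //; exact: ltW.
rewrite distrC; have := norm_le_vr _ st fin'; rewrite invr_gt0 invrK => /(_ lq)/le_trans; apply.
apply: (@le_trans _ _ ((e `^ (wlen q w)^-1) `^ wlen q w)); last first.
  by rewrite -powRrM mulVf ?gt_eqF// powRr1// ltW.
apply: (ge0_ler_powR (ltW lq)); rewrite ?nnegrE.
- exact: vr_ge0 (ltW st).
- exact: powR_ge0.
exact: le_trans (vr_mono s0 (ltW st) tT fin) le.
Qed.

(** For fixed s and t the remainder is a finite sum of continuous expressions in the increments and
    in y_s, y_t, all of which converge. *)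
Lemma approx_remainder s t e : 0 <= s -> s <= t -> t <= T -> 0 < e ->
  exists N, forall m, (N <= m)%N ->
  enorm (remainder q f (incr X) y s t) <= enorm (remainder q f (Z m) (ym m) s t) + e.
Proof.
move=> s0 st tT e0.
have t0 := le_trans s0 st; have sT := le_trans st tT.
have [Ws [uW WP wE]] := short_words p_ge1.
have ys := uniform_pointwise ymy (t := s) ltac:(by rewrite s0).
have yt := uniform_pointwise ymy (t := t) ltac:(by rewrite t0).
have cv : remainder q f (Z m) (ym m) s t @[m --> \oo] --> remainder q f (incr X) y s t.
  rewrite /remainder words_eq wE; under eq_fun do rewrite -fsbig_seq ?filter_uniq//.
  rewrite -fsbig_seq ?filter_uniq//; apply: cvgB; first exact: cvgB.
  have wW w : w \in [seq v <- Ws | v != [::]] -> words p w by rewrite wE.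
  elim: [seq v <- Ws | v != [::]] wW => [|w W IH] wW.
    by under eq_fun do rewrite big_nil; rewrite big_nil; exact: cvg_cst.
  under eq_fun do rewrite big_cons; rewrite big_cons; apply: cvgD; last first.
    by apply: IH => w' w'W; apply: wW; rewrite inE w'W orbT.
  have ww := wW w (mem_head _ _).
  apply: cvgZ; first exact: approx_cvg.
  have w1 : wlen q w <= 1 by rewrite pq1; move: ww => /andP[].
  exact: (cvg_comp (fun m => ym m s) (Fw f w) ys (@Fw_continuous _ _ _ q f M d_gt0 q_ge1 fJ w w1 (y s))).
have e1 : 0 < e / (n%:R + 1) by rewrite divr_gt0// ltr_wpDl.
move/cvgrPdist_le : cv => /(_ _ e1)[N _ NP]; exists N => m Nm.
have /= h := NP m Nm.
rewrite -{1}(subrK (remainder q f (Z m) (ym m) s t) (remainder _ _ (incr X) _ _ _)) addrC.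
apply: le_trans (ler_enormD _ _) _; rewrite lerD2l.
apply: le_trans (enorm_le_norm _) _.
apply: le_trans (ler_wpM2l (ler0n _ _) h) _.
by rewrite ler_pdivD1// ltW.
Qed.

(** The signature is the increment of X plus a small difference, and |a + b|^q <= 2^q (|a|^q +
    |b|^q). The lost factor is harmless, since the constants of the first pass are discarded. *)
Lemma approx_control (W : seq (seq 'I_d)) (mw : seq 'I_d -> R) m e s t :
  words p = [set` W] -> 0 <= e ->
  (forall w, w \in W -> (pvar (wlen q w)^-1 (D m w) 0 T < +oo)%E /\
     vr (wlen q w)^-1 (D m w) 0 T <= e) ->
  0 <= s -> s <= t -> t <= T ->
  (forall w, w \in W ->
    (pvar (wlen q w)^-1 (fun a b => wscale mw (Z m) a b w) s t < +oo)%E) /\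
  word_control q W (wscale mw (Z m)) s t <=
   (\sum_(w <- W) 2 `^ (wlen q w)^-1) * word_control q W (wscale mw (incr X)) s t +
   (\sum_(w <- W) 2 `^ (wlen q w)^-1 * `|mw w| `^ (wlen q w)^-1) * e.
Proof.
move=> wE e0 De s0 st tT.
have key w : w \in W ->
    (pvar (wlen q w)^-1 (fun a b => wscale mw (Z m) a b w) s t < +oo)%E /\
    vr (wlen q w)^-1 (fun a b => wscale mw (Z m) a b w) s t <=
    2 `^ (wlen q w)^-1 * vr (wlen q w)^-1 (fun a b => wscale mw (incr X) a b w) s t +
    2 `^ (wlen q w)^-1 * `|mw w| `^ (wlen q w)^-1 * e.
  move=> wW; have ww : words p w by rewrite wE.
  have ww' : words q w by rewrite words_eq.
  have lq : 0 < (wlen q w)^-1 by rewrite invr_gt0; move: ww' => /andP[].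
  have [Dfin De'] := De w wW.
  have Xfin := larger_pvar_fin p_ge1 T0 Xw mw pq ww.
  have sub A : (pvar (wlen q w)^-1 A 0 T < +oo)%E -> (pvar (wlen q w)^-1 A s t < +oo)%E.
    by apply: le_lt_trans; exact: pvar_mono.
  set c2 := 2 `^ _ * `|mw w| `^ _.
  have c20 : 0 <= c2 by rewrite mulr_ge0 ?powR_ge0.
  have [|f1 f2] := @pvar_dom R (wlen q w)^-1 _ _ (fun a b => wscale mw (Z m) a b w) _ _
    (2 `^ (wlen q w)^-1) c2 s t st (powR_ge0 _ _) c20 (sub _ Xfin) (sub _ Dfin).
    move=> u v _ _ _; rewrite /c2 -[X in _ + X]mulrA -[X in _ + _ * X]powRM// -normrM.
    have -> : wscale mw (Z m) u v w = wscale mw (incr X) u v w +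
        mw w * (signature (x m) w u v - incr X u v w) by rewrite /wscale; ring.
    exact: powR_normD.
  split; first exact: f1.
  apply: le_trans f2 _; rewrite lerD2l; apply: ler_wpM2l c20 _ _ _.
  exact: le_trans (vr_mono s0 st tT Dfin) De'.
split=> [w /key[]//|].
pose V w := vr (wlen q w)^-1 (fun a b => wscale mw (incr X) a b w) s t.
apply: (@le_trans _ _ (\sum_(w <- W) (2 `^ (wlen q w)^-1 * V w +
    2 `^ (wlen q w)^-1 * `|mw w| `^ (wlen q w)^-1 * e))).
  by rewrite /word_control; apply: ler_sum_seq => w /key[].
rewrite big_split/= [X in _ + X <= _](_ : _ = (\sum_(w <- W) 2 `^ (wlen q w)^-1 *
  `|mw w| `^ (wlen q w)^-1) * e); last by rewrite mulr_suml.
rewrite lerD2r mulr_suml; apply: ler_sum_seq => w wW.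
rewrite ler_wpM2l ?powR_ge0// /word_control (big_rem w)//= lerDl.
by apply: sumr_ge0 => v _; exact: vr_ge0.
Qed.

(* A and de may depend on f, X and y: all that matters is that th > 1, which makes
   the sums of remainders over fine partitions small. *)
Lemma rough_local_estimate : exists om : R -> R -> R, exists th : R,
  [/\ 1 < th, is_control om 0 T,
      forall e, 0 < e -> exists2 de, 0 < de & forall s t, 0 <= s -> s <= t -> t <= T ->
        t - s < de -> om s t <= e &
      exists2 Ad : R * R, 0 <= Ad.1 /\ 0 < Ad.2 & forall s t, 0 <= s -> s <= t -> t <= T ->
        om s t <= Ad.2 -> enorm (remainder p f (incr X) y s t) <= Ad.1 * om s t `^ th].
Proof.
have [Ws [uW WP wE]] := short_words p_ge1.
set W := [seq v <- Ws | v != [::]] in wE.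
have W_gt0 w : w \in W -> 0 < wlen q w.
  by rewrite mem_filter (wlen_gt0 q_ge1) => /andP[].
pose mw := Mw M; pose K := \sum_(w <- W) 2 `^ (wlen q w)^-1 : R.
have K0 : 0 <= K by apply: sumr_ge0 => w _; exact: powR_ge0.
pose L := \sum_(w <- W) 2 `^ (wlen q w)^-1 * `|mw w| `^ (wlen q w)^-1 : R.
have L0 : 0 <= L by apply: sumr_ge0 => w _; rewrite mulr_ge0 ?powR_ge0.
pose om0 := word_control q W (wscale mw (incr X)).
have om0C : is_control om0 0 T.
  by apply: word_controlP => w wW; apply: larger_pvar_fin => //; rewrite wE.
have omC := is_controlZ K0 om0C.
have [[A de] /= [A0 /andP[de0 de1]] AP] := local_estimate d_gt0 q_ge1.
have th1 := theta_gt1 d_gt0 q_ge1.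
exists (fun u v => K * om0 u v), (theta q); split=> //.
  move=> e e0.
  have /choice[dw dwP] : forall w, exists dw, 0 < dw /\ (w \in W ->
      forall s t, 0 <= s -> s <= t -> t <= T -> t - s < dw ->
      vr (wlen q w)^-1 (fun a b => wscale mw (incr X) a b w) s t <= e / (K * (size W)%:R + 1)).
    have D1 : 0 < K * (size W)%:R + 1 by rewrite ltr_wpDl ?mulr_ge0.
    have e1 : 0 < e / (K * (size W)%:R + 1) by rewrite divr_gt0.
    move=> w; have [wW|wW] := boolP (w \in W); last by exists 1.
    have ww : words p w by rewrite wE.
    have [dw dw0 dwP] := larger_pvar_small p_ge1 T0 Xw mw pq ww e1.
    by exists dw.
  exists (\big[Num.min/1]_(w <- W) dw w); first by apply: lt_bigmin => // w _; have [] := dwP w.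
  move=> s t s0 st tT std.
  apply: (@le_trans _ _ (K * (\sum_(w <- W) e / (K * (size W)%:R + 1)))).
    rewrite ler_wpM2l// /om0 /word_control; apply: ler_sum_seq => w wW.
    have [_ /(_ wW)] := dwP w; apply => //; apply: lt_le_trans std _.
    by apply: ge_bigmin_seq wW _.
  rewrite big_const_seq count_predT iter_addr_0 -[_ *+ _]mulr_natr.
  by rewrite mulrCA mulrC ler_pdivD1 ?(ltW e0) ?mulr_ge0.
exists (A * 2 `^ theta q + 1, de / 2); first by rewrite addr_ge0 ?mulr_ge0 ?powR_ge0// divr_gt0.
move=> s t s0 st tT /= omd.
have omst := control_ge0 omC s0 st tT.
(* For fixed s and t, m is taken large enough for an error e in the remainder and 2e in the control;
   [powR_limit] absorbs both. *)
apply: (powR_limit th1 A0 de0 de1 omst omd) => e e0 ode.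
have [N1 N1P] := approx_remainder s0 st tT e0.
have e1 : 0 < 2 * e / (L + 1) by rewrite divr_gt0 ?mulr_gt0// ltr_wpDl.
have [N2 N2P] := approx_pvar wE e1.
pose m := maxn N1 N2.
have := N1P m (leq_maxl _ _); rewrite remainder_eq => /le_trans; apply; rewrite lerD2r.
have De := N2P m (leq_maxr _ _).
have cmp u v : s <= u -> u <= v -> v <= t -> _ := fun su uv vt =>
  approx_control mw wE (ltW e1) De (le_trans s0 su) uv (le_trans vt tT).
have Le : L * (2 * e / (L + 1)) <= 2 * e.
  by rewrite ler_pdivD1// mulr_ge0// ltW.
pose omm := word_control q W (wscale mw (Z m)).
have ommC : is_control omm s t.
  by apply: word_controlP => w wW; have [/(_ w wW)] := cmp s t (lexx s) st (lexx t).
have omm_le : omm s t <= K * om0 s t + 2 * e.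
  by have [_ /le_trans] := cmp s t (lexx s) st (lexx t); apply; rewrite lerD2l.
have omm0 := control_ge0 ommC (lexx s) st (lexx t).
apply: (@le_trans _ _ (A * omm s t `^ theta q)); last first.
  rewrite ler_wpM2l// (ge0_ler_powR (ltW (lt_trans ltr01 th1))) ?nnegrE//.
  exact: le_trans omm_le.
apply: (AP n f M (Z m) omm (ym m) s t fJ M_ge0 st) => //.
- exact: is_increment_sub s0 tT (signature_increment q T0 (xBV m)).
- move=> u v w su uv vt w1 wn.
  have wW : w \in W by rewrite mem_filter wn WP -pq1.
  have -> : `|signature (x m) w u v| * Mw M w = `|wscale mw (Z m) u v w|.
    by rewrite /wscale normrM mulrC (ger0_norm (Mw_ge0 M_ge0 w)).
  have [fin _] := cmp u v su uv vt.
  apply: le_word_control => //; first exact: fin.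
  rewrite /wscale (increment_id (signature_increment q T0 (xBV m))).
  + by rewrite /gone (negbTE wn) mulr0.
  + exact: le_trans su.
  + exact: le_trans uv (le_trans vt tT).
- move=> e' e'0.
  exact: (bv_remainder_small d_gt0 q_ge1 fJ M_ge0 T0 (xBV m) (ymS m) s0 st tT e'0).
- exact: le_trans omm_le ode.
Qed.

End Approximation.

(** * Large controls *)

Section Globalization.
Context {R : realType}.
Implicit Types (s t u v : R).

Lemma pvar_ext q (A B : R -> R -> R) s t :
  (forall u v, s <= u -> u <= v -> v <= t -> A u v = B u v) ->
  pvar q A s t = pvar q B s t.
Proof.
move=> AB; rewrite !pvarE; congr ereal_sup; apply: eq_imagel => P Pp; congr EFin.
apply/le_anti/andP; split.
  have := @psum_le_linear R (fun u v => `|A u v| `^ q) (fun u v => `|B u v| `^ q)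
    (fun u v => `|B u v| `^ q) 1 0 s t P Pp.
  by rewrite mul0r mul1r addr0; apply => u v su uv vt; rewrite AB// mul0r mul1r addr0.
have := @psum_le_linear R (fun u v => `|B u v| `^ q) (fun u v => `|A u v| `^ q)
  (fun u v => `|A u v| `^ q) 1 0 s t P Pp.
by rewrite mul0r mul1r addr0; apply => u v su uv vt; rewrite AB// mul0r mul1r addr0.
Qed.

(** Writing om^th = om^(th-1) om, the first factor is uniformly small on a fine partition and the
    second sums to at most om s t. The number z makes A om(s,t) z^(th-1) <= e. *)
Lemma small_psum F om (A th de s t : R) : 1 < th -> 0 <= A -> 0 < de -> s <= t ->
  is_control om s t ->
  (forall e, 0 < e -> exists2 eta, 0 < eta & forall u v, s <= u -> u <= v -> v <= t ->
     v - u < eta -> om u v <= e) ->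
  (forall u v, s <= u -> u <= v -> v <= t -> om u v <= de -> F u v <= A * om u v `^ th) ->
  forall e, 0 < e -> exists2 P, itv_partition s t P & psum F s P <= e.
Proof.
move=> th1 A0 de0 st omC omS FA e e0.
have om0 := control_ge0 omC (lexx s) st (lexx t).
have th10 : 0 < th - 1 by rewrite subr_gt0.
have D0 : 0 < A * om s t + 1 by rewrite ltr_wpDl// mulr_ge0.
pose z := (e / (A * om s t + 1)) `^ (th - 1)^-1.
have z0 : 0 < z by rewrite powR_gt0// divr_gt0.
have zE : z `^ (th - 1) = e / (A * om s t + 1).
  by rewrite /z -powRrM mulVf ?gt_eqF// powRr1// divr_ge0// ltW.
have e10 : 0 < Num.min de z by rewrite lt_min de0.
have [eta eta0 etaP] := omS _ e10.
have [P Pp Pd] := fine_partition eta0 st; exists P => //.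
apply: le_trans (psum_fine (c := A * z `^ (th - 1)) _ omC _ Pp Pd) _.
- by rewrite mulr_ge0 ?powR_ge0.
- move=> u v su uv vt uvd; have := etaP u v su uv vt uvd; rewrite le_min => /andP[omd omz].
  apply: le_trans (FA u v su uv vt omd) _; rewrite -mulrA ler_wpM2l//.
  have ouv := control_ge0 omC su uv vt.
  rewrite -(mulr_powRB1 ouv (lt_trans ltr01 th1)) mulrC ler_wpM2r//.
  by rewrite (ge0_ler_powR (ltW th10)) ?nnegrE// ltW.
by rewrite zE mulrAC ler_pdivD1 ?(ltW e0) ?mulr_ge0.
Qed.

(* A block is closed as soon as its control exceeds de, and superadditivity bounds
   the number of blocks. *)
Lemma greedy_bound (N om : R -> R -> R) (K de T : R) : 0 < de -> 0 <= K ->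
  is_control om 0 T ->
  (forall u v w, N u w <= N u v + N v w) ->
  (forall u v, 0 <= u -> u <= v -> v <= T -> om u v <= de -> N u v <= K) ->
  forall P s t u, 0 <= u -> u <= s -> t <= T -> itv_partition s t P ->
  (forall k, (k < size P)%N -> N (nth t (s :: P) k) (nth t (s :: P) k.+1) <= 1) ->
  om u s <= de -> N u t <= (K + 1) * (om u t / de + 1).
Proof.
move=> de0 K0 omC tri NK; elim=> [|x P IH] s t u u0 us tT Pp N1 ous.
  have -> : t = s by case: Pp => _ /= /eqP.
  have st := itv_partition_le Pp; have sT := le_trans st tT.
  apply: le_trans (NK u s u0 us sT ous) _.
  have ous0 := control_ge0 omC u0 us sT.
  apply: (@le_trans _ _ (K + 1)); first by rewrite lerDl.
  rewrite -[leLHS]mulr1 ler_wpM2l ?addr_ge0//.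
  by rewrite lerDr divr_ge0// ltW.
have [/= /andP[sx xP] lastP] := Pp.
have Pp' : itv_partition x t P by [].
have xt := itv_partition_le Pp'; have sx' := ltW sx.
have N1' k : (k < size P)%N -> N (nth t (x :: P) k) (nth t (x :: P) k.+1) <= 1.
  by move=> kP; exact: (N1 k.+1).
have x0 := le_trans u0 (le_trans us sx').
have [oux|oux] := leP (om u x) de.
  by apply: (IH x) => //; exact: le_trans sx'.
have h0 : N s x <= 1 by exact: (N1 0%N).
have oxx : om x x <= de.
  have := controlD omC x0 (lexx x) (lexx x) (le_trans xt tT).
  by move=> ?; apply: le_trans (ltW de0); lra.
have h1 := IH x t x x0 (lexx x) tT Pp' N1' oxx.
have h2 := NK u s u0 us (le_trans sx' (le_trans xt tT)) ous.
have hD := controlD omC u0 (le_trans us sx') xt tT.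
have h3 : om x t / de + 1 <= om u t / de.
  rewrite -[X in _ + X](divff (x := de)) ?gt_eqF// -mulrDl ler_wpM2r ?invr_ge0 ?(ltW de0)//.
  by lra.
have h4 : (K + 1) * (om x t / de + 1) <= (K + 1) * (om u t / de).
  by rewrite ler_wpM2l ?addr_ge0.
have := tri u s t; have := tri s x t.
by rewrite mulrDr mulr1; lra.
Qed.

End Globalization.

Section RoughEstimate.
Context {R : realType} {d n : nat}.
Variables (p : 'I_d -> R) (T : R) (X : R -> seq 'I_d -> R).
Variables (f : 'I_d -> 'rV[R]_n -> 'rV[R]_n) (M : 'I_d -> R) (y : R -> 'rV[R]_n).
Hypothesis d_gt0 : (0 < d)%N.
Hypothesis p_ge1 : forall i, 1 <= p i.
Hypothesis T0 : 0 <= T.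
Hypothesis Xw : weakly_geometric p T X.
Hypothesis fJ : forall i, jet_bound (jet_order p i) (M i) (f i).
Hypothesis M_ge0 : forall i, 0 <= M i.

Lemma increment_le W om s t : words p = [set` W] -> uniq W ->
  (forall w, w \in W -> `|incr X s t w| * Mw M w <= om `^ wlen p w) ->
  enorm (\sum_(w \in words p) incr X s t w *: Fw f w (y s)) <=
  \sum_(w <- W) 2 ^+ (size w ^ 2) * om `^ wlen p w.
Proof.
move=> wE uW Xom; rewrite wE -fsbig_seq//.
apply: le_trans (ler_enorm_sum _ _ _) _.
apply: ler_sum_seq => w wW.
have : words p w by rewrite wE.
move=> /andP[]; rewrite (wlen_gt0 p_ge1) => wn w1.
rewrite enormZ; apply: le_trans (ler_wpM2l (normr_ge0 _) (Fw_le d_gt0 p_ge1 fJ M_ge0 _ w1 wn)) _.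
by rewrite mulrCA ler_wpM2l// Xom.
Qed.

(** The step at which [greedy_bound] closes a block may carry a large control, so its increment
    needs a bound of its own. Here eta may depend on everything: it only selects a partition, whose
    number of points does not enter the final estimate. *)
Lemma solution_steps om th (A de : R) : 1 < th -> 0 <= A -> 0 < de -> is_control om 0 T ->
  (forall e, 0 < e -> exists2 eta, 0 < eta & forall u v, 0 <= u -> u <= v -> v <= T ->
     v - u < eta -> om u v <= e) ->
  (forall u v, 0 <= u -> u <= v -> v <= T -> om u v <= de ->
     enorm (remainder p f (incr X) y u v) <= A * om u v `^ th) ->
  exists2 eta, 0 < eta & forall u v, 0 <= u -> u <= v -> v <= T -> v - u < eta ->
    enorm (y v - y u) <= 1.
Proof.
move=> th1 A0 de0 omC omS remA.
have [Ws [uW WP wE]] := short_words p_ge1.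
set W := [seq v <- Ws | v != [::]] in wE.
have {}uW : uniq W by exact: filter_uniq.
pose B w := 2 ^+ (size w ^ 2) * Mw M w : R.
have B0 w : 0 <= B w by rewrite mulr_ge0 ?Mw_ge0.
pose D := \sum_(w <- W) B w + 1.
have D0 : 0 < D by rewrite ltr_wpDl// sumr_ge0.
have /choice[dw dwP] : forall w, exists dw, 0 < dw /\ (w \in W ->
    forall s t, 0 <= s -> s <= t -> t <= T -> t - s < dw -> `|incr X s t w| <= 2^-1 / D).
  have e1 : 0 < 2^-1 / D by rewrite divr_gt0.
  move=> w; have [wW|wW] := boolP (w \in W); last by exists 1.
  have : words p w by rewrite wE.
  move=> /andP[]; rewrite (wlen_gt0 p_ge1) => wn w1.
  by have [dw dw0 dwP] := incr_small p_ge1 T0 Xw w1 wn e1; exists dw.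
pose e1 := Num.min (Num.min 1 de) (2^-1 / (A + 1)).
have A1 : 0 < A + 1 by rewrite ltr_wpDl.
have e10 : 0 < e1 by rewrite !lt_min ltr01 de0 divr_gt0.
have [eta eta0 etaP] := omS _ e10.
exists (\big[Num.min/eta]_(w <- W) dw w); first by apply: lt_bigmin => // w _; have [] := dwP w.
move=> u v u0 uv vT uvd.
have := etaP u v u0 uv vT (lt_le_trans uvd (bigmin_le_id _ _ _ _)).
rewrite !le_min => /andP[/andP[om1 omd] omA].
have o0 := control_ge0 omC u0 uv vT.
rewrite -(subrK (\sum_(w \in words p) incr X u v w *: Fw f w (y u)) (y v - y u)).
rewrite -/(remainder p f (incr X) y u v) (splitr 1) mul1r.
apply: le_trans (ler_enormD _ _) _; apply: lerD.
  apply: le_trans (remA u v u0 uv vT omd) _.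
  apply: (@le_trans _ _ (A * om u v)).
    by rewrite ler_wpM2l// -[leRHS]powRr1// powR_le1 ?o0// ltW.
  apply: le_trans (ler_wpM2l A0 omA) _.
  by rewrite ler_pdivD1.
rewrite wE -fsbig_seq//; apply: le_trans (ler_enorm_sum _ _ _) _.
apply: (@le_trans _ _ (\sum_(w <- W) B w * (2^-1 / D))).
  apply: ler_sum_seq => w wW.
  have : words p w by rewrite wE.
  move=> /andP[]; rewrite (wlen_gt0 p_ge1) => wn w1.
  rewrite enormZ mulrC ler_pM ?enorm_ge0//.
    exact: (Fw_le d_gt0 p_ge1 fJ M_ge0).
  have [_ /(_ wW)] := dwP w; apply => //; apply: lt_le_trans uvd _.
  by apply: ge_bigmin_seq wW _.
by rewrite -mulr_suml ler_pdivD1 ?sumr_ge0.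
Qed.

End RoughEstimate.

Section GlobalEstimate.
Context {R : realType} {d : nat}.
Variable p : 'I_d -> R.
Hypothesis d_gt0 : (0 < d)%N.
Hypothesis p_ge1 : forall i, 1 <= p i.

Lemma rescaled_pvar T X (m : seq 'I_d -> R) w : weakly_geometric p T X -> 0 <= T ->
  words p w -> (pvar (wlen p w)^-1 (fun a b => wscale m (incr X) a b w) 0 T < +oo)%E.
Proof.
move=> Xw T0 ww; have fin := rough_pvar p_ge1 T0 Xw ww.
have lp : 0 < (wlen p w)^-1 by rewrite invr_gt0; move: ww => /andP[].
have [|//] := @pvar_dom R (wlen p w)^-1 _ _ (fun a b => wscale m (incr X) a b w) _ _
  (`|m w| `^ (wlen p w)^-1) 0 0 T T0 (powR_ge0 _ _) (lexx 0) fin fin.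
by move=> u v _ _ _; rewrite mul0r addr0 /wscale normrM powRM.
Qed.

Lemma rough_global_estimate : exists2 C : R, 0 <= C &
  forall n T X (f : 'I_d -> 'rV[R]_n -> 'rV[R]_n) M y,
  0 <= T -> weakly_geometric p T X ->
  (forall i, jet_bound (jet_order p i) (M i) (f i)) -> (forall i, 0 <= M i) ->
  (exists om : R -> R -> R, exists th : R,
    [/\ 1 < th, is_control om 0 T,
      forall e, 0 < e -> exists2 de, 0 < de & forall s t, 0 <= s -> s <= t -> t <= T ->
        t - s < de -> om s t <= e &
      exists2 Ad : R * R, 0 <= Ad.1 /\ 0 < Ad.2 & forall s t, 0 <= s -> s <= t -> t <= T ->
        om s t <= Ad.2 -> enorm (remainder p f (incr X) y s t) <= Ad.1 * om s t `^ th]) ->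
  forall W : seq (seq 'I_d), uniq W -> words p = [set` W] ->
  forall s t, 0 <= s -> s <= t -> t <= T ->
  let om := word_control p W (wscale (Mw M) (incr X)) s t in
  enorm (remainder p f (incr X) y s t) <= C * Num.min (om `^ theta p) om.
Proof.
have [Ws [uW0 WP wE0]] := short_words p_ge1.
pose W0 := [seq v <- Ws | v != [::]].
have uW0' : uniq W0 by exact: filter_uniq.
have [[A de] /= [A0 /andP[de0 de1]] AP] := local_estimate d_gt0 p_ge1.
have th1 := theta_gt1 d_gt0 p_ge1.
have th0 := lt_trans ltr01 th1.
have th10 : 0 < theta p - 1 by rewrite subr_gt0.
pose S := \sum_(w <- W0) 2 ^+ (size w ^ 2) : R.
have S0 : 0 <= S by apply: sumr_ge0 => w _; exact: exprn_ge0.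
pose K := A + S; have K0 : 0 <= K by exact: addr_ge0.
(* K bounds the increment of y over a block with om <= de <= 1. For om > de the number om/de + 1 of
   blocks is at most 2 om/de, and S om/de bounds the sum over the words. *)
pose C1 := (2 * (K + 1) + S) / de.
have C10 : 0 <= C1 by rewrite divr_ge0 ?(ltW de0)// addr_ge0// mulr_ge0// addr_ge0.
(* For om > de one has om <= om^theta / de^(theta-1). This covers de < om < 1, where the linear
   bound must be traded for the smaller power. *)
pose C2 := C1 / de `^ (theta p - 1).
have C20 : 0 <= C2 by rewrite divr_ge0 ?powR_ge0.
exists (A + C1 + C2); first by rewrite !addr_ge0.
move=> n T X f M y T0 Xw fJ M0 [om' [th [th'1 om'C om'S [[A' de'] /= [A'0 de'0] A'P]]]] W uW wE.
have WW0 : perm_eq W W0.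
  apply: uniq_perm => // w; have : [set` W] w = [set` W0] w by rewrite -wE -wE0.
  by move=> /= ww; apply/idP/idP; rewrite ww.
have SE : S = \sum_(w <- W) 2 ^+ (size w ^ 2) by rewrite (perm_big _ WW0).
have Wp w : w \in W -> words p w by rewrite wE.
have W_gt0 w : w \in W -> 0 < wlen p w by move=> /Wp/andP[].
have W_le1 w : w \in W -> wlen p w <= 1 by move=> /Wp/andP[].
pose om u v := word_control p W (wscale (Mw M) (incr X)) u v.
have fin w : w \in W -> (pvar (wlen p w)^-1 (fun a b => wscale (Mw M) (incr X) a b w) 0 T < +oo)%E.
  by move=> wW; apply: rescaled_pvar => //; rewrite wE.
have omC : is_control om 0 T by exact: word_controlP.
have XI := rough_increment p_ge1 Xw.
have Xom u v w : 0 <= u -> u <= v -> v <= T -> w \in W ->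
    `|incr X u v w| * Mw M w <= om u v `^ wlen p w.
  move=> u0 uv vT wW.
  have -> : `|incr X u v w| * Mw M w = `|wscale (Mw M) (incr X) u v w|.
    by rewrite /wscale normrM mulrC (ger0_norm (Mw_ge0 M0 w)).
  apply: le_word_control => //.
    by apply: le_lt_trans (fin w wW); exact: pvar_mono.
  rewrite /wscale (increment_id XI)//; last exact: le_trans vT.
  by rewrite /gone -(negbK (w == _)) -(wlen_gt0 p_ge1) W_gt0// mulr0.
have loc u v : 0 <= u -> u <= v -> v <= T -> om u v <= de ->
    enorm (remainder p f (incr X) y u v) <= A * om u v `^ theta p.
  move=> u0 uv vT omd; apply: (AP n f M (incr X) om y u v fJ M0 uv _ _ _ _ omd).
  - exact: is_increment_sub u0 vT XI.
  - exact: is_control_sub u0 vT omC.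
  - move=> a b w ua ab bv w1 wn; apply: Xom => //; [exact: le_trans ua|exact: le_trans vT|].
    have : words p w by rewrite /words /= w1 (wlen_gt0 p_ge1) wn.
    by rewrite wE.
  - apply: (small_psum th'1 A'0 de'0 uv (is_control_sub u0 vT om'C)).
      move=> e e0; have [eta eta0 etaP] := om'S e e0; exists eta => // a b ua ab bv.
      by apply: etaP => //; [exact: le_trans ua|exact: le_trans vT].
    move=> a b ua ab bv; apply: A'P => //; [exact: le_trans ua|exact: le_trans vT].
have incS u v c : 0 <= u -> u <= v -> v <= T -> (forall w, w \in W -> om u v `^ wlen p w <= c) ->
    enorm (\sum_(w \in words p) incr X u v w *: Fw f w (y u)) <= S * c.
  move=> u0 uv vT omc.
  apply: le_trans (increment_le y d_gt0 p_ge1 fJ M0 wE uW (fun w => Xom u v w u0 uv vT)) _.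
  rewrite SE mulr_suml; apply: ler_sum_seq => w wW.
  by rewrite ler_wpM2l ?exprn_ge0// omc.
have [eta eta0 etaP] := solution_steps d_gt0 p_ge1 T0 Xw fJ M0 th'1 A'0 de'0 om'C om'S A'P.
move=> s t s0 st tT; rewrite -/(om s t) /=.
have o0 := control_ge0 omC s0 st tT.
have [omd|omd] := leP (om s t) de.
  rewrite min_l; last first.
    rewrite -[leRHS]powRr1// powR_le1 ?o0 ?(le_trans omd)// ltW//.
  apply: le_trans (loc s t s0 st tT omd) _.
  by rewrite ler_wpM2r ?powR_ge0// -addrA lerDl addr_ge0.
have NK u v : 0 <= u -> u <= v -> v <= T -> om u v <= de -> enorm (y v - y u) <= K.
  move=> u0 uv vT ouv; have ouv0 := control_ge0 omC u0 uv vT.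
  rewrite -(subrK (\sum_(w \in words p) incr X u v w *: Fw f w (y u)) (y v - y u)).
  rewrite -/(remainder p f (incr X) y u v).
  apply: le_trans (ler_enormD _ _) _; apply: lerD.
    apply: le_trans (loc u v u0 uv vT ouv) _.
    by rewrite -[leRHS]mulr1 ler_wpM2l// powR_le_one ?ouv0 ?(le_trans ouv).
  rewrite -[leRHS]mulr1; apply: incS => // w wW.
  by rewrite powR_le_one ?ouv0 ?(le_trans ouv)// W_gt0.
have [P Pp /(pathP t) Pd] := fine_partition eta0 st.
have oss : om s s <= de.
  have := controlD omC s0 (lexx s) (lexx s) (le_trans st tT).
  by move=> ?; apply: le_trans (ltW de0); lra.
have tri u v w : enorm (y w - y u) <= enorm (y v - y u) + enorm (y w - y v).
  by rewrite -(subrKA (y v)) addrC ler_enormD.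
have N1 k : (k < size P)%N ->
    enorm (y (nth t (s :: P) k.+1) - y (nth t (s :: P) k)) <= 1.
  move=> kP; have [ak _] := nth_partition_bounds Pp (ltnW kP).
  have [_ kb] := nth_partition_bounds Pp kP.
  apply: etaP; [exact: le_trans ak|exact: nth_partition_le|exact: le_trans tT|].
  exact: Pd.
have gr := greedy_bound (N := fun u v => enorm (y v - y u)) de0 K0 omC tri NK
  s0 (lexx s) tT Pp N1 oss.
have ode : 1 <= om s t / de by rewrite ler_pdivlMr// mul1r ltW.
have rem1 : enorm (remainder p f (incr X) y s t) <= C1 * om s t.
  apply: le_trans (ler_enormB _ _) _.
  have -> : C1 * om s t = (K + 1) * (om s t / de + om s t / de) + S * (om s t / de).
    by rewrite /C1; field; rewrite gt_eqF.
  apply: lerD.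
    by apply: le_trans gr _; rewrite ler_wpM2l ?addr_ge0// lerD2l.
  apply: incS => // w wW.
  (* om itself may be below 1; after division by de <= 1 the base is at least 1, and exponents at
     most 1 keep the power below om/de. *)
  apply: (@le_trans _ _ ((om s t / de) `^ wlen p w)).
    rewrite (ge0_ler_powR (ltW (W_gt0 w wW))) ?nnegrE//; first exact: le_trans ode.
    by rewrite ler_pdivlMr// ler_piMr.
  rewrite -[leRHS]powRr1 ?(le_trans _ ode)//.
  by rewrite ler_powR// W_le1.
rewrite /Num.min; case: ifP => _; last first.
  apply: le_trans rem1 _; rewrite ler_wpM2r//.
  by rewrite addrAC lerDr addr_ge0.
apply: (@le_trans _ _ (C2 * om s t `^ theta p)); last first.
  by rewrite ler_wpM2r ?powR_ge0// lerDr addr_ge0.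
apply: le_trans rem1 _; rewrite /C2 -mulrA ler_wpM2l//.
rewrite ler_pdivlMl ?powR_gt0// -[leRHS](mulr_powRB1 o0 th0) mulrC ler_wpM2l//.
by rewrite (ge0_ler_powR (ltW th10)) ?nnegrE ?(ltW de0)// ltW.
Qed.

End GlobalEstimate.

(** * The estimate for path-level solutions *)

Unset Implicit Arguments.
Set Strict Implicit.
Set Printing Implicit Defensive.

Theorem lemma8 (R : realType) (d : nat) (d_gt0 : (0 < d)%N) (p : 'I_d -> R)
    (p_ge1 : forall i, 1 <= p i) :
  exists C : R,
    forall (n : nat) (T : R) (X : R -> seq 'I_d -> R) (gamma : 'I_d -> R)
      (f : 'I_d -> 'rV[R]_n -> 'rV[R]_n) (xi : 'rV[R]_n) (y : R -> 'rV[R]_n),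
    0 <= T ->
    weakly_geometric p T X ->
    (forall i, pmax p * (1 - (p i)^-1) + 1 < gamma i) ->
    (forall i, is_Lip (gamma i) (f i)) ->
    path_level_solution p T X gamma f xi y ->
    forall s t : R, 0 <= s -> s <= t -> t <= T ->
      ((enorm (y t - y s -
               \sum_(w \in words p) incr X s t w *: Fw f w (y s)))%:E
        <= C%:E * mine (omega p (rescale gamma f X) s t `^ theta p)
                       (omega p (rescale gamma f X) s t))%E.
Proof.
have [C C0 CP] := rough_global_estimate d_gt0 p_ge1.
exists C => n T X gamma f xi y T0 Xw gammap fL [q [x [ym [[pq gammaq pq1] xBV xX ymS ymy]]]].
move=> s t s0 st tT.
have q_ge1 i : 1 <= q i by exact: le_trans (p_ge1 i) (ltW (pq i)).
have gamma0 i : 0 < gamma i by exact: (gamma_gt0 d_gt0 p_ge1 (gammap i)).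
(* With the Lip norms themselves as bounds, the weight [Mw M] is that of the rescaled path. *)
pose M i := Lip_norm (gamma i) (f i).
have fB i : Lip_bound (gamma i) (f i) (M i) by exact: Lip_norm_bound.
have M0 i : 0 <= M i by exact: Lip_bound_ge0 (fB i).
have jets N i : (N <= lip_order (gamma i))%N -> jet_bound N (M i) (f i).
  by apply: Lip_jet => //; have [] := fL i.
have fJp i : jet_bound (jet_order p i) (M i) (f i).
  exact: jets (jet_order_le d_gt0 p_ge1 (gammap i)).
(* gamma also exceeds the threshold for the larger exponents, so the same bounds M serve in the
   first pass. *)
have fJq i : jet_bound (jet_order q i) (M i) (f i).
  exact: jets (jet_order_le d_gt0 q_ge1 (gammaq i)).
have loc := rough_local_estimate d_gt0 p_ge1 T0 Xw pq pq1 fJq M0 xBV xX ymS ymy.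
have [Ws [uW0 _ wE]] := short_words p_ge1.
have uW : uniq [seq v <- Ws | v != [::]] by exact: filter_uniq.
have est := CP n T X f M y T0 Xw fJp M0 loc _ uW wE s t s0 st tT.
have Wp w : w \in [seq v <- Ws | v != [::]] -> words p w by rewrite wE.
(* Rescaling commutes with taking increments, and the variations are finite, so the extended-real
   control is the real one of the estimate. *)
have -> : omega p (rescale gamma f X) s t =
    (word_control p [seq v <- Ws | v != [::]] (wscale (Mw M) (incr X)) s t)%:E.
  rewrite /omega wE -fsbig_seq// /word_control -sumEFin.
  rewrite big_seq [RHS]big_seq; apply: eq_bigr => w /Wp ww.
  have fin := rescaled_pvar p_ge1 (Mw M) Xw T0 ww.
  have fst : (pvar (wlen p w)^-1 (fun a b => wscale (Mw M) (incr X) a b w) s t < +oo)%E.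
    by apply: le_lt_trans fin; exact: pvar_mono.
  rewrite -(vrE st fst).
  apply: pvar_ext => u v su uv vt; rewrite /wscale incr_rescale//.
  apply: (rough_nil Xw); first exact: le_trans su.
  exact: le_trans uv (le_trans vt tT).
by rewrite poweR_EFin -EFin_min -EFinM lee_fin.
Qed.
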